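(* Let $\Phi:\mathbb{R}^2\to\mathbb{R}^2$ be a smooth mapping, let $\Sigma=\{x\in\mathbb{R}^2:\Phi(x)=x\}$, and let $S(x)=\sigma(\Phi(x),x)$, where $\sigma(x,x')=\tfrac12|x-x'|^2$. Assume: ($\Phi$.1) $\Sigma$ is a smooth compact connected one-dimensional submanifold of $\mathbb{R}^2$ without boundary. ($\Phi$.2) There exist constants $p>0$, $R>0$, $C>0$ such that for any $x\in\mathbb{R}^2$, if $\sigma(x,0)>\frac{R^2}{2}$, then $S(x)\geqslant C[\sigma(x,0)]^p$. ($\Phi$.3) $s_2>0$ at all points of $\Sigma$, where $s_k=\nabla^k_{\mathbf h}S|_\Sigma$ is the $k$-th normal derivative of $S$ on $\Sigma$. Then the first coefficients of the asymptotic expansion $\Theta_\Phi(t)\sim\sum_{k=0}^\infty t^{(2k-1)/2}\int_\Sigma\mathrm{dvol}(y)\,a_k(y)$ as $t\to0^+$ are given by $$a_0=(4\pi s_2)^{-1/2},$$ $$a_1=(4\pi s_2)^{-1/2}\left[\left(-s_3\kappa-\tfrac14s_4\right)s_2^{-2}+\tfrac{5}{12}s_3^2s_2^{-3}\right],$$ $$a_2=(4\pi s_2)^{-1/2}\Big[\left(-\tfrac12s_5\kappa-\tfrac1{12}s_6\right)s_2^{-3}+\left(\tfrac{35}{12}s_3s_4\kappa+\tfrac7{12}s_3s_5+\tfrac{35}{96}s_4^2\right)s_2^{-4}+\left(-\tfrac{35}{12}s_3^3\kappa-\tfrac{35}{16}s_3^2s_4\right)s_2^{-5}+\tfrac{385}{288}s_3^4s_2^{-6}\Big],$$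 where, with $\Psi^\alpha_{(k)}(y)=\frac{\partial^k}{\partial z^k}\big|_{z=0}\Psi^\alpha(f(y)+z\mathbf h(y))$ and $\Psi^\alpha(x)=\Phi^\alpha(x)-x^\alpha$, $$s_2=\Psi^\alpha_{(1)}\Psi_{\alpha(1)},\quad s_3=3\Psi^\alpha_{(1)}\Psi_{\alpha(2)},\quad s_4=4\Psi^\alpha_{(1)}\Psi_{\alpha(3)}+3\Psi^\alpha_{(2)}\Psi_{\alpha(2)},$$ $$s_5=5\Psi^\alpha_{(1)}\Psi_{\alpha(4)}+10\Psi^\alpha_{(2)}\Psi_{\alpha(3)},\quad s_6=6\Psi^\alpha_{(1)}\Psi_{\alpha(5)}+15\Psi^\alpha_{(2)}\Psi_{\alpha(4)}+10\Psi^\alpha_{(3)}\Psi_{\alpha(3)}.$$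
   Context: The plane $\mathbb{R}^2$ carries the Euclidean metric and Cartesian coordinates; repeated indices are summed. The deformed heat trace is $$\Theta_\Phi(t)=\int_{\mathbb{R}^2}dx\,U(t;\Phi(x),x)=(4\pi t)^{-1}\int_{\mathbb{R}^2}dx\,\exp\left(-\frac{1}{2t}S(x)\right),$$ where $U(t;x,x')=(4\pi t)^{-1}\exp\left(-\frac{\sigma(x,x')}{2t}\right)$ is the heat kernel. $\mathbf h$ is a smooth unit normal vector field along $\Sigma$, $x=f(y)$ is a parametrization of $\Sigma$, and $s_k(y)=\frac{d^k}{dz^k}\big|_{z=0}S(f(y)+z\,\mathbf h(y))$. $\mathrm{dvol}(y)=\gamma(y)^{1/2}dy$ is the arc-length element of $\Sigma$, where $\gamma$ is the induced metric. The parameter $y$ is oriented so that $(\partial f/\partial y,\mathbf h)$ is positively oriented, and $\kappa=\gamma^{-1/2}\,\epsilon_{\alpha\beta}\frac{\partial h^\alpha}{\partial y}h^\beta$, where $\epsilon_{\alpha\beta}$ is the Levi-Civita symbol with $\epsilon_{12}=1$ (so the area element in coordinates $x=f(y)+z\mathbf h(y)$ is $(1+z\kappa)\gamma^{1/2}dy\,dz$). The asymptotic expansion $F(t)\sim\sum_k t^{(2k-1)/2}A_k$ means that for every $K$, $F(t)-\sum_{k=0}^{K}t^{(2k-1)/2}A_k=o(t^{(2K-1)/2})$ as $t\to0^+$. The density $a_k$ is the one obtained by integrating over the normal coordinate: writing $B(t,y,z)=\exp\left(-\frac12\sum_{j\geqslant3}\frac{t^{j/2-1}}{j!}s_jz^j\right)(1+t^{1/2}z\kappa)$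 as a formal power series in $t^{1/2}$, and letting $b_k$ be the coefficient of $t^k$, one has $a_k=\frac1{4\pi}\int_{-\infty}^\infty dz\,e^{-s_2z^2/4}\,b_k$. *)

(* Defs.v *)
From HB Require Import structures.
From mathcomp Require Import all_boot all_order all_algebra.
From mathcomp Require Import all_classical all_reals all_analysis.

Set Implicit Arguments.
Unset Strict Implicit.
Unset Printing Implicit Defensive.

Import Order.TTheory GRing.Theory Num.Theory.
Import numFieldNormedType.Exports.

Local Open Scope classical_set_scope.
Local Open Scope ring_scope.

(* The library norm on R * R is the max norm, so the Euclidean structure is
   given by dot. *)
Definition dot (R : realType) (a b : R * R) : R := a.1 * b.1 + a.2 * b.2.

(* epsilon_{alpha beta} a^alpha b^beta with epsilon_{12} = 1 *)
Definition cross (R : realType) (a b : R * R) : R := a.1 * b.2 - a.2 * b.1.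

Definition sigma (R : realType) (x x' : R * R) : R :=
  2^-1 * dot (x - x') (x - x').

Section smoothness.
Variable R : realType.

(* g is n times continuously differentiable on D (meant for open D): its
   iterated partial derivatives of order at most n exist and are continuous. *)
Fixpoint C_on (n : nat) (D : set (R * R)) (g : R * R -> R) : Prop :=
  (forall x, D x -> {for x, continuous g}) /\
  if n is m.+1 then
    [/\ forall x, D x -> derivable g x (1, 0) /\ derivable g x (0, 1),
        C_on m D ('D_(1, 0) g) & C_on m D ('D_(0, 1) g)]
  else True.

Definition smooth_map_on (D : set (R * R)) (F : R * R -> R * R) : Prop :=
  forall n, C_on n D (fst \o F) /\ C_on n D (snd \o F).

Definition smooth_curve (c : R -> R * R) : Prop :=
  forall k y, derivable (derive1n k (fst \o c)) y 1 /\
              derivable (derive1n k (snd \o c)) y 1.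

Definition velocity (c : R -> R * R) (y : R) : R * R :=
  (derive1 (fst \o c) y, derive1 (snd \o c) y).

(* Smooth one-dimensional embedded submanifold without boundary: around each
   of its points there is a diffeomorphism phi : U -> V between open sets of the
   plane, with inverse psi, straightening M to the first coordinate axis. *)
Definition submanifold1 (M : set (R * R)) : Prop :=
  forall x, M x -> exists U V (phi psi : R * R -> R * R),
    [/\ open U /\ open V, U x,
        smooth_map_on U phi /\ smooth_map_on V psi,
        (forall u, U u -> V (phi u) /\ psi (phi u) = u) /\
        (forall v, V v -> U (psi v) /\ phi (psi v) = v) &
        forall u, U u -> (M u <-> (phi u).2 = 0)].

(* f is a regular parametrization of the closed curve M, of period L *)
Definition closed_parametrization (M : set (R * R)) (L : R) (f : R -> R * R) :
    Prop :=
  [/\ 0 < L, smooth_curve f /\ (forall y, velocity f y != 0),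
      forall y, f (y + L) = f y,
      {in `[0, L[ &, injective f} & range f = M].

(* y |-> h y is the vector field along the curve at the point f y *)
Definition oriented_unit_normal (L : R) (f h : R -> R * R) : Prop :=
  [/\ smooth_curve h, forall y, h (y + L) = h y,
      forall y, dot (h y) (h y) = 1,
      forall y, dot (velocity f y) (h y) = 0 &
      forall y, 0 < cross (velocity f y) (h y)].

End smoothness.

Definition fixed_points (R : realType) (Phi : R * R -> R * R) : set (R * R) :=
  [set x | Phi x = x].

Definition S_of (R : realType) (Phi : R * R -> R * R) (x : R * R) : R :=
  sigma (Phi x) x.

Definition heat_kernel (R : realType) (t : R) (x x' : R * R) : R :=
  (4 * pi * t)^-1 * expR (- (sigma x x' / (2 * t))).

Definition heat_trace (R : realType) (Phi : R * R -> R * R) (t : R) : R :=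
  \int[(@lebesgue_measure R \x @lebesgue_measure R)%E]_x heat_kernel t (Phi x) x.

Section normal_data.
Variables (R : realType) (Phi : R * R -> R * R) (f h : R -> R * R).

Definition nderiv (g : R * R -> R) (k : nat) (y : R) : R :=
  derive1n k (fun z : R => g (f y + z *: h y)) 0.

Definition s_ (k : nat) (y : R) : R := nderiv (S_of Phi) k y.

Definition Psi (x : R * R) : R * R := Phi x - x.

Definition Psi_ (k : nat) (y : R) : R * R :=
  (nderiv (fst \o Psi) k y, nderiv (snd \o Psi) k y).

Definition metric (y : R) : R := dot (velocity f y) (velocity f y).

Definition curvature (y : R) : R :=
  (metric y) `^ (- 2^-1) * cross (velocity h y) (h y).

Definition arc_integral (L : R) (a : R -> R) : R :=
  \int[lebesgue_measure]_(y in `[0, L]) (a y * (metric y) `^ 2^-1).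

End normal_data.

(* Formal power series, as coefficient sequences. *)
Section formal_series.
Variable R : realType.

Definition fps_one (n : nat) : R := (n == 0%N)%:R.

Definition fps_mul (a b : nat -> R) (n : nat) : R :=
  \sum_(i < n.+1) a i * b (n - i)%N.

Definition fps_pow (a : nat -> R) (m : nat) : nat -> R :=
  iter m (fps_mul a) fps_one.

(* Exponential of a series with zero constant term: as (a ^ m)_n = 0 for
   m > n, the sum over m stops at n. *)
Definition fps_exp (a : nat -> R) (n : nat) : R :=
  \sum_(m < n.+1) fps_pow a m n / m`!%:R.

(* Series in the variable tau = t^(1/2); the coefficient of tau^i in the
   exponent corresponds to j = i + 2. *)
Definition B_exponent (s : nat -> R) (z : R) (i : nat) : R :=
  if i is 0%N then 0 else - (2^-1 * (s i.+2 / (i.+2)`!%:R * z ^+ i.+2)).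

Definition B_jacobian (kappa z : R) (i : nat) : R :=
  match i with 0%N => 1 | 1%N => z * kappa | _ => 0 end.

Definition B_series (s : nat -> R) (kappa z : R) : nat -> R :=
  fps_mul (fps_exp (B_exponent s z)) (B_jacobian kappa z).

(* coefficient of t^k = tau^(2k) *)
Definition b_ (s : nat -> R) (kappa : R) (k : nat) (z : R) : R :=
  B_series s kappa z k.*2.

Definition a_ (s : nat -> R) (kappa : R) (k : nat) : R :=
  (4 * pi)^-1 *
  \int[lebesgue_measure]_z (expR (- (s 2%N * z ^+ 2 / 4)) * b_ s kappa k z).

End formal_series.

(* F(t) ~ sum_k t^((2k-1)/2) A_k as t -> 0+ *)
Definition half_integer_expansion (R : realType) (F : R -> R) (A : nat -> R) :
    Prop :=
  forall K : nat,
    (fun t : R => F t - \sum_(k < K.+1) t `^ ((2 * k%:R - 1) / 2) * A k)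
      =o_ (0^'+) (fun t : R => t `^ ((2 * K%:R - 1) / 2)).

(* Main.v *)
(* In Fermi coordinates x = f(y) + z h(y) a tube around Sigma carries the
   area element (1 + z kappa) gamma^(1/2) dy dz. Off the tube S is bounded
   below by a positive constant (compactness, then the growth condition
   (Phi.2)), so the exterior contributes O(exp(-c/t)). In the tube put
   tau = t^(1/2) and rescale z -> tau z: since S and its first normal derivative
   vanish on Sigma, S / (2 t) becomes s_2 z^2 / 4 plus a power series in tau,
   and Taylor's formula expands exp(-S / (2 t)) (1 + tau z kappa) with a
   remainder O(tau^(N+1)) dominated by a polynomial times a Gaussian, uniformly
   in y. The terms of odd order in tau are odd in z and integrate to 0; the even
   ones are Gaussian moments of polynomials, which give a_0, a_1, a_2. *)
Require Import Defs.
From HB Require Import structures.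
From mathcomp Require Import all_boot all_order all_algebra.
From mathcomp Require Import all_classical all_reals all_analysis.
From mathcomp Require Import measurable_realfun ring lra zify.

Import Order.TTheory GRing.Theory Num.Theory.
Import numFieldNormedType.Exports.

Set Implicit Arguments.
Unset Strict Implicit.
Unset Printing Implicit Defensive.

Local Open Scope classical_set_scope.
Local Open Scope ring_scope.

(** * Change of variables in one dimension *)

(** The delicate step is the area formula for the tube. On a short piece of the curve one component
    of the unit normal, say [h2], keeps its sign, so (parameter, height of the point) serves as an
    intermediate coordinate system. Passing from z to the height at fixed y, exchanging the
    integrals by Tonelli, and passing from y to the abscissa at fixed height produces two scalar
    Jacobians whose product is the determinant. Integrands there are nonnegative with extended real
    values, so the formula needs no integrability; intervals are half-open so that the pieces tile a
    period without overlap. Uniformity in the Laplace step comes from an algebra of truncated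
    expansions in tau whose coefficients and errors grow at most polynomially in 1 + |z|. It mirrors
    [fps_mul] and [fps_exp] coefficient by coefficient, so the densities [a_] appear exactly as they
    are defined. The one factor without polynomial bound, the exponential of the non-quadratic part
    of the exponent, is carried as a separate weight; a thin enough tube lets half of the Gaussian
    absorb it. *)

Section transport.
Local Open Scope ereal_scope.
Context d1 d2 (X : measurableType d1) (Y : measurableType d2) (R : realType).
Variables (mu : {measure set X -> \bar R}) (nu : {measure set Y -> \bar R}).
Variables (D : set X) (E : set Y) (phi : X -> Y) (w : X -> R).
Hypotheses (mD : measurable D) (mE : measurable E).
Hypotheses (mphi : measurable_fun D phi) (mw : measurable_fun D w).
Hypothesis w0 : forall x, D x -> (0 <= w x)%R.
Hypothesis phiE : forall A, measurable A ->
  \int[mu]_(x in D) (w x * \1_A (phi x))%:E = nu (A `&` E).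

Import HBNNSimple.

(** The hypothesis [phiE] says that [phi] carries the measure with density [w] on [D] to [nu]
    restricted to [E], tested on sets only. Linearity extends it to simple functions and monotone
    convergence to [G]; [w0] keeps the weighted approximations increasing. *)
Lemma transport_ge0_integral (G : Y -> \bar R) :
  measurable_fun setT G -> (forall y, 0 <= G y) ->
  \int[mu]_(x in D) ((w x)%:E * G (phi x)) = \int[nu]_(y in E) G y.
Proof.
move=> mG G0.
pose g_ := nnsfun_approx measurableT mG.
have gG y : limn (fun n => (g_ n y)%:E) = G y.
  by apply/cvg_lim => //; apply: cvg_nnsfun_approx.
have sE n : \int[mu]_(x in D) (w x * g_ n (phi x))%:E =
    \int[nu]_(y in E) (g_ n y)%:E.
  transitivity (\int[mu]_(x in D) (\sum_(k \in range (g_ n))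
      (w x * (k * \1_(g_ n @^-1` [set k]) (phi x)))%:E)).
    apply: eq_integral => x _; rewrite fsumEFin//; congr EFin.
    rewrite {1}(fimfunE (g_ n)) !fsbig_finite//=.
    by rewrite mulr_sumr.
  rewrite ge0_integral_fsum//; last 2 first.
  - move=> k; apply/measurable_EFinP/measurable_funM => //.
    by apply/measurable_funM => //; apply: measurableT_comp.
  - move=> k x Dx; rewrite lee_fin mulr_ge0 ?w0//.
    by have := nnfun_muleindic_ge0 (g_ n) k (phi x); rewrite -EFinM lee_fin.
  transitivity (\int[nu]_(y in E) (\sum_(k \in range (g_ n))
      (k * \1_(g_ n @^-1` [set k]) y)%:E)); last first.
    by apply: eq_integral => y _; rewrite fsumEFin// -fimfunE.
  rewrite ge0_integral_fsum//; last 2 first.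
  - by move=> k; apply/measurable_EFinP/measurable_funM.
  - by move=> k x _; rewrite nnfun_muleindic_ge0.
  apply: eq_fsbigr => k.
  rewrite inE => -[y _ yk].
  have k0 : (0 <= k)%R by rewrite -yk.
  transitivity (k%:E * \int[mu]_(x in D)
      (w x * \1_(g_ n @^-1` [set k]) (phi x))%:E).
    rewrite -ge0_integralZl//=.
    - by apply: eq_integral => x _; rewrite -EFinM mulrCA.
    - apply/measurable_EFinP/measurable_funM => //.
      by apply: measurableT_comp.
    - by move=> x Dx; rewrite lee_fin mulr_ge0 ?w0.
  rewrite phiE// -integral_indic// -ge0_integralZl//.
  by apply/measurable_EFinP.
transitivity (limn (fun n => \int[mu]_(x in D) (w x * g_ n (phi x))%:E)).
  rewrite -monotone_convergence//.
  - apply: eq_integral => x /[!inE] Dx.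
    apply/esym/cvg_lim => //; under eq_fun do rewrite EFinM.
    by apply: cvgeZl => //; apply: cvg_nnsfun_approx.
  - move=> n; apply/measurable_EFinP/measurable_funM => //.
    by apply: measurableT_comp.
  - by move=> n x Dx; rewrite lee_fin mulr_ge0 ?w0.
  - move=> x Dx m n mn; rewrite lee_fin ler_wpM2l ?w0//.
    exact/lefP/nd_nnsfun_approx.
under eq_fun do rewrite sE.
rewrite -monotone_convergence//.
- by apply: eq_integral => y _; exact: gG.
- by move=> n; apply/measurable_EFinP; exact: measurable_funTS.
- by move=> n y _; rewrite lee_fin; exact: fun_ge0.
- by move=> y _ m n mn; rewrite lee_fin; exact/lefP/nd_nnsfun_approx.
Qed.

End transport.

Section substitution.
Context {R : realType}.
Implicit Types (H dH : R -> R) (a b : R) (G : R -> \bar R).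
Local Notation mu := (@lebesgue_measure R).

Lemma is_derive1_continuous H dH (y : R) : is_derive y 1 H (dH y) ->
  {for y, continuous H}.
Proof.
by move=> ?; apply/differentiable_continuous/derivable1_diffP; exact: ex_derive.
Qed.

Lemma is_derive_pos_incr H dH a b :
  {in `[a, b], forall y : R, is_derive y 1 H (dH y)} ->
  {in `[a, b], forall y, 0 < dH y} ->
  {in `[a, b] &, {homo H : x y / x < y}}.
Proof.
move=> HE dH0 x y xab yab xy.
have sub z : z \in `[x, y] -> z \in `[a, b].
  move: xab yab; rewrite !in_itv/= => /andP[? ?] /andP[? ?] /andP[? ?].
  by apply/andP; split; [exact: (@le_trans _ _ x)|exact: (@le_trans _ _ y)].
have [z zxy] := @MVT R H dH x y xy
  (fun z zxy => HE z (sub z (subset_itv_oo_cc zxy)))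
  (continuous_in_subspaceT (fun z zxy =>
     is_derive1_continuous (HE z (sub z (set_mem zxy))))).
rewrite -subr_gt0 => ->; rewrite mulr_gt0 ?subr_gt0//.
exact/dH0/sub/subset_itv_oo_cc.
Qed.

(** By [transport_ge0_integral] only indicators need checking. Both sides are then measures of the
    set in question, equal by uniqueness once they agree on open rays, where the claim is the
    fundamental theorem of calculus. *)
Lemma ge0_substitution_incr H dH a b G : a < b ->
  {in `[a, b], forall y : R, is_derive y 1 H (dH y)} ->
  {in `[a, b], forall y : R, {for y, continuous dH}} ->
  {in `[a, b], forall y, 0 < dH y} ->
  measurable_fun setT G -> (forall x, 0 <= G x)%E ->
  (\int[mu]_(y in `[a, b[) ((dH y)%:E * G (H y)) =
   \int[mu]_(x in `[H a, H b[) G x)%E.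
Proof.
move=> ab HE cdH dH0 mG G0.
have Hincr := is_derive_pos_incr HE dH0.
have aab : a \in `[a, b] by rewrite in_itv/= lexx ltW.
have bab : b \in `[a, b] by rewrite in_itv/= lexx ltW.
have cH : {within `[a, b], continuous H}.
  by apply: continuous_in_subspaceT => z /set_mem zab;
    apply: is_derive1_continuous (HE z zab).
have cdHw : {within `[a, b], continuous dH}.
  by apply: continuous_in_subspaceT => z /set_mem zab; exact: cdH.
have sub : `[a, b[ `<=` `[a, b] by exact: subset_itv_co_cc.
have mH : measurable_fun `[a, b[ H.
  apply: (measurable_funS _ sub) => //.
  exact: subspace_continuous_measurable_fun.
have mdH : measurable_fun `[a, b[ dH.
  apply: (measurable_funS _ sub) => //.
  exact: subspace_continuous_measurable_fun.
have HaHb : H a < H b by exact: Hincr.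
apply: transport_ge0_integral => // [y yab|A mA]; first exact/ltW/dH0/sub.
pose m (A : set (measurableTypeR R)) := (\int[mu]_(y in `[a, b[) (dH y * \1_A (H y))%:E)%E.
have m0 : m set0 = 0%E.
  by rewrite /m integral0_eq// => y _; rewrite indic0 mulr0.
have mge0 (B : set (measurableTypeR R)) : (0 <= m B)%E.
  apply: integral_ge0 => y yab; rewrite lee_fin mulr_ge0 ?indic_ge0//.
  exact/ltW/dH0/sub.
have madd : semi_sigma_additive m.
  move=> F mF tF mUF.
  have -> : m (\bigcup_n F n) = (\sum_(0 <= i <oo) m (F i))%E.
    rewrite /m -integral_nneseries//; last 2 first.
    - move=> n; apply/measurable_EFinP/measurable_funM => //.
      apply: (@measurableT_comp _ _ _ _ _ _ (\1_(F n) : measurableTypeR R -> R) _ _ _ mH).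
      exact: measurable_indic.
    - move=> n y yab; rewrite lee_fin mulr_ge0 ?indic_ge0//.
      exact/ltW/dH0/sub.
    apply: eq_integral => y /set_mem yab.
    have dHy : (0 <= dH y)%R by exact/ltW/dH0/sub.
    rewrite EFinM; under eq_eseriesr do rewrite EFinM.
    rewrite nneseriesZl//; congr (_ * _)%E.
    exact: indic_bigcup.
  by apply: is_cvg_ereal_nneg_natsum_cond => n _ _; exact: mge0.
pose M : {measure set (measurableTypeR R) -> \bar R} :=
  HB.pack m (isMeasure.Build _ _ _ m m0 mge0 madd).
pose N : {measure set (measurableTypeR R) -> \bar R} :=
  mrestr mu (measurable_itv `[H a, H b[).
suff : m A = N A by exact.
(* Rays are stable under intersection, generate the Borel sets and exhaust the line; uniqueness also
   needs finite mass on them, which holds because [N] is carried by a bounded interval. *)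
suff MN (x : R) : m `]-oo, x[%classic = N `]-oo, x[%classic.
  apply: (@measure_unique _ R (measurableTypeR R) (@RGenInftyO.G R)
    (fun k => `]-oo, k%:R[%classic) _ _ _ _ M N _ _ A mA).
  - exact: RGenInftyO.measurableE.
  - move=> _ _ [x ->] [y ->]; exists (Num.min x y).
    by apply/seteqP; split=> z; rewrite /= !in_itv/= lt_min => /andP.
  - by move=> k; exists k%:R.
  - apply/seteqP; split=> // x _.
    exists (Num.truncn `|x|).+1 => //=; rewrite in_itv/=.
    by rewrite (le_lt_trans (ler_norm _))// truncnS_gt.
  - by move=> _ [x ->]; exact: MN.
  - move=> k /=; rewrite MN /N /mrestr.
    apply: (@le_lt_trans _ _ (mu `[H a, H b[)).
      by apply: le_measure; rewrite ?inE//; apply: measurableI.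
    by rewrite lebesgue_measure_itv/= lte_fin HaHb -EFinB ltry.
(* Clamping [x] to the range of [H] lets a single intermediate value [q] describe the preimage of
   the ray, including rays that miss the range or contain it: then [q] is [a] or [b]. *)
pose c := Num.min (Num.max x (H a)) (H b).
have [q qab Hq] : exists2 q, q \in `[a, b] & H q = c.
  apply: IVT => //; first exact: ltW.
  rewrite (min_l (ltW HaHb)) (max_r (ltW HaHb)) /c.
  by rewrite le_min (ltW HaHb) le_max lexx orbT/= ge_min lexx orbT.
have Hlt y : y \in `[a, b[ -> (H y < x) = (y < q).
  move=> yab; have yab' := sub _ yab.
  have -> : (y < q) = (H y < c).
    rewrite -Hq; apply/idP/idP => [|]; first exact: Hincr.
    apply: contraTT; rewrite -!leNgt le_eqVlt => /predU1P[->//|qy].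
    exact/ltW/Hincr.
  move: yab; rewrite in_itv/= => /andP[ay yb].
  have HyHb : H y < H b by exact: Hincr.
  rewrite /c lt_min HyHb andbT lt_max.
  suff -> : (H y < H a) = false by rewrite orbF.
  apply/negbTE; rewrite -leNgt; move: ay.
  by rewrite le_eqVlt => /predU1P[->//|ay]; exact/ltW/Hincr.
have [aq qb] : a <= q /\ q <= b by move: qab; rewrite in_itv/= => /andP.
transitivity (\int[mu]_(y in `[a, q[) (dH y)%:E)%E.
  rewrite [RHS]integral_mkcond [LHS]integral_mkcond; apply: eq_integral => y _.
  rewrite !patchE; case: ifPn => [/set_mem yab|yab].
    have := Hlt y yab; rewrite indicE => E.
    case: ifPn => [/set_mem|] yaq.
      rewrite mem_set ?mulr1//=.
      by rewrite in_itv/= E; move: yaq; rewrite /= in_itv/= => /andP[].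
    rewrite memNset ?mulr0// => /=.
    rewrite in_itv/= E => yq; move: yaq; rewrite notin_setE; apply.
    by rewrite /= in_itv/= yq; move: yab; rewrite /= in_itv/= => /andP[->].
  case: ifPn => // /set_mem yaq; exfalso.
  move: yab; rewrite notin_setE; apply; move: yaq.
  by rewrite /= !in_itv/= => /andP[-> /lt_le_trans ->].
have -> : (N `]-oo, x[%classic = mu `[H a, H q[%classic)%E.
  rewrite /N /mrestr; congr (mu _); rewrite Hq /c.
  apply/seteqP; split=> z/=; rewrite !in_itv/= lt_min lt_max.
    by move=> [-> /andP[-> ->]].
  move=> /andP[Haz /andP[/orP[->|zHa] ->]]; rewrite Haz//.
  by have := le_lt_trans Haz zHa; rewrite ltxx.
move: aq; rewrite le_eqVlt => /predU1P[<-|aq].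
  by rewrite !set_itv_ge ?integral_set0 ?measure0// bnd_simp ltxx.
have sub' : `[a, q] `<=` `[a, b].
  by move=> z; rewrite /= !in_itv/= => /andP[-> /le_trans ->].
have sub'' : `[a, q[ `<=` `[a, b[.
  by move=> z; rewrite /= !in_itv/= => /andP[-> /lt_le_trans ->].
have HaHq : H a < H q by exact: Hincr.
rewrite lebesgue_measure_itv/= lte_fin HaHq integral_itv_bndo_bndc; last first.
  by apply/measurable_EFinP; apply: measurable_funS mdH.
apply: continuous_FTC2 => //.
- by apply: continuous_subspaceW cdHw.
- have cHw : {within `[a, q], continuous H} by apply: continuous_subspaceW cH.
  split.
  + move=> z zaq; have ? := HE z (sub' _ (subset_itv_oo_cc zaq)).
    exact: ex_derive.
  + apply: cvg_at_right_filter.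
    by apply: is_derive1_continuous (HE a aab).
  + apply: cvg_at_left_filter.
    by apply: is_derive1_continuous (HE q qab).
- move=> z zaq; rewrite derive1E.
  by have ? := HE z (sub' _ (subset_itv_oo_cc zaq)); rewrite derive_val.
Qed.

Lemma incr_image_co H a b : a < b -> {within `[a, b], continuous H} ->
  {in `[a, b] &, {homo H : x y / x < y}} ->
  H @` `[a, b[%classic = `[H a, H b[%classic.
Proof.
move=> ab cH Hincr.
have aab : a \in `[a, b] by rewrite in_itv/= lexx ltW.
have bab : b \in `[a, b] by rewrite in_itv/= lexx ltW.
have HaHb : H a < H b by exact: Hincr.
apply/seteqP; split=> [_ [y yab <-]|x].
  have yab' := subset_itv_co_cc yab.
  move: yab; rewrite /= !in_itv/= => /andP[ay yb].
  rewrite Hincr// andbT; move: ay; rewrite le_eqVlt => /predU1P[->//|ay].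
  exact/ltW/Hincr.
rewrite /= in_itv/= => /andP[Hax xHb].
have [q qab Hq] : exists2 q, q \in `[a, b] & H q = x.
  apply: IVT => //; first exact: ltW.
  by rewrite (min_l (ltW HaHb)) (max_r (ltW HaHb)) Hax ltW.
exists q => //; move: qab; rewrite /= !in_itv/= => /andP[-> /=].
by rewrite le_eqVlt => /predU1P[qb|//]; move: xHb; rewrite -Hq qb ltxx.
Qed.

(** The decreasing case is the increasing one for [- H], followed by a reflection of Lebesgue
    measure. A decreasing [H] yields an interval open on the left, which is why the target is
    written as an image, with its measurability part of the conclusion. *)
Lemma ge0_substitution H dH a b G : a < b ->
  {in `[a, b], forall y : R, is_derive y 1 H (dH y)} ->
  {in `[a, b], forall y : R, {for y, continuous dH}} ->
  {in `[a, b], forall y : R, 0 < dH y} \/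
    {in `[a, b], forall y : R, dH y < 0} ->
  measurable_fun setT G -> (forall x, 0 <= G x)%E ->
  measurable (H @` `[a, b[%classic) /\
  (\int[mu]_(y in `[a, b[) (`|dH y|%:E * G (H y)) =
   \int[mu]_(x in H @` `[a, b[%classic) G x)%E.
Proof.
move=> ab HE cdH [dH0|dH0] mG G0.
  have Hincr := is_derive_pos_incr HE dH0.
  rewrite incr_image_co//; last first.
    apply: continuous_in_subspaceT => z /set_mem zab;
    exact: is_derive1_continuous (HE z zab).
  split=> //; rewrite -(ge0_substitution_incr ab HE)//.
  apply: eq_integral => y /set_mem yab; rewrite gtr0_norm// dH0//.
  exact: subset_itv_co_cc yab.
pose dH' y := - dH y.
have HE' : {in `[a, b], forall y : R, is_derive y 1 (\- H) (dH' y)}.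
  by move=> y yab; have ? := HE y yab; exact: is_deriveN.
have dH0' : {in `[a, b], forall y : R, 0 < dH' y}.
  by move=> y yab; rewrite /dH' oppr_gt0 dH0.
have cdH' : {in `[a, b], forall y : R, {for y, continuous dH'}}.
  by move=> y yab; apply: cvgN; exact: cdH.
have Hincr := is_derive_pos_incr HE' dH0'.
have Eim : H @` `[a, b[%classic = -%R @^-1` `[- H a, - H b[%classic.
  rewrite -[X in _ @^-1` X](@incr_image_co (\- H) a b ab)//; last first.
    apply: continuous_in_subspaceT => z /set_mem zab;
    exact: is_derive1_continuous (HE' z zab).
  apply/seteqP; split=> [_ [y yab <-]|x [y yab /= /oppr_inj <-]].
    by exists y.
  by exists y.
have mN : measurable_fun setT (-%R : R -> R) by exact: oppr_measurable.
split.
  by rewrite Eim -[X in measurable X]setTI; exact: mN.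
pose G' x := G (- x)%R.
have mG' : measurable_fun setT G' by apply: measurableT_comp.
have := ge0_substitution_incr ab HE' cdH' dH0' mG' (fun x => G0 _).
rewrite Eim /G' => E.
transitivity (\int[mu]_(y in `[a, b[) ((- dH y)%:E * G (- - H y)%R))%E.
  apply: eq_integral => y /set_mem yab; rewrite opprK ltr0_norm// dH0//.
  exact: subset_itv_co_cc yab.
rewrite E.
have -> : (\int[mu]_(x in -%R @^-1` `[(- H a)%R, (- H b)%R[) G x =
  \int[mu]_(x in (-%R : measurableTypeR R -> measurableTypeR R) @^-1`
     `[(- H a)%R, (- H b)%R[) ((G \o -%R) \o -%R) x)%E.
  by apply: eq_integral => x _ /=; rewrite opprK.
rewrite -ge0_integral_pushforward//=; last exact: measurable_funTS.
by apply: eq_measure_integral => //= A mA AS; exact/esym/lebesgue_measureN.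
Qed.

End substitution.

(** * Change of variables in a tube *)

Section plane_measurability.
Context {R : realType}.
Local Notation T2 := (measurableTypeR R * measurableTypeR R)%type.

Lemma ball_plane_measurable (x : R * R) (e : R) :
  measurable (ball x e : set T2).
Proof.
have -> : ball x e = ball x.1 e `*` ball x.2 e :> set (R * R).
  by case: x => x1 x2.
by apply: measurableX; exact: measurable_ball.
Qed.

(** The product measure lives on the product sigma-algebra, while continuity refers to the product
    topology. The two are matched by writing [U] as the union of the countably many balls of
    rational centre and radius [1 / (n + 1)] that it contains. *)
Lemma open_plane_measurable (U : set (R * R)) : open U ->
  measurable (U : set T2).
Proof.
move=> oU.
pose B (p q : rat) (n : nat) : set T2 :=
  if `[< ball ((ratr p, ratr q) : R * R) n.+1%:R^-1 `<=` U >]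
  then ball ((ratr p, ratr q) : R * R) n.+1%:R^-1 else set0.
have -> : U = \bigcup_p \bigcup_q \bigcup_n B p q n.
  apply/seteqP; split=> [x Ux|x [p _ [q _ [n _]]]]; last first.
    by rewrite /B; case: asboolP => // + /=; exact.
  have /nbhs_ballP[e /= e0 xeU] : nbhs x U by exact: open_nbhs_nbhs.
  (* Half of [e], because the rational ball has its centre within its own radius of [x], so that its
     points lie within twice that radius. *)
  have [n _ ne] : \forall n \near \oo, n.+1%:R^-1 < e / 2.
    exact: (@near_infty_natSinv_lt R (PosNum (divr_gt0 e0 (ltr0n _ 2)))).
  have {}ne : n.+1%:R^-1 < e / 2 by exact: ne _ (leqnn n).
  have n0 : 0 < n.+1%:R^-1 :> R by rewrite invr_gt0.
  have ex (u y : R) : 0 < u -> exists p : rat, `|y - ratr p| < u.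
    move=> u0; have /rat_in_itvoo[p] : y - u < y + u by lra.
    rewrite in_itv/= => /andP[? ?]; exists p.
    by rewrite ltr_norml; apply/andP; split; lra.
  have [p xp] := ex _ x.1 n0; have [q xq] := ex _ x.2 n0.
  exists p => //; exists q => //; exists n => //.
  rewrite /B; case: asboolP => [_|nB].
    by split => /=; rewrite /ball/= distrC.
  exfalso; apply: nB => z [z1 z2]; apply: xeU.
  move: (n.+1%:R^-1) ne {n0} z1 z2 xp xq => u ne z1 z2 xp xq; split.
    rewrite /ball/= in z1 *; rewrite -(subrKA (ratr p)).
    by rewrite (le_lt_trans (ler_normD _ _))//; lra.
  rewrite /ball/= in z2 *; rewrite -(subrKA (ratr q)).
  by rewrite (le_lt_trans (ler_normD _ _))//; lra.
apply: bigcupT_measurable_rat => p; apply: bigcupT_measurable_rat => q.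
apply: bigcupT_measurable => n; rewrite /B; case: asboolP => // _.
exact: ball_plane_measurable.
Qed.

Lemma continuous_plane_measurable (g : R * R -> R) : continuous g ->
  measurable_fun [set: T2] g.
Proof.
move=> /continuousP cg; apply: (@measurability _ _ _ _ _ _ (@RGenOInfty.G R)).
  exact: RGenOInfty.measurableE.
move=> _ [_ [x ->] <-]; rewrite setTI.
by apply: open_plane_measurable; exact: cg.
Qed.

Lemma closed_plane_measurable (A : set (R * R)) : closed A ->
  measurable (A : set T2).
Proof.
by move/closed_openC/open_plane_measurable/measurableC; rewrite setCK.
Qed.

(* A half-open rectangle is a countable union of compact rectangles. *)
Lemma image_rectangle_measurable (F : R * R -> R * R) (a b c d : R) :
  continuous F ->
  measurable ((F @` (`[a, b[%classic `*` `[c, d[%classic)) : set T2).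
Proof.
move=> cF.
have -> : F @` (`[a, b[%classic `*` `[c, d[%classic) = \bigcup_n
   F @` (`[a, (b - n.+1%:R^-1)]%classic `*` `[c, (d - n.+1%:R^-1)]%classic).
  rewrite -image_bigcup; congr (F @` _).
  apply/seteqP; split=> [[x y] [/=]|[x y] [n _ [/=]]]; last first.
    have n0 : 0 < n.+1%:R^-1 :> R by rewrite invr_gt0.
    rewrite !in_itv/=; move: (n.+1%:R^-1) n0 => u u0 /andP[? ?] /andP[? ?].
    by split; apply/andP; split; lra.
  rewrite !in_itv/= => /andP[ax xb] /andP[cy yd].
  have e0 : 0 < Num.min (b - x) (d - y) by rewrite lt_min !subr_gt0 xb.
  have [n _ ne] : \forall n \near \oo, n.+1%:R^-1 < Num.min (b - x) (d - y).
    exact: (@near_infty_natSinv_lt R (PosNum e0)).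
  have := ne n (leqnn n); rewrite lt_min => /andP[].
  move=> nb nd; exists n => //; move: nb nd {ne}; move: (n.+1%:R^-1) => u ? ?.
  by split; rewrite /= in_itv/=; apply/andP; split; lra.
apply: bigcupT_measurable => n; apply: closed_plane_measurable.
apply: compact_closed; first exact: norm_hausdorff.
apply: continuous_compact; first exact: continuous_subspaceT.
by apply: compact_setX; exact: segment_compact.
Qed.

End plane_measurability.

(** Inversion is discontinuous only at 0, and a single point is harmless for measurability. It is
    applied to [h2], which may vanish away from the piece under study. *)
Lemma invr_measurable (R : realType) : measurable_fun setT (@GRing.inv R).
Proof.
have -> : [set: R] = [set 0] `|` [set~ 0] by rewrite setUv.
apply/measurable_funU => //; first exact: measurableC.
split; first exact: measurable_fun_set1.
apply: open_continuous_measurable_fun; first exact/closed_openC/closed_eq.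
by move=> x /set_mem/= /eqP x0; exact: inv_continuous.
Qed.

Lemma pair_continuous (R : realType) (X : topologicalType) (u v : X -> R) x :
  {for x, continuous u} -> {for x, continuous v} ->
  {for x, continuous (fun p => (u p, v p) : R * R)}.
Proof. by move=> cu cv; exact: (@cvg_pair _ _ _ _ (nbhs (u x)) (nbhs (v x))). Qed.

Section piece.
Context {R : realType}.
Local Notation mu := (@lebesgue_measure R).
Local Notation T2 := (measurableTypeR R * measurableTypeR R)%type.
Variables f1 f2 h1 h2 df1 df2 dh1 dh2 : R -> R.
Hypothesis f1E : forall y : R, is_derive y 1 f1 (df1 y).
Hypothesis f2E : forall y : R, is_derive y 1 f2 (df2 y).
Hypothesis h1E : forall y : R, is_derive y 1 h1 (dh1 y).
Hypothesis h2E : forall y : R, is_derive y 1 h2 (dh2 y).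
Hypotheses (cdf1 : continuous df1) (cdf2 : continuous df2).
Hypotheses (cdh1 : continuous dh1) (cdh2 : continuous dh2).

Definition tube_map (x : R * R) : R * R :=
  (f1 x.1 + x.2 * h1 x.1, f2 x.1 + x.2 * h2 x.1).
(** Determinant of the differential of [tube_map]: the cross product of [df + z dh], its derivative
    in y, with [h], its derivative in z. *)
Definition tube_jac (y z : R) : R :=
  (df1 y + z * dh1 y) * h2 y - (df2 y + z * dh2 y) * h1 y.

Let cf1 : continuous f1. Proof. by move=> y; exact: is_derive1_continuous. Qed.
Let cf2 : continuous f2. Proof. by move=> y; exact: is_derive1_continuous. Qed.
Let ch1 : continuous h1. Proof. by move=> y; exact: is_derive1_continuous. Qed.
Let ch2 : continuous h2. Proof. by move=> y; exact: is_derive1_continuous. Qed.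

Lemma tube_map_continuous : continuous tube_map.
Proof.
have cfst : continuous (@fst R R) by move=> x; exact: cvg_fst.
have csnd : continuous (@snd R R) by move=> x; exact: cvg_snd.
move=> x; have := @pair_continuous R (R * R)%type
  (fun p : R * R => f1 p.1 + p.2 * h1 p.1)
  (fun p : R * R => f2 p.1 + p.2 * h2 p.1) x.
apply; apply: cvgD.
- by apply: continuous_comp; [exact: cfst|exact: cf1].
- apply: cvgM; first exact: csnd.
  by apply: continuous_comp; [exact: cfst|exact: ch1].
- by apply: continuous_comp; [exact: cfst|exact: cf2].
- apply: cvgM; first exact: csnd.
  by apply: continuous_comp; [exact: cfst|exact: ch2].
Qed.

(* The normal line at f(y) meets the horizontal line of height w at the
   parameter z = (w - f2 y) / h2 y, that is at abscissa [crossing y w], whose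
   derivative in y is the Jacobian divided by h2 y. *)
Let zpar y w := (w - f2 y) * (h2 y)^-1.
Let crossing y w := f1 y + h1 y * zpar y w.
Let dcrossing y w := tube_jac y (zpar y w) * (h2 y)^-1.

Let crossingE w y : h2 y != 0 ->
  is_derive y 1 (crossing ^~ w) (dcrossing y w).
Proof.
move=> h20.
have V : is_derive y 1 (fun y => (h2 y)^-1) (- (h2 y) ^- 2 *: dh2 y).
  exact: is_deriveV.
apply: is_derive_eq; rewrite /dcrossing /tube_jac /zpar /GRing.scale/=.
by field.
Qed.

Let dcrossing_continuous w y : h2 y != 0 ->
  {for y, continuous (dcrossing ^~ w)}.
Proof.
move=> h20.
have cV : {for y, continuous (fun y => (h2 y)^-1)}.
  by apply: cvgV => //; exact: ch2.
have cz : {for y, continuous (zpar ^~ w)}.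
  by apply: cvgM => //; apply: cvgB; [exact: cvg_cst|exact: cf2].
apply: cvgM => //; apply: cvgB; apply: cvgM.
- by apply: cvgD; [exact: cdf1|apply: cvgM => //; exact: cdh1].
- exact: ch2.
- by apply: cvgD; [exact: cdf2|apply: cvgM => //; exact: cdh2].
- exact: ch1.
Qed.

Variables (a b e e0 : R).
Hypotheses (ab : a < b) (e_gt0 : 0 < e).
Hypothesis h2_sign : {in `[a, b], forall y, 0 < h2 y} \/
  {in `[a, b], forall y, h2 y < 0}.
Hypothesis jac_sign :
  {in `[a, b], forall y z, `|z| <= e0 -> 0 < tube_jac y z} \/
  {in `[a, b], forall y z, `|z| <= e0 -> tube_jac y z < 0}.
Hypothesis e0P : {in `[a, b] &, forall y y' z, `|z| <= e ->
  `|f2 y' + z * h2 y' - f2 y| <= e0 * `|h2 y|}.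

Let Om := tube_map @` (`[a, b[%classic `*` `[- e, e[%classic).

Let h20 : {in `[a, b], forall y, h2 y != 0}.
Proof.
case: h2_sign => h2s y yab; first by rewrite gt_eqF// h2s.
by rewrite lt_eqF// h2s.
Qed.

(** A height [w] reached by the piece is met by every normal line of the piece at a parameter of
    size at most [e0]: this is [e0P] divided by [|h2 y|]. So [jac_sign] applies there, and the sign
    of [h2] settles that of the quotient. *)
Let dcrossing_sign (y0 z0 : R) : y0 \in `[a, b] -> `|z0| <= e ->
  let w := f2 y0 + z0 * h2 y0 in
  {in `[a, b], forall y, 0 < dcrossing y w} \/
  {in `[a, b], forall y, dcrossing y w < 0}.
Proof.
move=> y0ab z0e w.
have zw y : y \in `[a, b] -> `|zpar y w| <= e0.
  move=> yab; rewrite normrM normfV ler_pdivrMr ?normr_gt0 ?h20//.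
  exact: e0P.
have [h2s|h2s] := h2_sign; have [Js|Js] := jac_sign.
- left=> y yab; rewrite mulr_gt0 ?invr_gt0//; first exact/Js/zw.
  exact: h2s.
- right=> y yab; rewrite nmulr_rlt0 ?invr_gt0//; first exact: h2s.
  exact/Js/zw.
- right=> y yab; rewrite pmulr_rlt0 ?invr_lt0//; first exact: h2s.
  exact/Js/zw.
- left=> y yab; rewrite nmulr_rgt0 ?invr_lt0//; first exact: h2s.
  exact/Js/zw.
Qed.

(** Converts membership of a point in [Om] into membership of its parameter: at a height of the
    piece, a point of abscissa [crossing y w] can come from no other parameter of the piece than
    [y]. *)
Let crossing_inj (y0 z0 : R) : y0 \in `[a, b] -> `|z0| <= e ->
  let w := f2 y0 + z0 * h2 y0 in
  {in `[a, b] &, injective (crossing ^~ w)}.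
Proof.
move=> y0ab z0e w.
have dE : {in `[a, b], forall y : R,
    is_derive y 1 (crossing ^~ w) (dcrossing y w)}.
  by move=> y yab; exact/crossingE/h20.
have [ds|ds] := dcrossing_sign y0ab z0e.
  have inc := is_derive_pos_incr dE ds.
  move=> x y xab yab xy; apply/eqP; move/eqP: xy; apply: contraTT.
  rewrite neq_lt => /orP[xy|xy].
    by rewrite lt_eqF//; exact: inc.
  by rewrite gt_eqF//; exact: inc.
have dE' : {in `[a, b], forall y : R,
    is_derive y 1 (fun y => - crossing y w) ((fun y => - dcrossing y w) y)}.
  by move=> y yab; have ? := dE y yab; exact: is_deriveN.
have ds' : {in `[a, b], forall y : R, 0 < (fun y => - dcrossing y w) y}.
  by move=> y yab; rewrite oppr_gt0 ds.
have inc := is_derive_pos_incr dE' ds'.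
move=> x y xab yab xy; apply/eqP; move/eqP: xy; apply: contraTT.
rewrite neq_lt -eqr_opp => /orP[xy|xy].
  by rewrite lt_eqF//; exact: inc.
by rewrite gt_eqF//; exact: inc.
Qed.

Lemma piece_image_measurable : measurable (Om : set T2).
Proof.
exact: (@image_rectangle_measurable R tube_map _ _ _ _ tube_map_continuous).
Qed.

Local Open Scope ereal_scope.

Variable g : R * R -> \bar R.
Hypotheses (mg : measurable_fun [set: T2] g) (g0 : forall x, 0 <= g x).

(** The determinant factors as [dcrossing] times [h2]: [h2 y] is the Jacobian of the passage from z
    to the height at fixed y, and [dcrossing] that of the passage from y to the abscissa at fixed
    height. *)
Lemma piece_change_of_variables :
  \int[mu]_(y in `[a, b[) \int[mu]_(z in `[(- e)%R, e[)
    (`|tube_jac y z|%:E * g (tube_map (y, z))) =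
  \int[(mu \x mu)%E]_(x in Om) g x.
Proof.
pose g' := (g \_ Om : T2 -> \bar R).
have mg' : measurable_fun [set: T2] g'.
  apply/(measurable_restrictT _ _).1; first exact: piece_image_measurable.
  exact: measurable_funTS.
have g'0 x : 0 <= g' x by rewrite /g' patchE; case: ifPn.
(* The integrand in the mixed coordinates (parameter, height). As [g'] vanishes off [Om], the inner
   domains of integration, which depend on the outer variable, can be enlarged to the whole line. *)
pose K0 (p : T2) := `|dcrossing p.1 p.2|%:E * g' (crossing p.1 p.2, p.2).
have K00 p : 0 <= K0 p by rewrite mule_ge0.
have mf1 : measurable_fun [set: T2] (f1 \o fst).
  by apply: measurableT_comp => //; exact: continuous_measurable_fun.
have mf2 : measurable_fun [set: T2] (f2 \o fst).
  by apply: measurableT_comp => //; exact: continuous_measurable_fun.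
have mh1 : measurable_fun [set: T2] (h1 \o fst).
  by apply: measurableT_comp => //; exact: continuous_measurable_fun.
have mh2 : measurable_fun [set: T2] (h2 \o fst).
  by apply: measurableT_comp => //; exact: continuous_measurable_fun.
have mdf1 : measurable_fun [set: T2] (df1 \o fst).
  by apply: measurableT_comp => //; exact: continuous_measurable_fun.
have mdf2 : measurable_fun [set: T2] (df2 \o fst).
  by apply: measurableT_comp => //; exact: continuous_measurable_fun.
have mdh1 : measurable_fun [set: T2] (dh1 \o fst).
  by apply: measurableT_comp => //; exact: continuous_measurable_fun.
have mdh2 : measurable_fun [set: T2] (dh2 \o fst).
  by apply: measurableT_comp => //; exact: continuous_measurable_fun.
have mV : measurable_fun [set: T2] (fun p => (h2 p.1)^-1)%R.
  by apply: measurableT_comp => //; exact: invr_measurable.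
have mz : measurable_fun [set: T2] (fun p => zpar p.1 p.2).
  by apply: measurable_funM => //; exact: measurable_funB.
have mc : measurable_fun [set: T2] (fun p => crossing p.1 p.2).
  by apply: measurable_funD => //; exact: measurable_funM.
have mdc : measurable_fun [set: T2] (fun p => dcrossing p.1 p.2).
  by apply: measurable_funM => //; apply: measurable_funB;
    apply: measurable_funM => //; apply: measurable_funD => //;
    exact: measurable_funM.
have mK0 : measurable_fun [set: T2] K0.
  apply: emeasurable_funM.
    by apply/measurable_EFinP; exact: measurableT_comp.
  apply: measurableT_comp => //.
  by apply: measurable_fun_pair.
have Omg (y z : R) : y \in `[a, b[ -> z \in `[(- e)%R, e[ ->
    g' (tube_map (y, z)) = g (tube_map (y, z)).
  by move=> yab ze; rewrite /g' patchT//; apply/mem_set; exists (y, z).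
have znorm (z : R) : z \in `[(- e)%R, e[ -> (`|z| <= e)%R.
  by rewrite in_itv/= => /andP[? ?]; rewrite ler_norml; apply/andP; split; lra.
transitivity (\int[mu]_(y in `[a, b[) \int[mu]_w K0 (y, w)).
  apply: eq_integral => y /set_mem yab.
  have yab' : y \in `[a, b] by exact: subset_itv_co_cc yab.
  have hy0 := h20 yab'.
  have He : (- e < e)%R by rewrite gtrN.
  have HE : {in `[(- e)%R, e], forall z : R,
      is_derive z 1%R (fun z => f2 y + z * h2 y)%R (cst (h2 y) z)}.
    move=> z _; apply: is_derive_eq; rewrite /GRing.scale/=; ring.
  have [mW] := ge0_substitution (G := fun w => K0 (y, w)) He HE
    (fun z _ => cvg_cst _)
    (match h2_sign with
     | or_introl P => or_introl (fun z _ => P y yab')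
     | or_intror P => or_intror (fun z _ => P y yab') end)
    (measurable_fun_pair2 _ mK0) (fun w => K00 _).
  set W := image _ _ => E.
  transitivity (\int[mu]_(w in W) K0 (y, w)).
    rewrite -E; apply: eq_integral => z /set_mem ze.
    have zE : zpar y (f2 y + z * h2 y) = z by rewrite /zpar; field.
    rewrite /K0/= muleA -EFinM -normrM /dcrossing zE; congr (`|_|%:E * _).
      by field.
    rewrite -Omg//; congr g'; rewrite /tube_map /crossing zE/=.
    by congr pair; ring.
  (* The heights swept by the normal at [y] form [W]. Any other height contributes 0: were its point
     in [Om], [crossing_inj] would make [y] the parameter of that point and put the height in
     [W]. *)
  rewrite integral_mkcond; apply: eq_integral => w _.
  rewrite patchE; case: ifPn => // wW.
  rewrite /K0 /g' patchE; case: ifPn => [|_]; last by rewrite mule0.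
  move=> /set_mem[[y0 z0] [/= y0ab z0e] [c1 c2]].
  exfalso; move: wW; rewrite notin_setE; apply.
  have y0ab' : y0 \in `[a, b] by exact: subset_itv_co_cc y0ab.
  suff yy0 : y = y0 by exists z0; rewrite ?yy0.
  apply: (crossing_inj y0ab' (znorm _ z0e)) => //.
  rewrite c2 -c1 /crossing -c2; congr (_ + _)%R.
  by rewrite /zpar; field; exact: h20.
pose K := (K0 \_ (`[a, b[ `*` [set: R]) : T2 -> \bar R).
have mI : measurable (`[a, b[ `*` [set: R] : set T2) by exact: measurableX.
have mK : measurable_fun [set: T2] K.
  by apply/(measurable_restrictT _ _).1 => //; exact: measurable_funTS.
have Kge0 p : 0 <= K p by rewrite /K patchE; case: ifPn.
transitivity (\int[mu]_y \int[mu]_w K (y, w)).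
  rewrite integral_mkcond; apply: eq_integral => y _.
  rewrite patchE; case: ifPn => yab.
    apply: eq_integral => w _; rewrite /K patchT//.
    by apply/mem_set; split => //; exact: set_mem yab.
  rewrite integral0_eq// => w _; rewrite /K patchC//.
  apply/mem_set => -[/= yab' _].
  by move: yab; rewrite mem_set.
rewrite fubini_tonelli//.
rewrite [RHS]integral_mkcond fubini_tonelli2//; apply: eq_integral => w _.
rewrite /fubini_G.
transitivity (\int[mu]_(y in `[a, b[) K0 (y, w)).
  rewrite [RHS]integral_mkcond; apply: eq_integral => y _.
  rewrite /K !patchE; congr (if _ then _ else _).
  by apply/idP/idP => [/set_mem[/= /mem_set]|/set_mem yab]//; exact/mem_set.
(* Only at heights attained by the piece is [dcrossing] known to keep its sign, so only there is the
   substitution in y available; at the others [g'] is identically 0. *)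
have [[y0 [z0 [y0ab z0e wE]]]|nW] := pselect (exists y0 z0 : R,
    [/\ y0 \in `[a, b[, z0 \in `[(- e)%R, e[ & w = f2 y0 + z0 * h2 y0])%R.
  have y0ab' : y0 \in `[a, b] by exact: subset_itv_co_cc y0ab.
  have := dcrossing_sign y0ab' (znorm _ z0e); rewrite -wE => ds.
  have dE : {in `[a, b], forall y : R,
      is_derive y 1%R (crossing ^~ w) (dcrossing y w)}.
    by move=> y yab; exact/crossingE/h20.
  have dc : {in `[a, b], forall y : R, {for y, continuous (dcrossing ^~ w)}}.
    by move=> y yab; exact/dcrossing_continuous/h20.
  have [mW ->] := ge0_substitution ab dE dc ds (measurable_fun_pair1 w mg')
    (fun x => g'0 _).
  rewrite [LHS]integral_mkcond; apply: eq_integral => x _.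
  rewrite patchE; case: ifPn => // xW; rewrite /g' patchE.
  case: ifPn => // /set_mem[[y1 z1] [/= y1ab z1e] [c1 c2]].
  exfalso; move: xW; rewrite notin_setE; apply; exists y1 => //.
  rewrite -c1 -c2 /crossing; congr (_ + _)%R.
  by rewrite /zpar; field; exact/h20/subset_itv_co_cc.
have g'w x : g' (x, w) = 0.
  rewrite /g' patchE; case: ifPn => // /set_mem[[y1 z1] [/= y1ab z1e] [c1 c2]].
  by exfalso; apply: nW; exists y1, z1.
by rewrite !integral0_eq// => y _; rewrite /K0 g'w mule0.
Qed.

End piece.

Section segment_bounds.
Context {R : realType}.
Implicit Types (u du : R -> R) (a b : R).

Lemma continuous_segment_bounded u a b : a <= b -> continuous u ->
  exists2 M : R, 1 <= M & {in `[a, b], forall y, `|u y| <= M}.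
Proof.
move=> ab cu.
have cnu : {within `[a, b], continuous (fun y => `|u y|)}.
  apply: continuous_subspaceT => y.
  by apply: continuous_comp; [exact: cu|exact: norm_continuous].
have [c cab cmax] := EVT_max ab cnu.
exists (Num.max 1 `|u c|); first by rewrite le_max lexx.
by move=> y yab; rewrite le_max cmax ?orbT.
Qed.

Lemma continuous_segment_pos u a b : a <= b -> continuous u ->
  {in `[a, b], forall y, 0 < u y} ->
  exists2 m : R, 0 < m & {in `[a, b], forall y, m <= u y}.
Proof.
move=> ab cu u0.
have [c cab cmin] := EVT_min ab (continuous_subspaceT cu).
by exists (u c); [exact: u0|move=> y yab; exact: cmin].
Qed.

Lemma is_derive_segment_lipschitz u du a b M :
  {in `[a, b], forall y : R, is_derive y 1 u (du y)} ->
  {in `[a, b], forall y, `|du y| <= M} ->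
  {in `[a, b] &, forall x y, `|u x - u y| <= M * `|x - y|}.
Proof.
move=> uE duM.
suff W : {in `[a, b] &, forall x y, x < y -> `|u x - u y| <= M * `|x - y|}.
  move=> x y xab yab; have [xy|xy|->] := ltgtP x y; first exact: W.
    by rewrite distrC (distrC x); exact: W.
  by rewrite !subrr normr0 mulr0.
move=> x y xab yab xy.
have sub z : z \in `[x, y] -> z \in `[a, b].
  move: xab yab; rewrite !in_itv/= => /andP[? ?] /andP[? ?] /andP[? ?].
  by apply/andP; split; [exact: (@le_trans _ _ x)|exact: (@le_trans _ _ y)].
have [z zxy] := @MVT R u du x y xy
  (fun z zxy => uE z (sub z (subset_itv_oo_cc zxy)))
  (continuous_in_subspaceT (fun z zxy =>
     is_derive1_continuous (uE z (sub z (set_mem zxy))))).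
rewrite distrC => ->; rewrite normrM (distrC x) ler_wpM2r//.
exact/duM/sub/subset_itv_oo_cc.
Qed.

End segment_bounds.

Section tube.
Context {R : realType}.
Local Notation mu := (@lebesgue_measure R).
Local Notation T2 := (measurableTypeR R * measurableTypeR R)%type.
Variables f1 f2 h1 h2 df1 df2 dh1 dh2 ddf1 ddf2 : R -> R.
Hypothesis f1E : forall y : R, is_derive y 1 f1 (df1 y).
Hypothesis f2E : forall y : R, is_derive y 1 f2 (df2 y).
Hypothesis h1E : forall y : R, is_derive y 1 h1 (dh1 y).
Hypothesis h2E : forall y : R, is_derive y 1 h2 (dh2 y).
Hypothesis df1E : forall y : R, is_derive y 1 df1 (ddf1 y).
Hypothesis df2E : forall y : R, is_derive y 1 df2 (ddf2 y).
Hypotheses (cdh1 : continuous dh1) (cdh2 : continuous dh2).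
Hypotheses (cddf1 : continuous ddf1) (cddf2 : continuous ddf2).
Variable L : R.
Hypothesis L0 : 0 < L.
Hypotheses (f1L : forall y, f1 (y + L) = f1 y)
  (f2L : forall y, f2 (y + L) = f2 y) (h1L : forall y, h1 (y + L) = h1 y)
  (h2L : forall y, h2 (y + L) = h2 y).
Hypothesis f_inj : {in `[0, L[ &, forall y y',
  f1 y = f1 y' -> f2 y = f2 y' -> y = y'}.
Hypothesis h_unit : forall y, h1 y ^+ 2 + h2 y ^+ 2 = 1.
Hypothesis h_normal : forall y, df1 y * h1 y + df2 y * h2 y = 0.
Hypothesis h_pos : forall y, 0 < df1 y * h2 y - df2 y * h1 y.

Local Notation tmap := (tube_map f1 f2 h1 h2).
Local Notation jac := (tube_jac h1 h2 df1 df2 dh1 dh2).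

Let cf1 : continuous f1. Proof. by move=> y; exact: is_derive1_continuous. Qed.
Let cf2 : continuous f2. Proof. by move=> y; exact: is_derive1_continuous. Qed.
Let ch1 : continuous h1. Proof. by move=> y; exact: is_derive1_continuous. Qed.
Let ch2 : continuous h2. Proof. by move=> y; exact: is_derive1_continuous. Qed.
Let cdf1 : continuous df1. Proof. by move=> y; exact: is_derive1_continuous. Qed.
Let cdf2 : continuous df2. Proof. by move=> y; exact: is_derive1_continuous. Qed.

Lemma unit_normal_le1 y : `|h1 y| <= 1 /\ `|h2 y| <= 1.
Proof.
have := h_unit y; have := sqr_ge0 (h1 y); have := sqr_ge0 (h2 y) => ? ? ?.
by split; rewrite -(@ler_pXn2r _ 2)// ?nnegrE// expr1n -normrX ger0_norm//; lra.
Qed.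

(** The range is [[- L, L]] rather than one period because parameters on either side of the seam are
    compared after a shift by [L]. Since [h] is unit and normal, the squared speed is the square of
    the cross product, whence [m ^+ 2] in the minimum. *)
Lemma tube_bounds : exists M m : R, [/\ 1 <= M, 0 < m,
  {in `[- L, L], forall y, [/\ `|df1 y| <= M, `|df2 y| <= M, `|dh1 y| <= M
     & `|dh2 y| <= M]},
  {in `[- L, L], forall y, `|ddf1 y| <= M /\ `|ddf2 y| <= M} &
  {in `[- L, L], forall y, m <= df1 y * h2 y - df2 y * h1 y /\
     m <= df1 y ^+ 2 + df2 y ^+ 2}].
Proof.
have LL : - L <= L by have := L0; lra.
have [M1 M11 M1P] := continuous_segment_bounded LL cdf1.
have [M2 M21 M2P] := continuous_segment_bounded LL cdf2.
have [M3 M31 M3P] := continuous_segment_bounded LL cdh1.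
have [M4 M41 M4P] := continuous_segment_bounded LL cdh2.
have [M5 M51 M5P] := continuous_segment_bounded LL cddf1.
have [M6 M61 M6P] := continuous_segment_bounded LL cddf2.
have cc0 : continuous (fun y => df1 y * h2 y - df2 y * h1 y).
  move=> y; apply: cvgB; apply: cvgM;
    [exact: cdf1|exact: ch2|exact: cdf2|exact: ch1].
have [m m0 mP] := continuous_segment_pos LL cc0 (fun y _ => h_pos y).
exists (M1 + M2 + M3 + M4 + M5 + M6), (Num.min m (m ^+ 2)).
split; first lra.
- by rewrite lt_min m0 exprn_gt0.
- move=> y yL; have /= := M1P _ yL; have /= := M2P _ yL; have /= := M3P _ yL.
  by have /= := M4P _ yL => *; split; lra.
- by move=> y yL; have /= := M5P _ yL; have /= := M6P _ yL => *; split; lra.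
- move=> y yL; rewrite !ge_min mP//; split => //; apply/orP; right.
  have -> : df1 y ^+ 2 + df2 y ^+ 2 = (df1 y * h2 y - df2 y * h1 y) ^+ 2.
    have := h_unit y; have := h_normal y => hn hu.
    transitivity ((df1 y ^+ 2 + df2 y ^+ 2) * (h1 y ^+ 2 + h2 y ^+ 2)
      - (df1 y * h1 y + df2 y * h2 y) ^+ 2); last by ring.
    by rewrite hn hu; ring.
  by rewrite ler_pXn2r// ?nnegrE ?mP// ltW// h_pos.
Qed.

(* Testing an equality of tube points against the tangent vector at y kills
   the term z h(y), and the other normal term is at most e |y - y'|. *)
Lemma tube_local_injective : exists2 d : R, 0 < d &
  forall e, e <= d -> {in `[- L, L] &, forall y y' z z',
    `|y - y'| <= d -> `|z'| <= e ->
    tmap (y, z) = tmap (y', z') -> y = y'}.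
Proof.
have [M [m [M1 m0 MP MP2 mP]]] := tube_bounds.
have M0 : 0 < M by lra.
have M20 : 0 < M ^+ 2 by rewrite exprn_gt0.
(* Four error terms, two from Taylor remainders and two from the variation of [h], are each at most
   [M ^+ 2 * d] times the parameter distance; with this [d] they add up to [m / 2], less than the
   main term. *)
pose d := m / (8 * M ^+ 2).
have d0 : 0 < d by rewrite divr_gt0// mulr_gt0.
have dE : d * (8 * M ^+ 2) = m by rewrite /d divfK// gt_eqF// mulr_gt0.
exists d => // e ed y y' yL y'L z z' yy' z'e [E1 E2].
have [b1 b2 _ _] := MP _ yL.
have [_ mm] := mP _ yL.
have lip (u du : R -> R) (c : R) : (forall y : R, is_derive y 1 u (du y)) -> 0 <= c ->
    {in `[- L, L], forall y, `|du y| <= c} -> `|u y' - u y| <= c * `|y - y'|.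
  move=> uE c0 duM; rewrite (distrC y y').
  exact: (is_derive_segment_lipschitz (fun y _ => uE y) duM y'L yL).
have lh1 := lip _ _ _ h1E (ltW M0) (fun y yL => let: And4 _ _ p _ := MP y yL in p).
have lh2 := lip _ _ _ h2E (ltW M0) (fun y yL => let: And4 _ _ _ p := MP y yL in p).
have taylor (u du ddu : R -> R) : (forall y : R, is_derive y 1 u (du y)) ->
    (forall y : R, is_derive y 1 du (ddu y)) ->
    {in `[- L, L], forall y, `|ddu y| <= M} ->
    `|u y' - u y - du y * (y' - y)| <= M * d * `|y - y'|.
  move=> uE duE dduM.
  (* Removing the linear part leaves a function with derivative [du x - du y], of size at most
     [M * d] on the short segment, so a Lipschitz bound replaces a second-order formula. *)
  pose v x := u x - du y * x.
  have vE (x : R) : is_derive x 1 v (du x - du y).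
    by apply: is_derive_eq; rewrite /GRing.scale/=; ring.
  have -> : u y' - u y - du y * (y' - y) = v y' - v y by rewrite /v; ring.
  pose l := Num.min y y'; pose r := Num.max y y'.
  have yl : y \in `[l, r] by rewrite in_itv/= ge_min le_max !lexx.
  have y'l : y' \in `[l, r] by rewrite in_itv/= ge_min le_max !lexx !orbT.
  rewrite (distrC y).
  apply: (is_derive_segment_lipschitz (fun x _ => vE x) _ y'l yl).
  move=> x xl.
  have xyy : `|x - y| <= `|y - y'| /\ x \in `[- L, L].
    move: xl yL y'L; rewrite /l /r !in_itv/=.
    case: (lerP y y') => yy /andP[lx xr] /andP[? ?] /andP[? ?].
      rewrite ger0_norm ?subr_ge0//; split; first lra.
      by apply/andP; split; lra.
    rewrite ler0_norm ?subr_le0//; split; first lra.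
    by apply/andP; split; lra.
  have [xy xL] := xyy.
  apply: (@le_trans _ _ (M * `|x - y|)).
    exact: (is_derive_segment_lipschitz (fun x _ => duE x) dduM xL yL).
  by rewrite ler_pM2l// (le_trans xy).
have t1 := taylor _ _ _ f1E df1E (fun y yL => (MP2 y yL).1).
have t2 := taylor _ _ _ f2E df2E (fun y yL => (MP2 y yL).2).
set r1 := f1 y' - f1 y - df1 y * (y' - y) in t1.
set r2 := f2 y' - f2 y - df2 y * (y' - y) in t2.
have key : (df1 y ^+ 2 + df2 y ^+ 2) * (y' - y) =
   - (df1 y * r1 + df2 y * r2)
   - z' * (df1 y * (h1 y' - h1 y) + df2 y * (h2 y' - h2 y)).
  have E1' : f1 y' = f1 y + z * h1 y - z' * h1 y'.
    by move: E1; rewrite /= => ->; ring.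
  have E2' : f2 y' = f2 y + z * h2 y - z' * h2 y'.
    by move: E2; rewrite /= => ->; ring.
  rewrite /r1 /r2 E1' E2'.
  have := h_normal y => hn.
  transitivity ((df1 y ^+ 2 + df2 y ^+ 2) * (y' - y)
    - (z - z') * (df1 y * h1 y + df2 y * h2 y)); last by ring.
  by rewrite hn; ring.
have : m * `|y - y'| <= 4 * (M ^+ 2 * d) * `|y - y'|.
  have -> : `|y - y'| = `|y' - y| by rewrite distrC.
  apply: (@le_trans _ _ `|(df1 y ^+ 2 + df2 y ^+ 2) * (y' - y)|).
    by rewrite normrM ler_wpM2r// (le_trans mm)// ler_norm.
  have A (p q P Q : R) : `|p| <= P -> `|q| <= Q -> `|p * q| <= P * Q.
    by move=> pP qQ; rewrite normrM ler_pM.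
  rewrite key (le_trans (ler_normB _ _))// normrN.
  rewrite (le_trans (lerD (ler_normD _ _) (A _ _ _ _ (le_trans z'e ed)
    (le_trans (ler_normD _ _) (lerD (A _ _ _ _ b1 lh1) (A _ _ _ _ b2 lh2))))))//.
  have := lerD (A _ _ _ _ b1 t1) (A _ _ _ _ b2 t2).
  rewrite (distrC y' y); set Y := `|y - y'| => B; apply: (le_trans (lerD B (lexx _))).
  by rewrite le_eqVlt; apply/orP; left; apply/eqP; ring.
have -> : M ^+ 2 * d = m / 8 by rewrite -dE; field.
move=> H; apply/eqP; rewrite -subr_eq0 -normr_eq0 eq_le normr_ge0 andbT.
have := normr_ge0 (y - y'); move: H; set Y := `|_| => H Y0.
by rewrite leNgt; apply/negP => Yp; nra.
Qed.

Let in0L_LL y : y \in `[0, L] -> y \in `[- L, L].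
Proof.
have := L0 => ?; rewrite !in_itv/= => /andP[? ?]; apply/andP; split; lra.
Qed.

(** On the compact set of pairs that are close neither directly nor through the seam, the squared
    chord attains its minimum, and a zero minimum would contradict injectivity of the
    parametrization. The bound [L - d] excludes the pair formed by the two ends, which represent the
    same point. *)
Lemma chord_bound (d : R) : 0 < d -> exists2 c : R, 0 < c &
  {in `[0, L] &, forall y y', d <= `|y - y'| -> `|y - y'| <= L - d ->
    c <= (f1 y - f1 y') ^+ 2 + (f2 y - f2 y') ^+ 2}.
Proof.
move=> d0.
pose A : set (R * R) := (`[0, L]%classic `*` `[0, L]%classic) `&`
  [set p | d <= `|p.1 - p.2| /\ `|p.1 - p.2| <= L - d].
have [A0|/set0P] := eqVneq A set0; last first.
  move=> An0.
  have cfst : continuous (@fst R R) by move=> x; exact: cvg_fst.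
  have csnd : continuous (@snd R R) by move=> x; exact: cvg_snd.
  have cn : continuous (fun p : R * R => `|p.1 - p.2|).
    move=> x; apply: (@continuous_comp _ _ _ (fun p : R * R => p.1 - p.2)).
      by apply: cvgB; [exact: cfst|exact: csnd].
    exact: norm_continuous.
  have cA : compact A.
    apply: compact_closedI.
      by apply: compact_setX; exact: segment_compact.
    have -> : [set p : R * R | d <= `|p.1 - p.2| /\ `|p.1 - p.2| <= L - d] =
        (fun p : R * R => `|p.1 - p.2|) @^-1` `[d, L - d]%classic.
      by apply/seteqP; split=> p /=; rewrite in_itv/= => /andP.
    by apply: closed_comp => [p _|]; [exact: cn|exact: interval_closed].
  pose chord (p : R * R) := (f1 p.1 - f1 p.2) ^+ 2 + (f2 p.1 - f2 p.2) ^+ 2.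
  have cchord : continuous chord.
    have cs (u : R -> R) : continuous u ->
        continuous (fun p : R * R => (u p.1 - u p.2) ^+ 2).
      move=> cu x.
      have cd : {for x, continuous (fun p : R * R => u p.1 - u p.2)}.
        apply: cvgB.
          by apply: continuous_comp; [exact: cfst|exact: cu].
        by apply: continuous_comp; [exact: csnd|exact: cu].
      exact: (continuous_comp cd (@exprn_continuous R 2 _)).
    by move=> x; apply: cvgD; exact: cs.
  have [c /set_mem[[c1 c2] [cd cL]] cmin] := compact_EVT_min An0 cA
    (continuous_subspaceT cchord).
  exists (chord c); last first.
    by move=> y y' yL y'L yd yLd; apply: (cmin (y, y')); apply/mem_set.
  rewrite lt_neqAle addr_ge0 ?sqr_ge0// andbT eq_sym.
  apply/negP => /eqP/eqP; rewrite paddr_eq0 ?sqr_ge0//.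
  rewrite !sqrf_eq0 !subr_eq0 => /andP[/eqP E1 /eqP E2].
  (* The minimizing pair lies in the closed square, whereas [f_inj] concerns the half-open period; a
     coordinate equal to [L] is moved to 0. *)
  have red y : y \in `[0, L] -> exists2 y0, y0 \in `[0, L[ &
      [/\ f1 y0 = f1 y, f2 y0 = f2 y & y0 = y \/ y0 = 0 /\ y = L].
    rewrite in_itv/= => /andP[y0 yL].
    have [yL'|yL'] := ltP y L.
      by exists y; [rewrite in_itv/= y0|split => //; left].
    have -> : y = L by apply/eqP; rewrite eq_le yL.
    exists 0; first by rewrite in_itv/= lexx.
    by split; [rewrite -f1L add0r|rewrite -f2L add0r|right].
  have [p1 p1L [p11 p12 p1c]] := red _ c1.
  have [p2 p2L [p21 p22 p2c]] := red _ c2.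
  have p12e : p1 = p2 by apply: f_inj => //; rewrite ?p11 ?p12 ?p21 ?p22.
  have := L0 => L_gt0.
  move: cd cL => /=.
  case: p1c => [<-|[p1z ->]]; case: p2c => [<-|[p2z ->]].
  - by rewrite p12e subrr normr0; lra.
  - by rewrite p12e p2z sub0r normrN gtr0_norm//; lra.
  - by rewrite -p12e p1z subr0 gtr0_norm//; lra.
  - by rewrite subrr normr0; lra.
(* Here [A] is empty, as happens for [d] large against [L], and any positive constant works. *)
exists 1 => // y y' yL y'L yd yLd.
have : A (y, y') by [].
by rewrite A0.
Qed.

(** Close parameters are separated by [tube_local_injective], distant ones by [chord_bound]; those
    close through the seam become close once [y'] is replaced by [y' - L], which does not move the
    tube point. *)
Lemma tube_injective : exists2 e1 : R, 0 < e1 &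
  {in `[0, L[ &, forall y y' z z', `|z| <= e1 -> `|z'| <= e1 ->
    tmap (y, z) = tmap (y', z') -> y = y'}.
Proof.
have [d d0 inj] := tube_local_injective.
have [c c0 chord] := chord_bound d0.
(* Equal tube points force each component of the chord to be at most [2 * e1]. With [e1 <= 1] the
   squared chord is then at most [8 * e1], hence at most [c / 2]. *)
pose e1 := Num.min d (Num.min 1 (c / 16)).
have e10 : 0 < e1 by rewrite !lt_min d0 ltr01 divr_gt0.
have e1d : e1 <= d by rewrite ge_min lexx.
have e11 : e1 <= 1 by rewrite !ge_min lexx orbT.
have e1c : e1 <= c / 16 by rewrite !ge_min lexx !orbT.
exists e1 => //.
suff W : {in `[0, L[ &, forall y y' z z', y < y' -> `|z| <= e1 ->
    `|z'| <= e1 -> tmap (y, z) = tmap (y', z') -> False}.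
  move=> y y' yL y'L z z' ze z'e E.
  have [yy'|yy'|//] := ltgtP y y'; exfalso.
    exact: (W y y' yL y'L z z').
  exact: (W y' y y'L yL z' z).
move=> y y' yL y'L z z' yy' ze z'e E.
have yL' := subset_itv_co_cc yL; have y'L' := subset_itv_co_cc y'L.
have L_gt0 := L0.
have nyy : `|y - y'| = y' - y by rewrite ltr0_norm ?subr_lt0// opprB.
have [yd|yd] := lerP `|y - y'| d.
  have := inj _ e1d _ _ (in0L_LL yL') (in0L_LL y'L') _ _ yd z'e E.
  by move=> yE; rewrite yE ltxx in yy'.
have [yLd|yLd] := lerP `|y - y'| (L - d).
  have := chord _ _ yL' y'L' (ltW yd) yLd.
  case: E => E1 E2.
  have -> : f1 y - f1 y' = z' * h1 y' - z * h1 y.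
    by rewrite -[f1 y](addrK (z * h1 y)) E1; ring.
  have -> : f2 y - f2 y' = z' * h2 y' - z * h2 y.
    by rewrite -[f2 y](addrK (z * h2 y)) E2; ring.
  have bd (u v : R) : `|u| <= 1 -> `|v| <= 1 ->
      (z' * v - z * u) ^+ 2 <= (2 * e1) ^+ 2.
    move=> u1 v1; rewrite -[leLHS]real_normK ?num_real//.
    rewrite ler_pXn2r// ?nnegrE ?mulr_ge0// ?(ltW e10)//.
    have -> : 2 * e1 = e1 * 1 + e1 * 1 by ring.
    rewrite (le_trans (ler_normB _ _))// !normrM.
    by apply: lerD; apply: ler_pM.
  have [a1 a2] := unit_normal_le1 y; have [b1 b2] := unit_normal_le1 y'.
  have B1 := bd _ _ a1 b1; have B2 := bd _ _ a2 b2 => cc.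
  have : (2 * e1) ^+ 2 <= 4 * e1 by nra.
  by lra.
have E' : tmap (y, z) = tmap (y' - L, z').
  have shift (u : R -> R) : (forall y, u (y + L) = u y) -> u (y' - L) = u y'.
    by move=> uL; rewrite -uL subrK.
  by rewrite E /tube_map/= !shift.
have y'Ln : y' - L \in `[- L, L].
  by move: y'L; rewrite !in_itv/= => /andP[? ?]; apply/andP; split; lra.
have yd' : `|y - (y' - L)| <= d.
  move: yL y'L; rewrite !in_itv/= => /andP[? ?] /andP[? ?].
  by rewrite ler_norml; apply/andP; split; lra.
have := inj _ e1d _ _ (in0L_LL yL') y'Ln _ _ yd' z'e E'.
by move: yL y'L; rewrite !in_itv/= => /andP[? ?] /andP[? ?] ?; lra.
Qed.

Lemma tube_jac_swap y z :
  tube_jac h2 h1 df2 df1 dh2 dh1 y z = - jac y z.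
Proof. by rewrite /tube_jac; ring. Qed.

(** The determinant is affine in [z], with value at least [m] at 0 and slope at most [2 * M]; the
    chosen radius costs at most half of [m]. *)
Lemma tube_jac_pos : exists2 e1 : R, 0 < e1 &
  {in `[0, L], forall y z, `|z| <= e1 -> 0 < jac y z}.
Proof.
have [M [m [M1 m0 MP _ mP]]] := tube_bounds.
have M0 : 0 < M by lra.
exists (m / (4 * M)); first by rewrite divr_gt0// mulr_gt0.
move=> y yL z; rewrite ler_pdivlMr ?mulr_gt0// => ze.
have [_ _ c1 c2] := MP _ (in0L_LL yL); have [cm _] := mP _ (in0L_LL yL).
have [a1 a2] := unit_normal_le1 y.
have -> : jac y z = (df1 y * h2 y - df2 y * h1 y)
    + z * (dh1 y * h2 y - dh2 y * h1 y) by rewrite /tube_jac; ring.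
have : `|z * (dh1 y * h2 y - dh2 y * h1 y)| <= `|z| * (M * 1 + M * 1).
  rewrite normrM ler_wpM2l// (le_trans (ler_normB _ _))// !normrM.
  by apply: lerD; apply: ler_pM.
by rewrite ler_norml => /andP[]; nra.
Qed.

Local Open Scope ereal_scope.

Lemma swap_integral (g : R * R -> \bar R) : measurable_fun [set: T2] g ->
  (forall x, 0 <= g x) ->
  \int[(mu \x mu)%E]_x g (x.2, x.1) = \int[(mu \x mu)%E]_x g x.
Proof.
move=> mg g0.
rewrite [RHS]fubini_tonelli2// (fubini_tonelli1 (fun x : T2 => g (x.2, x.1)))//.
by apply: measurableT_comp => //; exact: measurable_fun_pair.
Qed.

(** One component of a unit vector has square at least 1/2, and over a short parameter interval it
    stays at least 1/2 in size. If it is [h2] the piece formula applies directly; if it is [h1], the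
    two plane coordinates are exchanged, which flips the sign of the determinant. *)
Lemma tube_piece : exists d e2 : R, [/\ (0 < d)%R, (0 < e2)%R &
  forall a b e, (0 <= a)%R -> (a < b)%R -> (b <= L)%R -> (b - a <= d)%R ->
    (0 < e)%R -> (e <= e2)%R ->
  forall g : R * R -> \bar R, measurable_fun [set: T2] g ->
  (forall x, 0 <= g x) ->
  \int[mu]_(y in `[a, b[) \int[mu]_(z in `[(- e)%R, e[)
    (`|jac y z|%:E * g (tmap (y, z))) =
  \int[(mu \x mu)%E]_(x in tmap @` (`[a, b[%classic `*` `[(- e)%R, e[%classic)) g x].
Proof.
have [M [m [M1 m0 MP _ mP]]] := tube_bounds.
have [e1 e10 jpos] := tube_jac_pos.
have M0 : (0 < M)%R by lra.
(* From [7 / 10] at [a], the large component loses at most [1 / 5] and stays at least [1 / 2]. The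
   variation [e1 / 4] of [f], together with [e <= e1 / 4], gives at most [e1 / 2], hence the height
   condition required of a piece. *)
pose d : R := Num.min (e1 / (4 * M))%R (1 / (5 * M))%R.
have d0 : (0 < d)%R by rewrite lt_min !divr_gt0// mulr_gt0.
have Md1 : (M * d <= e1 / 4)%R.
  have : (d <= e1 / (4 * M))%R by rewrite ge_min lexx.
  rewrite -(ler_pM2l M0) => /le_trans; apply.
  by rewrite le_eqVlt; apply/orP; left; apply/eqP; field; exact: lt0r_neq0.
have Md2 : (M * d <= 1 / 5)%R.
  have : (d <= 1 / (5 * M))%R by rewrite ge_min lexx orbT.
  rewrite -(ler_pM2l M0) => /le_trans; apply.
  by rewrite le_eqVlt; apply/orP; left; apply/eqP; field; exact: lt0r_neq0.
exists d, (e1 / 4)%R; split => //; first by rewrite divr_gt0.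
move=> a b e a0 ab bL bad e0 ee g mg g0.
have ab0L y : y \in `[a, b] -> y \in `[0%R, L].
  by rewrite !in_itv/= => /andP[? ?]; apply/andP; split; lra.
have abL y : y \in `[a, b] -> y \in `[(- L)%R, L].
  by move=> /ab0L/in0L_LL.
have lip (u du : R -> R) : (forall y : R, is_derive y 1%R u (du y)) ->
    {in `[(- L)%R, L], forall y, `|du y| <= M}%R ->
    {in `[a, b] &, forall y y', `|u y - u y'| <= M * d}%R.
  move=> uE duM y y' yab y'ab.
  apply: (le_trans (is_derive_segment_lipschitz (fun y _ => uE y) duM
    (abL _ yab) (abL _ y'ab))).
  rewrite ler_pM2l// ler_norml; move: yab y'ab; rewrite !in_itv/=.
  by move=> /andP[? ?] /andP[? ?]; apply/andP; split; lra.
have lf1 := lip _ _ f1E (fun y yL => let: And4 p _ _ _ := MP y yL in p).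
have lf2 := lip _ _ f2E (fun y yL => let: And4 _ p _ _ := MP y yL in p).
have lh1 := lip _ _ h1E (fun y yL => let: And4 _ _ p _ := MP y yL in p).
have lh2 := lip _ _ h2E (fun y yL => let: And4 _ _ _ p := MP y yL in p).
have aab : a \in `[a, b] by rewrite in_itv/= lexx ltW.
have sgn (u : R -> R) : {in `[a, b] &, forall y y', `|u y - u y'| <= M * d}%R ->
    (1 / 2 <= u a ^+ 2)%R ->
    {in `[a, b], forall y, 0 < u y}%R \/ {in `[a, b], forall y, u y < 0}%R.
  move=> lu ua; have [ua0|ua0] := lerP 0%R (u a); [left|right] => y yab.
    have := lu _ _ yab aab; rewrite ler_norml => /andP[l1 l2].
    have : (7 / 10 <= u a)%R by nra.
    lra.
  have := lu _ _ yab aab; rewrite ler_norml => /andP[l1 l2].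
  have : (u a <= - (7 / 10))%R by nra.
  lra.
have big (u : R -> R) : {in `[a, b] &, forall y y', `|u y - u y'| <= M * d}%R ->
    (1 / 2 <= u a ^+ 2)%R -> {in `[a, b], forall y, 1 / 2 <= `|u y|}%R.
  move=> lu ua y yab; have := lu _ _ aab yab.
  have : (7 / 10 <= `|u a|)%R.
    by move: ua; rewrite -real_normK ?num_real//; have := normr_ge0 (u a); nra.
  have := ler_normB (u a - u y)%R (- u y)%R; rewrite opprK subrK normrN.
  by move=> *; lra.
have rep (u v : R -> R) :
    {in `[a, b] &, forall y y', `|u y - u y'| <= M * d}%R ->
    (forall y, `|v y| <= 1)%R -> {in `[a, b], forall y, 1 / 2 <= `|v y|}%R ->
    {in `[a, b] &, forall y y' z, `|z| <= e ->
     `|u y' + z * v y' - u y| <= e1 * `|v y|}%R.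
  move=> lu v1 vb y y' yab y'ab z ze.
  have -> : (u y' + z * v y' - u y = (u y' - u y) + z * v y')%R by ring.
  apply: (le_trans (ler_normD _ _)); rewrite normrM.
  have zv : (`|z| * `|v y'| <= e * 1)%R by apply: ler_pM.
  have := lu _ _ y'ab yab; have := vb _ yab; nra.
have [hh|hh] := lerP (1 / 2)%R (h2 a ^+ 2)%R.
  apply: (@piece_change_of_variables R f1 f2 h1 h2 df1 df2 dh1 dh2 f1E f2E h1E
    h2E cdf1 cdf2 cdh1 cdh2 a b e e1) => //.
  - exact: sgn.
  - by left=> y yab z ze; exact: jpos (ab0L _ yab) _ ze.
  - apply: rep => //; last exact: big.
    by move=> y; have [] := unit_normal_le1 y.
have {}hh : (1 / 2 <= h1 a ^+ 2)%R by have := h_unit a; lra.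
pose g' (x : R * R) := g (x.2, x.1).
have mg' : measurable_fun [set: T2] g'.
  by apply: measurableT_comp => //; exact: measurable_fun_pair.
have := @piece_change_of_variables R f2 f1 h2 h1 df2 df1 dh2 dh1 f2E f1E h2E
    h1E cdf2 cdf1 cdh2 cdh1 a b e e1 ab e0 (sgn _ lh1 hh) _ _ g' mg'
    (fun x => g0 _).
(* The swapped formula is turned back into the original one while its two remaining side conditions,
   abstracted as [P] and [Q], are still pending. *)
have -> : forall P Q, (P -> Q -> \int[mu]_(y in `[a, b[) \int[mu]_(z in `[(- e)%R, e[)
    (`|tube_jac h2 h1 df2 df1 dh2 dh1 y z|%:E * g' (tube_map f2 f1 h2 h1 (y, z))) =
  \int[(mu \x mu)%E]_(x in tube_map f2 f1 h2 h1 @` (`[a, b[%classic `*` `[(- e)%R, e[%classic)) g' x) = (P -> Q -> \int[mu]_(y in `[a, b[) \int[mu]_(z in `[(- e)%R, e[)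
    (`|jac y z|%:E * g (tmap (y, z))) =
  \int[(mu \x mu)%E]_(x in tmap @` (`[a, b[%classic `*` `[(- e)%R, e[%classic)) g x).
  move=> P Q.
  under eq_integral do under eq_integral do rewrite tube_jac_swap normrN /g'/=.
  congr (_ -> _ -> _ = _).
  rewrite integral_mkcond [RHS]integral_mkcond.
  rewrite -[RHS]swap_integral; last 2 first.
  - apply/(measurable_restrictT _ _).1; last exact: measurable_funTS.
    exact: piece_image_measurable.
  - by move=> x; rewrite patchE; case: ifPn.
  apply: eq_integral => -[x y] _; rewrite !patchE /=.
  congr (if _ then _ else _).
  apply/idP/idP => /set_mem[[p q] pq [E1 E2]]; apply/mem_set; exists (p, q) => //.
    by rewrite /tube_map/= in E1 E2 *; rewrite E1 E2.
  by rewrite /tube_map/= in E1 E2 *; rewrite E1 E2.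
apply.
- right=> y yab z ze; rewrite tube_jac_swap oppr_lt0.
  exact: jpos (ab0L _ yab) _ ze.
- apply: rep => //; last exact: big.
  by move=> y; have [] := unit_normal_le1 y.
Qed.

Lemma partial_integral_measurable (D : set R) (K : R * R -> \bar R) :
  measurable D -> measurable_fun [set: T2] K -> (forall x, 0 <= K x) ->
  measurable_fun setT (fun y => \int[mu]_(z in D) K (y, z)).
Proof.
move=> mD mK K0.
have mTD : measurable ([set: R] `*` D : set T2) by exact: measurableX.
have mK' : measurable_fun [set: T2] (K \_ ([set: R] `*` D)).
  by apply/(measurable_restrictT _ _).1 => //; exact: measurable_funTS.
have K'0 x : 0 <= (K \_ ([set: R] `*` D)) x by rewrite patchE; case: ifPn.
have := @measurable_fun_fubini_tonelli_F _ _ (measurableTypeR R)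
  (measurableTypeR R) R mu (K \_ ([set: R] `*` D)) mK' K'0.
rewrite /fubini_F; congr (measurable_fun _ _); apply/funext => y.
rewrite [RHS]integral_mkcond; apply: eq_integral => z _.
rewrite !patchE; congr (if _ then _ else _).
by apply/idP/idP => [/set_mem[_ /= /mem_set]|/set_mem zD]//; exact/mem_set.
Qed.

Lemma tube_jac_continuous : continuous (fun x : R * R => jac x.1 x.2).
Proof.
have cfst : continuous (@fst R R) by move=> x; exact: cvg_fst.
have csnd : continuous (@snd R R) by move=> x; exact: cvg_snd.
have c1 (u : R -> R) : continuous u -> continuous (fun x : R * R => u x.1).
  by move=> cu x; apply: continuous_comp; [exact: cfst|exact: cu].
move=> x; apply: cvgB; apply: cvgM.
- apply: cvgD; first exact: (c1 _ cdf1).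
  by apply: cvgM; [exact: csnd|exact: (c1 _ cdh1)].
- exact: (c1 _ ch2).
- apply: cvgD; first exact: (c1 _ cdf2).
  by apply: cvgM; [exact: csnd|exact: (c1 _ cdh2)].
- exact: (c1 _ ch1).
Qed.

(** The period is cut into equal pieces no longer than [d] and the piece formulas are added by
    induction. Additivity on the plane side needs the images of different pieces to be disjoint,
    which is what global injectivity of the tube map provides. *)
Lemma tube_change_of_variables : exists2 e0 : R, (0 < e0)%R &
  forall e, (0 < e)%R -> (e <= e0)%R ->
  let T := tmap @` (`[0%R, L[%classic `*` `[(- e)%R, e[%classic) in
  [/\ {in `[0%R, L], forall y z, (`|z| <= e)%R -> (0 < jac y z)%R},
    measurable (T : set T2) &
    forall g : R * R -> \bar R, measurable_fun [set: T2] g ->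
    (forall x, 0 <= g x) ->
    \int[mu]_(y in `[0%R, L[) \int[mu]_(z in `[(- e)%R, e[)
      ((jac y z)%:E * g (tmap (y, z))) = \int[(mu \x mu)%E]_(x in T) g x].
Proof.
have [d [e2 [d0 e20 piece]]] := tube_piece.
have [e1 e10 inj] := tube_injective.
have [e3 e30 jpos] := tube_jac_pos.
exists (Num.min e1 (Num.min e2 e3)); first by rewrite !lt_min e10 e20.
move=> e e_gt0; rewrite !le_min => /andP[ee1 /andP[ee2 ee3]] T.
have L_gt0 := L0.
have cF := tube_map_continuous f1E f2E h1E h2E.
have jp y z : y \in `[0%R, L] -> (`|z| <= e)%R -> (0 < jac y z)%R.
  by move=> yL ze; apply: jpos => //; exact: le_trans ee3.
have znorm (z : R) : z \in `[(- e)%R, e[ -> (`|z| <= e)%R.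
  by rewrite in_itv/= => /andP[? ?]; rewrite ler_norml; apply/andP; split; lra.
split; first by move=> y yL z; exact: jp.
  exact: (@image_rectangle_measurable R tmap _ _ _ _ cF).
move=> g mg g0.
transitivity (\int[mu]_(y in `[0%R, L[) \int[mu]_(z in `[(- e)%R, e[)
      (`|jac y z|%:E * g (tmap (y, z)))).
  apply: eq_integral => y /set_mem yL; apply: eq_integral => z /set_mem ze.
  by rewrite gtr0_norm// jp//; [exact: subset_itv_co_cc yL|exact: znorm].
have mK : measurable_fun [set: T2]
    (fun x => `|jac x.1 x.2|%:E * g (tmap x)).
  apply: emeasurable_funM.
    apply/measurable_EFinP/measurableT_comp => //.
    apply: (@continuous_plane_measurable R (fun x => jac x.1 x.2)).
    exact: tube_jac_continuous.
  apply: measurableT_comp => //.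
  have m1 : measurable_fun [set: T2] (fun x => (tmap x).1).
    apply: (@continuous_plane_measurable R (fun x => (tmap x).1)) => x.
    by apply: continuous_comp; [exact: cF|exact: cvg_fst].
  have m2 : measurable_fun [set: T2] (fun x => (tmap x).2).
    apply: (@continuous_plane_measurable R (fun x => (tmap x).2)) => x.
    by apply: continuous_comp; [exact: cF|exact: cvg_snd].
  exact: measurable_fun_pair m1 m2.
have mI : measurable_fun setT (fun y => \int[mu]_(z in `[(- e)%R, e[)
      (`|jac y z|%:E * g (tmap (y, z)))).
  apply: (@partial_integral_measurable _
    (fun x => `|jac x.1 x.2|%:E * g (tmap x))) => // x.
  by rewrite mule_ge0.
have [N N0 LN] : exists2 N : nat, (0 < N)%N & (L / N%:R <= d)%R.
  exists (Num.truncn (L / d)).+1 => //.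
  rewrite ler_pdivrMr// mulrC -ler_pdivrMr// ltW//.
  exact: truncnS_gt.
have N0' : (0 < N%:R :> R)%R by rewrite ltr0n.
pose a k : R := (k%:R * (L / N%:R))%R.
have aN : a N = L by rewrite /a mulrC divfK// gt_eqF.
have a0 k : (0 <= a k)%R by rewrite mulr_ge0// divr_ge0// ltW.
have aS k : (a k < a k.+1)%R.
  by rewrite ltr_pM2r ?divr_gt0// ltr_nat.
have aL k : (k <= N)%N -> (a k <= L)%R.
  by move=> kN; rewrite -aN ler_pM2r ?divr_gt0// ler_nat.
pose Z := `[(- e)%R, e[%classic.
have mO (p q : R) : measurable (tmap @` (`[p, q[%classic `*` Z) : set T2).
  exact: (@image_rectangle_measurable R tmap _ _ _ _ cF).
suff H k : (k <= N)%N ->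
    \int[mu]_(y in `[0%R, a k[) \int[mu]_(z in Z)
      (`|jac y z|%:E * g (tmap (y, z))) =
    \int[(mu \x mu)%E]_(x in tmap @` (`[0%R, a k[%classic `*` Z)) g x.
  by have := H N (leqnn N); rewrite aN.
elim: k => [_|k IH kN].
  have -> : `[0%R, a 0%N[%classic = set0 :> set R.
    by rewrite /a mul0r set_itv_ge// bnd_simp ltxx.
  by rewrite set0X image_set0 !integral_set0.
have aE : `[0%R, a k.+1[%classic =
    `[0%R, a k[%classic `|` `[a k, a k.+1[%classic :> set R.
  apply/seteqP; split=> y /=; rewrite !in_itv/=.
    move=> /andP[y0 ->]; rewrite y0/= andbT.
    by case: (ltP y (a k)) => ?; [left|right].
  by move=> [/andP[-> /lt_trans->]//|/andP[ay ->]]; rewrite andbT (le_trans _ ay).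
rewrite aE ge0_integral_setU//=; last 3 first.
- exact: measurable_funTS.
- by move=> y _; apply: integral_ge0 => z _; rewrite mule_ge0.
- apply/disj_setPS => y /= []; rewrite !in_itv/= => /andP[_ ya] /andP[ay _].
  by move: (lt_le_trans ya ay); rewrite ltxx.
have -> : tmap @` ((`[0%R, a k[%classic `|` `[a k, a k.+1[%classic) `*` Z) =
    tmap @` (`[0%R, a k[%classic `*` Z) `|` tmap @` (`[a k, a k.+1[%classic `*` Z).
  rewrite -image_setU; congr (_ @` _); apply/seteqP; split=> -[p q] /=.
    by move=> [/= [?|?] ?]; [left|right].
  by move=> [[/= ? ?]|[/= ? ?]]; split => //; [left|right].
rewrite ge0_integral_setU//=; last 2 first.
- exact: measurable_funTS.
- apply/disj_setPS => x [[[y z] [/= yk ze] E1] [[y' z'] [/= y'k z'e] E2]].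
  have yy' : y = y'.
    apply: (inj _ _ _ _ z z'); rewrite ?E1 ?E2//.
    - move: yk; rewrite !in_itv/= => /andP[-> ya]/=.
      by rewrite (lt_le_trans ya)// aL// ltnW.
    - move: y'k; rewrite !in_itv/= => /andP[ay ya].
      by rewrite (le_trans _ ay)//= (lt_le_trans ya)// aL.
    - by rewrite (le_trans _ ee1)// znorm.
    - by rewrite (le_trans _ ee1)// znorm.
  move: yk y'k; rewrite yy' /= !in_itv/= => /andP[_ ya] /andP[ay _].
  by move: (lt_le_trans ya ay); rewrite ltxx.
rewrite IH 1?ltnW//; congr (_ + _); apply: piece => //.
- exact: aL.
- rewrite (_ : a k.+1 - a k = L / N%:R)%R// /a -natr1; ring.
Qed.

Local Close Scope ereal_scope.

Lemma period_reduce y : exists2 y0, y0 \in `[0, L[ &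
  [/\ f1 y0 = f1 y, f2 y0 = f2 y, h1 y0 = h1 y & h2 y0 = h2 y].
Proof.
have L_gt0 := L0.
have shift (u : R -> R) : (forall y, u (y + L) = u y) ->
    forall k : int, u (y + k%:~R * L) = u y.
  move=> uL; elim/int_ind => [|k IH|k IH]; first by rewrite mul0r addr0.
    by rewrite intS intrD mulrDl mul1r (addrC L) addrA uL.
  rewrite -uL -addrA; have -> : (- k.+1%:Z)%:~R * L + L = (- k%:Z)%:~R * L.
    by rewrite intS !rmorphN/= intrD; ring.
  exact: IH.
exists (y + (- Num.floor (y / L))%:~R * L); last by split; exact: shift.
rewrite rmorphN/= mulNr in_itv/= subr_ge0 -ler_pdivlMr// floor_le/=.
have := floorD1_gt (y / L); rewrite ltr_pdivrMr// intrD mulrDl mul1r.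
by rewrite ltrBlDr addrC.
Qed.

(** The coordinates of [x] come from a nearest point of the curve: there the squared distance is
    critical, so [x - f c] is orthogonal to the tangent and therefore a multiple of [h c], with
    coefficient equal in size to the distance. *)
Lemma tube_contains (e : R) (x : R * R) : 0 < e ->
  (exists y, (x.1 - f1 y) ^+ 2 + (x.2 - f2 y) ^+ 2 < e ^+ 2) ->
  (tmap @` (`[0, L[%classic `*` `[- e, e[%classic)) x.
Proof.
move=> e0 [y1 y1e]; have L_gt0 := L0.
pose q y := (x.1 - f1 y) ^+ 2 + (x.2 - f2 y) ^+ 2.
pose dq y := - (2 * ((x.1 - f1 y) * df1 y + (x.2 - f2 y) * df2 y)).
have qE (y : R) : is_derive y 1 q (dq y).
  by apply: is_derive_eq; rewrite /dq /GRing.scale/=; ring.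
have cq : continuous q by move=> y; exact: is_derive1_continuous (qE y).
have [c cL cmin] := EVT_min (ltW L0) (continuous_subspaceT cq).
(* Periodicity makes the minimum over one period global, so the derivative vanishes at [c] even when
   [c] is an end of [[0, L]]. *)
have cminT y : q c <= q y.
  have [y0 y0L [E1 E2 _ _]] := period_reduce y.
  rewrite /q -E1 -E2; apply: cmin; exact: subset_itv_co_cc y0L.
have dq0 : dq c = 0.
  have cc : c \in `]c - 1, c + 1[ by rewrite in_itv/=; apply/andP; split; lra.
  have H := @derive1_at_min R q (c - 1) (c + 1) c ltac:(lra)
    (fun t _ => @ex_derive _ _ _ _ _ _ _ (qE t)) cc (fun t _ => cminT t).
  have := qE c => H'.
  by rewrite -(@derive_val _ _ _ _ _ _ _ H') (@derive_val _ _ _ _ _ _ _ H).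
have [y0 y0L [E1 E2 E3 E4]] := period_reduce c.
pose z := (x.1 - f1 c) * h1 c + (x.2 - f2 c) * h2 c.
have vT : (x.1 - f1 c) * df1 c + (x.2 - f2 c) * df2 c = 0.
  by move: dq0; rewrite /dq => /eqP; rewrite oppr_eq0 mulf_eq0 pnatr_eq0/= => /eqP.
have hn := h_normal c; have hu := h_unit c; have hp := h_pos c.
(* The product of two plane cross products expands into dot products; both resulting terms contain a
   vanishing factor, and [hp] allows division by the second cross product. *)
have vh : (x.1 - f1 c) * h2 c - (x.2 - f2 c) * h1 c = 0.
  apply/eqP; rewrite -(mulIr_eq0 _ (mulIf (lt0r_neq0 hp))); apply/eqP.
  transitivity (((x.1 - f1 c) * df1 c + (x.2 - f2 c) * df2 c) *
      (h1 c ^+ 2 + h2 c ^+ 2) -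
    ((x.1 - f1 c) * h1 c + (x.2 - f2 c) * h2 c) *
      (df1 c * h1 c + df2 c * h2 c)); first by ring.
  by rewrite vT hn; ring.
have X1 : x.1 = f1 c + z * h1 c.
  apply/eqP; rewrite -subr_eq0; apply/eqP.
  transitivity ((x.1 - f1 c) * (1 - (h1 c ^+ 2 + h2 c ^+ 2)) +
    h2 c * ((x.1 - f1 c) * h2 c - (x.2 - f2 c) * h1 c)); first by rewrite /z; ring.
  by rewrite vh hu; ring.
have X2 : x.2 = f2 c + z * h2 c.
  apply/eqP; rewrite -subr_eq0; apply/eqP.
  transitivity ((x.2 - f2 c) * (1 - (h1 c ^+ 2 + h2 c ^+ 2)) -
    h1 c * ((x.1 - f1 c) * h2 c - (x.2 - f2 c) * h1 c)); first by rewrite /z; ring.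
  by rewrite vh hu; ring.
have z2 : z ^+ 2 = q c.
  by rewrite /q X1 X2; transitivity (z ^+ 2 * (h1 c ^+ 2 + h2 c ^+ 2));
    [rewrite hu mulr1|ring].
have ze : `|z| < e.
  rewrite -(@ltr_pXn2r _ 2)// ?nnegrE ?(ltW e0)// real_normK ?num_real// z2.
  exact: le_lt_trans (cminT y1) y1e.
exists (y0, z) => /=; last first.
  by rewrite /tube_map/= E1 E2 E3 E4 -X1 -X2; case: (x).
split => //=; rewrite in_itv/=; move: ze; rewrite ltr_norml.
by move=> /andP[/ltW-> ->].
Qed.

End tube.

(** * Normal derivatives of smooth functions *)

Section directional_derivatives.
Context {R : realType}.
Implicit Types (g : R * R -> R) (p v x : R * R).

Lemma MVT_between (u du : R -> R) (a b : R) :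
  (forall y : R, is_derive y 1 u (du y)) ->
  exists2 c, `|c - a| <= `|b - a| & u b - u a = du c * (b - a).
Proof.
move=> uE.
have cu (x y : R) : {within `[x, y], continuous u}.
  apply: continuous_subspaceT => z.
  by apply/differentiable_continuous/derivable1_diffP; have ? := uE z;
    exact: ex_derive.
have [ab|ab|->] := ltgtP a b.
- have [c] := MVT ab (fun y _ => uE y) (cu _ _).
  rewrite in_itv/= => /andP[ac cb] ->; exists c => //.
  by rewrite !gtr0_norm ?subr_gt0// lerB// ltW.
- have [c] := MVT ab (fun y _ => uE y) (cu _ _).
  rewrite in_itv/= => /andP[ac cb] E; exists c.
    by rewrite !ltr0_norm ?subr_lt0// !opprB lerB// ltW.
  by rewrite -opprB E -mulrN opprB.
- by exists b => //; rewrite !subrr mulr0.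
Qed.

Lemma is_derive_line g p v (z d : R) : is_derive (p + z *: v) v g d ->
  is_derive z 1 (fun z : R => g (p + z *: v)) d.
Proof.
move=> [dg gd].
have E : (fun h : R => h^-1 *: (((fun z : R => g (p + z *: v)) \o shift z)
    (h *: (1 : R)) - g (p + z *: v))) =
    (fun h : R => h^-1 *: ((g \o shift (p + z *: v)) (h *: v) - g (p + z *: v))).
  apply/funext => h /=; congr (_ *: (g _ - _)).
  by rewrite scalerDl [h *: 1]mulr1 addrCA.
split; first by rewrite /derivable E.
by rewrite /derive E.
Qed.

(** The increment is taken one coordinate at a time, and the mean value theorem turns each part into
    a partial derivative at an intermediate point; continuity of the partials at [x] does the
    rest. *)
Lemma C1_is_derive g x v : C_on 1 setT g ->
  is_derive x v g (v.1 * 'D_(1, 0) g x + v.2 * 'D_(0, 1) g x).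
Proof.
move=> [_ [dg [c1 _] [c2 _]]].
set d := _ + _.
suff H : (fun h : R => h^-1 *: ((g \o shift x) (h *: v) - g x)) @ 0^' --> d.
  split; first by apply/cvg_ex; exists d.
  exact/cvg_lim.
have partial1 a b (s : R) :
    is_derive s 1 (fun s : R => g (a + s, b)) ('D_(1, 0) g (a + s, b)).
  have := @is_derive_line g (a, b) (1, 0) s ('D_(1, 0) g (a + s, b)).
  have E (r : R) : (a, b) + r *: ((1, 0) : R * R) = (a + r, b).
    by congr pair; rewrite /= /GRing.scale/= ?mulr1 ?mulr0 ?addr0.
  under [X in is_derive s 1 X _]eq_fun do rewrite E.
  apply; rewrite E; apply: DeriveDef => //.
  by have [] := dg (a + s, b) I.
have partial2 a b (s : R) :
    is_derive s 1 (fun s : R => g (a, b + s)) ('D_(0, 1) g (a, b + s)).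
  have := @is_derive_line g (a, b) (0, 1) s ('D_(0, 1) g (a, b + s)).
  have E (r : R) : (a, b) + r *: ((0, 1) : R * R) = (a, b + r).
    by congr pair; rewrite /= /GRing.scale/= ?mulr1 ?mulr0 ?addr0.
  under [X in is_derive s 1 X _]eq_fun do rewrite E.
  apply; rewrite E; apply: DeriveDef => //.
  by have [] := dg (a, b + s) I.
apply/cvgrPdist_lt => e e0.
(* The summand 1 keeps [K] positive when [v] is 0; steps below [r / K] keep both intermediate points
   within [r] of [x]. *)
pose K := `|v.1| + `|v.2| + 1.
have K0 : 0 < K by rewrite /K ltr_wpDl// addr_ge0.
have e'0 : 0 < e / K by rewrite divr_gt0.
have /cvgrPdist_lt/(_ _ e'0)/nbhs_ballP[d1 /= d10 P1] := c1 x I.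
have /cvgrPdist_lt/(_ _ e'0)/nbhs_ballP[d2 /= d20 P2] := c2 x I.
pose r := Num.min d1 d2.
have r0 : 0 < r by rewrite lt_min d10.
have rK0 : 0 < r / K by rewrite divr_gt0.
near=> h.
have h0 : h != 0 by near: h; exact: nbhs_dnbhs_neq.
have hK : `|h| < r / K.
  near: h; apply: dnbhs0_lt => //.
have [s1 s1h E1] := @MVT_between _ _ 0 (h * v.1) (partial1 x.1 (x.2 + h * v.2)).
have [s2 s2h E2] := @MVT_between _ _ 0 (h * v.2) (partial2 x.1 x.2).
rewrite !subr0 in s1h s2h E1 E2.
have vK (i : R) : i = v.1 \/ i = v.2 -> `|h * i| < r.
  move=> iv; rewrite normrM; move: hK; rewrite ltr_pdivlMr//.
  apply: le_lt_trans; rewrite ler_wpM2l//.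
  by case: iv => ->; rewrite /K; have := normr_ge0 v.1; have := normr_ge0 v.2;
    lra.
have -> : h^-1 *: ((g \o shift x) (h *: v) - g x) =
    v.1 * 'D_(1, 0) g (x.1 + s1, x.2 + h * v.2) +
    v.2 * 'D_(0, 1) g (x.1, x.2 + s2).
  have -> : (g \o shift x) (h *: v) - g x =
     (g (x.1 + h * v.1, x.2 + h * v.2) - g (x.1 + 0, x.2 + h * v.2)) +
     (g (x.1, x.2 + h * v.2) - g (x.1, x.2 + 0)).
    rewrite !addr0 /= /shift/=.
    have -> : h *: v + x = (x.1 + h * v.1, x.2 + h * v.2).
      by rewrite [LHS]surjective_pairing/=; congr pair; rewrite addrC.
    by rewrite -surjective_pairing; ring.
  by rewrite E1 E2 /GRing.scale/=; field.
have r1 : r <= d1 by rewrite ge_min lexx.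
have r2 : r <= d2 by rewrite ge_min lexx orbT.
have hv1 := vK _ (or_introl erefl); have hv2 := vK _ (or_intror erefl).
have B1 : `|'D_(1, 0) g x - 'D_(1, 0) g (x.1 + s1, x.2 + h * v.2)| < e / K.
  apply: P1; split; rewrite /= /ball/= opprD addNKr normrN.
    exact: le_lt_trans (lt_le_trans hv1 r1).
  exact: (lt_le_trans hv2).
have B2 : `|'D_(0, 1) g x - 'D_(0, 1) g (x.1, x.2 + s2)| < e / K.
  apply: P2; split; rewrite /= /ball/= ?subrr ?normr0//.
  rewrite opprD addNKr normrN; exact: le_lt_trans (lt_le_trans hv2 r2).
rewrite /d.
set A1 := 'D_(1, 0) g x in B1 *; set A2 := 'D_(0, 1) g x in B2 *.
set A1' := 'D_(1, 0) g _ in B1 *; set A2' := 'D_(0, 1) g _ in B2 *.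
have -> : v.1 * A1 + v.2 * A2 - (v.1 * A1' + v.2 * A2') =
  v.1 * (A1 - A1') + v.2 * (A2 - A2') by ring.
apply: (le_lt_trans (ler_normD _ _)); rewrite !normrM.
have : e / K * K = e by rewrite divfK// gt_eqF.
have := normr_ge0 v.1; have := normr_ge0 v.2.
move: (e / K) e'0 B1 B2 => w w0 B1 B2 n2 n1; rewrite /K => <-.
have : `|v.1| * `|A1 - A1'| <= `|v.1| * w by rewrite ler_wpM2l// ltW.
have : `|v.2| * `|A2 - A2'| <= `|v.2| * w by rewrite ler_wpM2l// ltW.
lra.
Unshelve. all: end_near. Qed.

Definition smooth_fun g := forall n, C_on n setT g.

Lemma smooth_fun_partial g : smooth_fun g ->
  smooth_fun ('D_(1, 0) g) /\ smooth_fun ('D_(0, 1) g).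
Proof. by move=> sg; split=> n; have [_ []] := sg n.+1. Qed.

Lemma smooth_fun_continuous g : smooth_fun g -> continuous g.
Proof. by move=> sg x; have [c _] := sg 0%N; exact: c. Qed.

(** The k-th power of the operator v . grad with constant [v], expanded over partial derivatives.
    Unlike an iterated derivative along a line, it makes sense with [v] and the base point varying
    independently, which gives joint continuity. *)
Fixpoint dirn (k : nat) g v : R * R -> R :=
  if k is k'.+1 then fun x =>
    v.1 * dirn k' ('D_(1, 0) g) v x + v.2 * dirn k' ('D_(0, 1) g) v x
  else g.

Lemma is_derive_dirn k g p v (z : R) : smooth_fun g ->
  is_derive z 1 (fun z => dirn k g v (p + z *: v)) (dirn k.+1 g v (p + z *: v)).
Proof.
elim: k g => [|k IH] g sg; first exact/is_derive_line/C1_is_derive/sg.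
have [s1 s2] := smooth_fun_partial sg.
have ? := IH _ s1; have ? := IH _ s2.
by apply: is_derive_eq.
Qed.

Lemma derive1n_line k g p v : smooth_fun g ->
  derive1n k (fun z : R => g (p + z *: v)) = fun z => dirn k g v (p + z *: v).
Proof.
move=> sg; elim: k => [|k IH]; first by [].
rewrite derive1nS IH; apply/funext => z; rewrite derive1E.
have ? := is_derive_dirn k p v z sg.
exact: derive_val.
Qed.

(** Used with [V] the normal at y and [X] the point f(y) + z h(y): joint continuity in (y, z) gives
    bounds on compact rectangles, hence uniformity in y. *)
Lemma dirn_continuous (T : topologicalType) k g (V X : T -> R * R) :
  smooth_fun g -> continuous (fst \o V) -> continuous (snd \o V) ->
  continuous X -> continuous (fun t => dirn k g (V t) (X t)).
Proof.
move=> + c1 c2 cX; elim: k g => [|k IH] g sg.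
  by move=> t; apply: continuous_comp; [exact: cX|exact: smooth_fun_continuous].
have [s1 s2] := smooth_fun_partial sg.
move=> t; apply: cvgD; apply: cvgM.
- exact: c1.
- exact: IH.
- exact: c2.
- exact: IH.
Qed.

End directional_derivatives.

Section smooth_algebra.
Context {R : realType}.
Implicit Types (g k : R * R -> R).

Lemma C_onS n g : C_on n.+1 setT g -> C_on n setT g.
Proof.
elim: n g => [|n IH] g [cg [dg c1 c2]]; first exact: conj cg I.
exact: conj cg (And3 dg (IH _ c1) (IH _ c2)).
Qed.

Lemma C_on_cst n (c : R) : C_on n setT (cst c : R * R -> R).
Proof.
elim: n c => [|n IH] c; first by split; [move=> x _; exact: cvg_cst|].
have E v : 'D_v (cst c : R * R -> R) = cst 0.
  by apply/funext => x; rewrite derive_cst.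
split=> [x _|]; first exact: cvg_cst.
split; [|by rewrite E; exact: IH|by rewrite E; exact: IH].
by move=> x _; split; exact: derivable_cst.
Qed.

Lemma C_onD n g k : C_on n setT g -> C_on n setT k ->
  C_on n setT (fun x => g x + k x).
Proof.
elim: n g k => [|n IH] g k.
  move=> [cg _] [ck _]; split; last by [].
  by move=> x _; apply: cvgD; [exact: cg|exact: ck].
move=> [cg [dg c1 c2]] [ck [dk k1 k2]].
split=> [x _|]; first by apply: cvgD; [exact: cg|exact: ck].
have E v : (forall x, derivable g x v) -> (forall x, derivable k x v) ->
    'D_v (fun x => g x + k x) = fun x => 'D_v g x + 'D_v k x.
  by move=> gv kv; apply/funext => x; rewrite deriveD.
have dg1 x : derivable g x (1, 0) by have [] := dg x I.
have dg2 x : derivable g x (0, 1) by have [] := dg x I.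
have dk1 x : derivable k x (1, 0) by have [] := dk x I.
have dk2 x : derivable k x (0, 1) by have [] := dk x I.
split.
- by move=> x _; split; apply: derivableD.
- rewrite (E _ dg1 dk1); exact: (IH _ _ c1 k1).
- rewrite (E _ dg2 dk2); exact: (IH _ _ c2 k2).
Qed.

Lemma C_onM n g k : C_on n setT g -> C_on n setT k ->
  C_on n setT (fun x => g x * k x).
Proof.
elim: n g k => [|n IH] g k.
  move=> [cg _] [ck _]; split; last by [].
  by move=> x _; apply: cvgM; [exact: cg|exact: ck].
(* The product rule leaves one factor undifferentiated, so the induction hypothesis also needs [g]
   and [k] themselves at the lower order. *)
move=> sg sk; have sg' := C_onS sg; have sk' := C_onS sk.
case: sg sk => [cg [dg c1 c2]] [ck [dk k1 k2]].
split=> [x _|]; first by apply: cvgM; [exact: cg|exact: ck].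
have E v : (forall x, derivable g x v) -> (forall x, derivable k x v) ->
    'D_v (fun x => g x * k x) = fun x => g x * 'D_v k x + k x * 'D_v g x.
  by move=> gv kv; apply/funext => x; rewrite deriveM.
have dg1 x : derivable g x (1, 0) by have [] := dg x I.
have dg2 x : derivable g x (0, 1) by have [] := dg x I.
have dk1 x : derivable k x (1, 0) by have [] := dk x I.
have dk2 x : derivable k x (0, 1) by have [] := dk x I.
split.
- by move=> x _; split; apply: derivableM.
- rewrite (E _ dg1 dk1); exact: (C_onD (IH _ _ sg' k1) (IH _ _ sk' c1)).
- rewrite (E _ dg2 dk2); exact: (C_onD (IH _ _ sg' k2) (IH _ _ sk' c2)).
Qed.

Lemma is_derive_additive (x v : R * R) (u : R * R -> R) (c : R) :
  (forall h : R, u (h *: v + x) = h * c + u x) -> is_derive x v u c.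
Proof.
move=> uE.
have cv : (fun h : R => h^-1 *: ((u \o shift x) (h *: v) - u x)) @ 0^' --> c.
  apply: cvg_near_cst; near=> h.
  have h0 : h != 0 by near: h; exact: nbhs_dnbhs_neq.
  by rewrite /= /shift/= uE addrK /GRing.scale/= mulKf.
split; first by apply/cvg_ex; exists c.
exact/cvg_lim.
Unshelve. all: end_near. Qed.

Lemma smooth_fst : smooth_fun (@fst R R).
Proof.
move=> [|n]; first by split => [x _|]; [exact: cvg_fst|].
have dE x (v : R * R) : is_derive x v (@fst R R) v.1.
  by apply: is_derive_additive.
have E v : 'D_v (@fst R R) = cst v.1 :> (R * R -> R).
  by apply/funext => x; exact: (@derive_val _ _ _ _ _ _ _ (dE x v)).
split=> [x _|]; first exact: cvg_fst.
split.
- by move=> x _; split; apply: (@ex_derive _ _ _ _ _ _ _ (dE _ _)).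
- by rewrite E; exact: C_on_cst.
- by rewrite E; exact: C_on_cst.
Qed.

Lemma smooth_snd : smooth_fun (@snd R R).
Proof.
move=> [|n]; first by split => [x _|]; [exact: cvg_snd|].
have dE x (v : R * R) : is_derive x v (@snd R R) v.2.
  by apply: is_derive_additive.
have E v : 'D_v (@snd R R) = cst v.2 :> (R * R -> R).
  by apply/funext => x; exact: (@derive_val _ _ _ _ _ _ _ (dE x v)).
split=> [x _|]; first exact: cvg_snd.
split.
- by move=> x _; split; apply: (@ex_derive _ _ _ _ _ _ _ (dE _ _)).
- by rewrite E; exact: C_on_cst.
- by rewrite E; exact: C_on_cst.
Qed.

Lemma Psi_smooth (Phi : R * R -> R * R) : smooth_map_on setT Phi ->
  smooth_fun (fst \o Psi Phi) /\ smooth_fun (snd \o Psi Phi).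
Proof.
move=> sPhi.
have E1 : fst \o Psi Phi = fun x => (fst \o Phi) x + cst (-1) x * x.1.
  by apply/funext => x; rewrite /= mulN1r.
have E2 : snd \o Psi Phi = fun x => (snd \o Phi) x + cst (-1) x * x.2.
  by apply/funext => x; rewrite /= mulN1r.
split=> n; rewrite ?E1 ?E2.
  exact: (C_onD (sPhi n).1 (C_onM (C_on_cst n _) (smooth_fst n))).
exact: (C_onD (sPhi n).2 (C_onM (C_on_cst n _) (smooth_snd n))).
Qed.

Lemma S_ofE (Phi : R * R -> R * R) x : S_of Phi x =
  2^-1 * ((Psi Phi x).1 * (Psi Phi x).1 + (Psi Phi x).2 * (Psi Phi x).2).
Proof. by []. Qed.

Lemma S_smooth (Phi : R * R -> R * R) : smooth_map_on setT Phi ->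
  smooth_fun (S_of Phi).
Proof.
move=> /Psi_smooth[s1 s2] n.
have -> : S_of Phi = fun x => cst 2^-1 x * ((fst \o Psi Phi) x * (fst \o Psi Phi) x
   + (snd \o Psi Phi) x * (snd \o Psi Phi) x) by apply/funext.
exact: (C_onM (C_on_cst n _) (C_onD (C_onM (s1 n) (s1 n)) (C_onM (s2 n) (s2 n)))).
Qed.

End smooth_algebra.

(** * Taylor remainders, and derivatives of half a squared norm *)

Section taylor.
Context {R : realType}.

(** Differentiating the remainder gives the remainder of [G 1] one order lower, so the mean value
    theorem and induction suffice. The factorial of the sharp bound is given up, since only the
    power of [|z|] matters. *)
Lemma taylor_bound (n : nat) (G : nat -> R -> R) (C e : R) :
  (forall k (z : R), is_derive z 1 (G k) (G k.+1 z)) ->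
  (forall z, `|z| <= e -> `|G n.+1 z| <= C) ->
  forall z, `|z| <= e ->
    `|G 0%N z - \sum_(j < n.+1) G j 0 / j`!%:R * z ^+ j| <= C * `|z| ^+ n.+1.
Proof.
elim: n G => [|n IH] G GE GC z ze.
  rewrite big_ord1 expr0 mulr1 fact0 divr1.
  have [c cz ->] := @MVT_between R (G 0%N) (G 1%N) 0 z (GE 0%N).
  rewrite !subr0 in cz *; rewrite normrM expr1 ler_wpM2r//.
  by apply: GC; exact: le_trans ze.
pose T (z : R) := \sum_(j < n.+2) G j 0 / j`!%:R * z ^+ j.
pose T' (z : R) := \sum_(j < n.+1) G j.+1 0 / j`!%:R * z ^+ j.
have TE (y : R) : is_derive y 1 T (T' y).
  have -> : T = \sum_(j < n.+2) (fun z => G j 0 / j`!%:R * z ^+ j).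
    by apply/funext => w; rewrite fct_sumE.
  have -> : T' y = \sum_(j < n.+2) (G j 0 / j`!%:R * (j%:R * y ^+ j.-1)).
    rewrite big_ord_recl/= !mul0r mulr0 add0r; apply: eq_bigr => j _.
    rewrite /bump/= add1n add0n factS natrM; field.
    by rewrite pnatr_eq0 -lt0n fact_gt0 nat1r pnatr_eq0.
  have := @is_derive_sum R R R n.+2 (fun j z => G j 0 / j`!%:R * z ^+ j) y 1
    (fun j => G j 0 / j`!%:R * (j%:R * y ^+ j.-1)); apply => j.
  have Xj : is_derive y 1 (fun z : R => z ^+ j) (j%:R * y ^+ j.-1).
    apply: DeriveDef; first exact: exprn_derivable.
    by rewrite exp_derive /GRing.scale/= mulr1.
  by apply: is_derive_eq; rewrite /GRing.scale/=; ring.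
have dE (y : R) : is_derive y 1 (fun y => G 0%N y - T y) (G 1%N y - T' y).
  by have ? := GE 0%N y; have ? := TE y; exact: is_deriveB.
have [c cz] := @MVT_between R _ _ 0 z dE.
have T0 : T 0 = G 0%N 0.
  rewrite /T big_ord_recl/= expr0 fact0 divr1 mulr1 big1 ?addr0// => j _.
  by rewrite /bump/= expr0n/= mulr0.
rewrite T0 subrr !subr0 -/(T z) => ->; rewrite !subr0 in cz.
rewrite normrM exprSr mulrA ler_wpM2r//.
have := IH (fun k => G k.+1) (fun k => GE k.+1) GC c (le_trans cz ze).
move=> /le_trans; apply; rewrite ler_wpM2l//.
  by apply: le_trans (GC 0 _) => //; rewrite normr0 (le_trans _ ze).
by rewrite lerXn2r ?nnegrE.
Qed.

(** Each line follows from the previous one by the Leibniz rule for [D i j] and its symmetry in the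
    indices. The terms with index 0 are kept here; they vanish later, at points of the curve. *)
Lemma half_square_derivatives (U V : nat -> R -> R) :
  (forall k (z : R), is_derive z 1 (U k) (U k.+1 z)) ->
  (forall k (z : R), is_derive z 1 (V k) (V k.+1 z)) ->
  let W z := 2^-1 * (U 0%N z * U 0%N z + V 0%N z * V 0%N z) in
  let D i j z := U i z * U j z + V i z * V j z in
  [/\ derive1n 1 W = D 0%N 1%N,
    derive1n 2 W = fun z => D 0%N 2%N z + D 1%N 1%N z,
    derive1n 3 W = fun z => D 0%N 3%N z + 3 * D 1%N 2%N z,
    derive1n 4 W = fun z => D 0%N 4%N z + 4 * D 1%N 3%N z + 3 * D 2%N 2%N z &
    derive1n 5 W = (fun z => D 0%N 5%N z + 5 * D 1%N 4%N z + 10 * D 2%N 3%N z) /\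
    derive1n 6 W = fun z => D 0%N 6%N z + 6 * D 1%N 5%N z + 15 * D 2%N 4%N z + 10 * D 3%N 3%N z].
Proof.
move=> UE VE W D.
have DE i j (z : R) : is_derive z 1 (D i j) (D i.+1 j z + D i j.+1 z).
  have ? := UE i z; have ? := UE j z; have ? := VE i z; have ? := VE j z.
  by apply: is_derive_eq; rewrite /D /GRing.scale/=; ring.
have Dsym i j z : D i j z = D j i z by rewrite /D; ring.
have val (f : R -> R) (df : R -> R) : (forall z : R, is_derive z 1 f (df z)) ->
    derive1 f = df.
  by move=> fE; apply/funext => z; rewrite derive1E; have ? := fE z;
    exact: derive_val.
have E1 : derive1n 1 W = D 0%N 1%N.
  rewrite derive1n1; apply: val => z.
  have -> : W = (fun z => 2^-1 * D 0%N 0%N z) by [].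
  have ? := DE 0%N 0%N z; apply: is_derive_eq.
  by rewrite /D /GRing.scale/=; field.
have E2 : derive1n 2 W = fun z => D 0%N 2%N z + D 1%N 1%N z.
  rewrite derive1nS E1; apply: val => z.
  by have ? := DE 0%N 1%N z; apply: is_derive_eq; rewrite addrC.
have E3 : derive1n 3 W = fun z => D 0%N 3%N z + 3 * D 1%N 2%N z.
  rewrite derive1nS E2; apply: val => z.
  have ? := DE 0%N 2%N z; have ? := DE 1%N 1%N z.
  by apply: is_derive_eq; rewrite (Dsym 2%N 1%N); ring.
have E4 : derive1n 4 W = fun z => D 0%N 4%N z + 4 * D 1%N 3%N z + 3 * D 2%N 2%N z.
  rewrite derive1nS E3; apply: val => z.
  have ? := DE 0%N 3%N z; have ? := DE 1%N 2%N z.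
  by apply: is_derive_eq; rewrite /GRing.scale/=; ring.
have E5 : derive1n 5 W = fun z => D 0%N 5%N z + 5 * D 1%N 4%N z + 10 * D 2%N 3%N z.
  rewrite derive1nS E4; apply: val => z.
  have ? := DE 0%N 4%N z; have ? := DE 1%N 3%N z; have ? := DE 2%N 2%N z.
  by apply: is_derive_eq; rewrite /GRing.scale/= (Dsym 3%N 2%N); ring.
split => //; split => //.
rewrite derive1nS E5; apply: val => z.
have ? := DE 0%N 5%N z; have ? := DE 1%N 4%N z; have ? := DE 2%N 3%N z.
by apply: is_derive_eq; rewrite /GRing.scale/=; ring.
Qed.

End taylor.

(** * Asymptotic expansions with polynomial growth *)

Section formal.
Context {R : realType}.
Implicit Types (a b : nat -> R).

Lemma fps_pow_small a m n : a 0%N = 0 -> (n < m)%N -> fps_pow a m n = 0.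
Proof.
move=> a0; elim: m n => // m IH n nm; rewrite /fps_pow iterS -/(fps_pow a m).
rewrite /fps_mul big_ord_recl/= a0 mul0r add0r big1// => i _.
rewrite IH ?mulr0//= /bump/= add1n.
by case: n nm i => [|n] nm [i ni]//=; rewrite subSS; lia.
Qed.

(** Powers above [n] do not reach the coefficient of order [n], so one truncation of the exponential
    sum serves all orders up to [N]; this allows a single Taylor polynomial in [expansion_exp]. *)
Lemma fps_exp_wide a N n : a 0%N = 0 -> (n <= N)%N ->
  \sum_(m < N.+1) (m`!%:R)^-1 * fps_pow a m n = fps_exp a n.
Proof.
move=> a0 nN; rewrite /fps_exp.
rewrite (big_ord_widen_cond N.+1 xpredT (fun m => fps_pow a m n / m`!%:R))//.
rewrite [RHS]big_mkcond/=; apply: eq_bigr => m _.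
rewrite mulrC; case: ltnP => // nm.
by rewrite fps_pow_small ?mul0r.
Qed.

(** This is [taylor_bound] for the constant family [expR], on the interval of radius [|x|]. *)
Lemma expR_taylor_bound n (x : R) :
  `|expR x - \sum_(m < n.+1) (m`!%:R)^-1 * x ^+ m| <=
  expR `|x| * `|x| ^+ n.+1.
Proof.
have := @taylor_bound R n (fun _ => expR) (expR `|x|) `|x|.
move=> /(_ (fun _ z => is_derive_expR z)) H.
have -> : \sum_(m < n.+1) (m`!%:R)^-1 * x ^+ m =
    \sum_(m < n.+1) expR 0 / m`!%:R * x ^+ m.
  by apply: eq_bigr => m _; rewrite expR0 mul1r.
apply: H => // z zx; rewrite ger0_norm ?expR_ge0// ler_expR.
exact: le_trans (ler_norm _) zx.
Qed.

End formal.

Section expansions.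
(* om p weighs the growth in the unbounded normal variable; it is 1 + |z| in
   the application. *)
Context {R : realType} {T : Type}.
Variables (D : set T) (tau om : T -> R).
Hypotheses (tau0 : forall p, D p -> 0 <= tau p).
Hypotheses (tau1 : forall p, D p -> tau p <= 1).
Hypotheses (om1 : forall p, D p -> 1 <= om p).
Implicit Types (u v : T -> R) (a b : nat -> T -> R).

Definition poly_growth u :=
  exists C M, 0 <= C /\ forall p, D p -> `|u p| <= C * om p ^+ M.

Let om_exp p m n : D p -> (m <= n)%N -> om p ^+ m <= om p ^+ n.
Proof. by move=> Dp mn; apply: ler_weXn2l => //; exact: om1. Qed.

Lemma poly_growth_bounded u (C : R) : (forall p, D p -> `|u p| <= C) ->
  poly_growth u.
Proof.
move=> uC; exists `|C|, 0%N; split => // p Dp; rewrite expr0 mulr1.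
exact: le_trans (uC p Dp) (ler_norm _).
Qed.

Lemma poly_growth_cst (c : R) : poly_growth (fun=> c).
Proof. exact: (@poly_growth_bounded _ `|c|). Qed.

Lemma poly_growthD u v : poly_growth u -> poly_growth v ->
  poly_growth (fun p => u p + v p).
Proof.
move=> [C [M [C0 uC]]] [C' [M' [C'0 vC]]].
exists (C + C'), (M + M')%N; split; first exact: addr_ge0.
move=> p Dp; rewrite mulrDl (le_trans (ler_normD _ _))// lerD//.
  rewrite (le_trans (uC p Dp))// ler_wpM2l// om_exp// leq_addr//.
by rewrite (le_trans (vC p Dp))// ler_wpM2l// om_exp// leq_addl.
Qed.

Lemma poly_growthM u v : poly_growth u -> poly_growth v ->
  poly_growth (fun p => u p * v p).
Proof.
move=> [C [M [C0 uC]]] [C' [M' [C'0 vC]]].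
exists (C * C'), (M + M')%N; split; first exact: mulr_ge0.
move=> p Dp; rewrite exprD mulrACA normrM.
by apply: ler_pM; rewrite ?uC ?vC.
Qed.

Lemma poly_growth_sum (I : Type) (r : seq I) (P : pred I) (F : I -> T -> R) :
  (forall i, P i -> poly_growth (F i)) ->
  poly_growth (fun p => \sum_(i <- r | P i) F i p).
Proof.
move=> FP; elim: r => [|i r IH].
  by under eq_fun do rewrite big_nil; exact: poly_growth_cst.
case: (boolP (P i)) => Pi; last first.
  by under eq_fun do rewrite big_cons (negbTE Pi).
under eq_fun do rewrite big_cons Pi.
by apply: poly_growthD => //; exact: FP.
Qed.

Lemma poly_growthX u n : poly_growth u -> poly_growth (fun p => u p ^+ n).
Proof.
move=> up; elim: n => [|n IH]; first exact: poly_growth_cst.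
by under eq_fun do rewrite exprS; exact: poly_growthM.
Qed.

Lemma eq_poly_growth u v : (forall p, D p -> u p = v p) -> poly_growth u ->
  poly_growth v.
Proof.
by move=> uv [C [M [C0 uC]]]; exists C, M; split=> // p Dp; rewrite -uv// uC.
Qed.

(** The points of [D] carry their own value of the small parameter, so [tau] is a function on [T]
    and the estimate is uniform in all other variables. The error may grow in [om] in the same way
    as the coefficients. *)
Definition expansion N u a := (forall n, (n <= N)%N -> poly_growth (a n)) /\
  exists C M, 0 <= C /\ forall p, D p ->
   `|u p - \sum_(n < N.+1) tau p ^+ n * a n p| <= C * tau p ^+ N.+1 * om p ^+ M.

Lemma expansion_remainder N u a (r : T -> R) : poly_growth r ->
  (forall n, (n <= N)%N -> poly_growth (a n)) ->
  (forall p, D p ->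
    u p - \sum_(n < N.+1) tau p ^+ n * a n p = tau p ^+ N.+1 * r p) ->
  expansion N u a.
Proof.
move=> [C [M [C0 rC]]] aP uE; split => //; exists C, M; split=> // p Dp.
rewrite uE// normrM ger0_norm ?exprn_ge0 ?tau0// -mulrA mulrCA.
by rewrite ler_wpM2l ?exprn_ge0 ?tau0 ?rC.
Qed.

Lemma expansion_growth N u a : expansion N u a -> poly_growth u.
Proof.
move=> [aP [C [M [C0 uC]]]].
have : poly_growth (fun p => (u p - \sum_(n < N.+1) tau p ^+ n * a n p)
    + \sum_(n < N.+1) tau p ^+ n * a n p).
  apply: poly_growthD; last first.
    apply: poly_growth_sum => n _; apply: poly_growthM.
      apply: poly_growthX; apply: (@poly_growth_bounded _ 1) => p Dp.
      by rewrite ger0_norm ?tau0 ?tau1.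
    by apply: aP; rewrite -ltnS.
  exists C, M; split=> // p Dp; rewrite (le_trans (uC p Dp))//.
  rewrite ler_wpM2r ?exprn_ge0 ?(le_trans ler01) ?om1//.
  by rewrite -[leRHS]mulr1 ler_wpM2l// exprn_ile1 ?tau0 ?tau1.
by apply: eq_poly_growth => p Dp; rewrite subrK.
Qed.

(** Terms of the product of the two truncations beyond order [N] carry a factor [tau ^+ N.+1], and
    what remains of them has polynomial growth because [tau] is at most 1. The error of each factor
    is multiplied by a quantity of polynomial growth. *)
Lemma expansionM N u v a b : expansion N u a -> expansion N v b ->
  expansion N (fun p => u p * v p)
    (fun n p => fps_mul (a ^~ p) (b ^~ p) n).
Proof.
move=> ua vb; have ug := expansion_growth ua; have vg := expansion_growth vb.
case: ua vb => [aP [C [M [C0 uC]]]] [bP [C' [M' [C'0 vC]]]].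
(* Viewing the truncations as polynomials in [tau] lets [coefM] and [horner_coef_wide] sort the
   product by order; up to [N] its coefficients are those of [fps_mul]. *)
pose pa p := \poly_(n < N.+1) a n p; pose pb p := \poly_(n < N.+1) b n p.
pose c n p := (pa p * pb p)`_n.
have cP n : poly_growth (c n).
  rewrite /c; under eq_fun do rewrite coefM.
  apply: poly_growth_sum => i _; apply: poly_growthM.
    rewrite /pa; under eq_fun do rewrite coef_poly.
    by case: ltnP => ?; [exact: aP|exact: poly_growth_cst].
  rewrite /pb; under eq_fun do rewrite coef_poly.
  by case: ltnP => ?; [exact: bP|exact: poly_growth_cst].
have cE n p : (n <= N)%N -> c n p = fps_mul (a ^~ p) (b ^~ p) n.
  move=> nN; rewrite /c coefM; apply: eq_bigr => i _.
  by rewrite !coef_poly !ifT// ltnS; have := ltn_ord i; lia.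
have evE p d : (\poly_(n < N.+1) d n : {poly R}).[tau p] =
    \sum_(n < N.+1) tau p ^+ n * d n.
  by rewrite horner_poly; apply: eq_bigr => n _; rewrite mulrC.
pose A p := \sum_(n < N.+1) tau p ^+ n * a n p.
pose B p := \sum_(n < N.+1) tau p ^+ n * b n p.
have AB p : A p * B p = \sum_(n < N.+1) tau p ^+ n * c n p +
    tau p ^+ N.+1 * \sum_(n < N.+1) tau p ^+ n * c (N.+1 + n)%N p.
  rewrite /A -(evE p (a ^~ p)) /B -(evE p (b ^~ p)) -hornerM.
  have sz : (size (pa p * pb p)%R <= N.+1 + N.+1)%N.
    rewrite (leq_trans (size_polyMleq _ _))//.
    have := size_poly N.+1 (a ^~ p); have := size_poly N.+1 (b ^~ p).
    by rewrite -/(pa p) -/(pb p); lia.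
  rewrite (horner_coef_wide _ sz) big_split_ord/=; congr (_ + _).
    by apply: eq_bigr => i _; rewrite mulrC.
  rewrite big_distrr/=; apply: eq_bigr => i _.
  by rewrite mulrA -exprD mulrC.
have Ag : poly_growth A.
  apply: poly_growth_sum => n _; apply: poly_growthM.
    apply: poly_growthX; apply: (@poly_growth_bounded _ 1) => p Dp.
    by rewrite ger0_norm ?tau0 ?tau1.
  by apply: aP; rewrite -ltnS.
split=> [n nN|].
  by apply: (@eq_poly_growth (c n)) => // p _; exact: cE.
have [K [m [K0 KP]]] : poly_growth (fun p => (C * om p ^+ M) * `|v p| +
    `|A p| * (C' * om p ^+ M') +
    `|\sum_(n < N.+1) tau p ^+ n * c (N.+1 + n)%N p|).
  have omg k : poly_growth (fun p => om p ^+ k).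
    apply: poly_growthX; exists 1, 1%N; split => // p Dp.
    by rewrite mul1r expr1 ger0_norm// (le_trans ler01)// om1.
  have ng w : poly_growth w -> poly_growth (fun p => `|w p|).
    by move=> [k [l [? H]]]; exists k, l; split => // p Dp; rewrite normr_id H.
  apply: poly_growthD; first apply: poly_growthD.
  - apply: poly_growthM; last exact: ng.
    by apply: poly_growthM => //; exact: poly_growth_cst.
  - apply: poly_growthM; first exact: ng.
    by apply: poly_growthM => //; exact: poly_growth_cst.
  - apply: ng; apply: poly_growth_sum => n _; apply: poly_growthM => //.
    apply: poly_growthX; apply: (@poly_growth_bounded _ 1) => p Dp.
    by rewrite ger0_norm ?tau0 ?tau1.
exists K, m; split => // p Dp.
have t0 : 0 <= tau p ^+ N.+1 by rewrite exprn_ge0 ?tau0.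
have o0 k : 0 <= om p ^+ k by rewrite exprn_ge0 ?(le_trans ler01) ?om1.
have -> : u p * v p - \sum_(n < N.+1) tau p ^+ n * fps_mul (a ^~ p) (b ^~ p) n =
    (u p - A p) * v p + A p * (v p - B p) +
    tau p ^+ N.+1 * \sum_(n < N.+1) tau p ^+ n * c (N.+1 + n)%N p.
  have -> : \sum_(n < N.+1) tau p ^+ n * fps_mul (a ^~ p) (b ^~ p) n =
      \sum_(n < N.+1) tau p ^+ n * c n p.
    by apply: eq_bigr => n _; rewrite cE// -ltnS.
  by have := AB p; set Z := \sum_(n < N.+1) _ * c n p => H;
    rewrite mulrBr H; ring.
apply: (@le_trans _ _ (tau p ^+ N.+1 * (C * om p ^+ M * `|v p| +
    `|A p| * (C' * om p ^+ M') +
    `|\sum_(n < N.+1) tau p ^+ n * c (N.+1 + n)%N p|))); last first.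
  rewrite [leRHS](_ : _ = tau p ^+ N.+1 * (K * om p ^+ m)); last by ring.
  rewrite ler_wpM2l//; apply: le_trans (KP p Dp).
  exact: ler_norm.
rewrite [leRHS]mulrDr [X in _ <= X + _]mulrDr.
rewrite (le_trans (ler_normD _ _))// lerD//; last first.
  by rewrite normrM (ger0_norm t0).
rewrite (le_trans (ler_normD _ _))//; apply: lerD; rewrite normrM.
  by rewrite [leRHS]mulrA ler_wpM2r// (le_trans (uC p Dp))// mulrA (mulrC C).
rewrite mulrCA ler_wpM2l// (le_trans (vC p Dp))//.
by rewrite mulrA (mulrC C').
Qed.

Lemma expansion_one N : expansion N (fun=> 1) (fun n _ => fps_one R n).
Proof.
apply: (expansion_remainder (poly_growth_cst 0)) => [n _|p Dp].
  exact: poly_growth_cst.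
rewrite mulr0 big_ord_recl/= expr0 mul1r big1 ?addr0 ?subrr// => i _.
by rewrite /fps_one/= mulr0.
Qed.

Lemma expansionX N u a m : expansion N u a ->
  expansion N (fun p => u p ^+ m) (fun n p => fps_pow (a ^~ p) m n).
Proof.
move=> ua; elim: m => [|m IH]; first exact: expansion_one.
by under eq_fun do rewrite exprS; exact: expansionM.
Qed.

Lemma expansion_lin N (K : nat) (c : nat -> R) (u : nat -> T -> R)
    (a : nat -> nat -> T -> R) :
  (forall m, expansion N (u m) (a m)) ->
  expansion N (fun p => \sum_(m < K) c m * u m p)
    (fun n p => \sum_(m < K) c m * a m n p).
Proof.
move=> ua; split=> [n nN|].
  apply: poly_growth_sum => m _; apply: poly_growthM.
    exact: poly_growth_cst.
  exact: (ua m).1.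
elim: K => [|K [C [M [C0 IH]]]].
  exists 0, 0%N; split => // p Dp; rewrite big_ord0 big1 ?subrr ?normr0 ?mul0r//.
  by move=> i _; rewrite big_ord0 mulr0.
have [_ [C' [M' [C'0 uC]]]] := ua K.
exists (C + `|c K| * C'), (M + M')%N; split.
  by rewrite addr_ge0// mulr_ge0.
move=> p Dp.
have t0 : 0 <= tau p ^+ N.+1 by rewrite exprn_ge0 ?tau0.
have -> : \sum_(m < K.+1) c m * u m p -
    \sum_(n < N.+1) tau p ^+ n * (\sum_(m < K.+1) c m * a m n p) =
   (\sum_(m < K) c m * u m p -
    \sum_(n < N.+1) tau p ^+ n * (\sum_(m < K) c m * a m n p)) +
   c K * (u K p - \sum_(n < N.+1) tau p ^+ n * a K n p).
  have -> : \sum_(n < N.+1) tau p ^+ n * (\sum_(m < K.+1) c m * a m n p) =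
      \sum_(n < N.+1) tau p ^+ n * (\sum_(m < K) c m * a m n p) +
      c K * \sum_(n < N.+1) tau p ^+ n * a K n p.
    rewrite mulr_sumr -big_split/=; apply: eq_bigr => n _.
    by rewrite big_ord_recr/= mulrDr; congr (_ + _); rewrite mulrCA.
  by rewrite big_ord_recr/=; ring.
rewrite (le_trans (ler_normD _ _))// !mulrDl lerD//.
  rewrite (le_trans (IH p Dp))// ler_wpM2l ?mulr_ge0// om_exp// leq_addr//.
rewrite normrM -!mulrA ler_wpM2l// mulrA (le_trans (uC p Dp))//.
by rewrite ler_wpM2l ?mulr_ge0// om_exp// leq_addl.
Qed.

(** The exponential is replaced by its Taylor polynomial of degree [N], which the algebra of
    expansions handles. The remainder contains the power [N.+1] of [u], and polynomial growth of
    [u / tau] turns it into the required power of [tau]. The exponential of |u| stays in the weight,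
    to be absorbed by a Gaussian. *)
Lemma expansion_exp N u a v b : expansion N u a ->
  (forall p, a 0%N p = 0) ->
  poly_growth (fun p => u p / tau p) -> (forall p, D p -> 0 < tau p) ->
  expansion N v b ->
  exists C M, 0 <= C /\ forall p, D p ->
   `|expR (u p) * v p - \sum_(n < N.+1) tau p ^+ n *
      fps_mul (fps_exp (a ^~ p)) (b ^~ p) n| <=
   C * tau p ^+ N.+1 * (om p ^+ M * expR `|u p|).
Proof.
move=> ua a0 uO taup vb.
pose P p := \sum_(m < N.+1) (m`!%:R)^-1 * u p ^+ m.
have PE : expansion N P (fun n p => fps_exp (a ^~ p) n).
  have [P1 P2] := expansion_lin N.+1 (fun m => (m`!%:R)^-1)
    (fun m => expansionX m ua).
  split=> [n nN|].
    by apply: eq_poly_growth (P1 n nN) => p Dp; rewrite fps_exp_wide.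
  have [C [M [C0 H]]] := P2; exists C, M; split => // p Dp.
  have := H p Dp; congr (`|_ - _| <= _); apply: eq_bigr => n _.
  by rewrite fps_exp_wide// -ltnS.
have [_ [C1 [M1 [C10 PvC]]]] := expansionM PE vb.
have [C2 [M2 [C20 uC]]] := poly_growthM (poly_growthX N.+1 uO)
  (expansion_growth vb).
exists (C1 + C2), (M1 + M2)%N; split; first exact: addr_ge0.
move=> p Dp.
have t0 : 0 <= tau p ^+ N.+1 by rewrite exprn_ge0 ?tau0.
have o0 k : 0 <= om p ^+ k by rewrite exprn_ge0 ?(le_trans ler01) ?om1.
have e1 : 1 <= expR `|u p| by rewrite -expR0 ler_expR.
have -> : expR (u p) * v p - \sum_(n < N.+1) tau p ^+ n *
    fps_mul (fps_exp (a ^~ p)) (b ^~ p) n =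
  (P p * v p - \sum_(n < N.+1) tau p ^+ n *
    fps_mul (fps_exp (a ^~ p)) (b ^~ p) n) + (expR (u p) - P p) * v p by ring.
rewrite (mulrDl C1) [leRHS]mulrDl (le_trans (ler_normD _ _))// lerD//.
  rewrite (le_trans (PvC p Dp))// ler_wpM2l ?mulr_ge0//.
  apply: (@le_trans _ _ (om p ^+ (M1 + M2) * 1)).
    by rewrite mulr1 om_exp// leq_addr.
  by rewrite ler_wpM2l.
rewrite normrM.
apply: (@le_trans _ _ (expR `|u p| * `|u p| ^+ N.+1 * `|v p|)).
  by rewrite ler_wpM2r// expR_taylor_bound.
have -> : expR `|u p| * `|u p| ^+ N.+1 * `|v p| =
    tau p ^+ N.+1 * (expR `|u p| * `|(u p / tau p) ^+ N.+1 * v p|).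
  rewrite normrM normrX normrM normfV (gtr0_norm (taup p Dp)) expr_div_n.
  by field; rewrite expf_neq0// gt_eqF// taup.
rewrite [leRHS](_ : _ = tau p ^+ N.+1 *
  (expR `|u p| * (C2 * om p ^+ (M1 + M2)))); last by ring.
rewrite ler_wpM2l// ler_wpM2l ?expR_ge0// (le_trans (uC p Dp))//.
by rewrite ler_wpM2l// om_exp// leq_addl.
Qed.

End expansions.

(** * Gaussian integrals and the coefficients *)

Section gaussian.
Context {R : realType}.
Local Notation mu := (@lebesgue_measure R).

(** Half of the exponent, called [y], is given away: the square of 1 + |z| is at most a multiple of
    1 + y, and a power of 1 + y is at most a factorial times the exponential of 1 + y. *)
Lemma gauss_absorb (c : R) (M : nat) : 0 < c -> exists2 C : R, 0 <= C &
  forall z : R, (1 + `|z|) ^+ M * expR (- (c * z ^+ 2)) <=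
    C * expR (- (c / 2 * z ^+ 2)).
Proof.
move=> c0.
pose k := 1 + 2 / c.
have k0 : 0 < k by rewrite addr_gt0// divr_gt0.
have k1 : 1 <= k by rewrite lerDl divr_ge0// ltW.
exists ((2 * k) ^+ M * (M.+1)`!%:R * expR 1) => [|z].
  by rewrite !mulr_ge0 ?expR_ge0// exprn_ge0// mulr_ge0// ltW.
pose y := c / 2 * z ^+ 2.
have y0 : 0 <= y by rewrite mulr_ge0 ?sqr_ge0// divr_ge0// ltW.
have -> : - (c * z ^+ 2) = - y + - y by rewrite /y; field.
rewrite -/y expRD mulrA ler_wpM2r ?expR_ge0// expRN ler_pdivrMr ?expR_gt0//.
have zy : (1 + `|z|) ^+ 2 <= 2 * k * (1 + y).
  have -> : 2 * k * (1 + y) = 2 * (k + (k * (c / 2)) * z ^+ 2) by rewrite /y; ring.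
  have -> : k * (c / 2) = 1 + c / 2 by rewrite /k; field; exact: lt0r_neq0.
  have : 0 <= c / 2 * z ^+ 2 by [].
  rewrite -(real_normK (num_real z)); move: (`|z|) (normr_ge0 z) => w w0 H.
  by have := sqr_ge0 (w - 1); nra.
apply: (@le_trans _ _ (((1 + `|z|) ^+ 2) ^+ M)).
  rewrite -exprM; apply: ler_weXn2l; first by rewrite lerDl.
  by rewrite mul2n -addnn leq_addr.
apply: (@le_trans _ _ ((2 * k * (1 + y)) ^+ M)).
  apply: lerXn2r; rewrite ?nnegrE//.
  by rewrite mulr_ge0 ?addr_ge0// mulr_ge0// ltW.
rewrite exprMn -!mulrA ler_wpM2l ?exprn_ge0 ?mulr_ge0 ?(ltW k0)//.
rewrite -expRD -ler_pdivrMl ?ltr0n ?fact_gt0// mulrC.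
apply: le_trans (@expR_ge1Dxn R (1 + y) M _); last by rewrite addr_ge0.
rewrite ler_wpDl// ler_wpM2r ?invr_ge0 ?ler0n//.
by apply: ler_weXn2l => //; rewrite lerDl.
Qed.

(** The weight is a multiple of the normal density of mean 0 and variance [2 / s], whose integral is
    1. *)
Lemma gauss_integral (s : R) : 0 < s ->
  mu.-integrable setT (fun z => (expR (- (s * z ^+ 2 / 4)))%:E) /\
  \int[mu]_z expR (- (s * z ^+ 2 / 4)) = Num.sqrt (4 * pi / s).
Proof.
move=> s0; pose d : R := Num.sqrt (2 / s).
have d2 : d ^+ 2 = 2 / s by rewrite sqr_sqrtr// divr_ge0// ltW.
have d0 : d != 0 by rewrite gt_eqF// sqrtr_gt0 divr_gt0.
have pk := normal_peak_gt0 d0.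
have E z : expR (- (s * z ^+ 2 / 4)) = (normal_peak d)^-1 * normal_pdf 0 d z.
  rewrite (normal_pdfE 0 d0) /normal_fun mulrA mulVf ?gt_eqF// mul1r.
  congr expR; rewrite subr0 d2; field; exact: lt0r_neq0.
have ipdf := integrable_normal_pdf 0 d.
split.
  under eq_fun do rewrite E EFinM.
  exact: integrableZl.
under eq_Rintegral do rewrite E.
rewrite RintegralZl// /Rintegral integral_normal_pdf/= mulr1 invrK; congr Num.sqrt.
by rewrite d2; field; exact: lt0r_neq0.
Qed.

Lemma gauss_growth_integrable (c : R) (M : nat) (u : R -> R) : 0 < c ->
  measurable_fun setT u ->
  (exists C : R, forall z, `|u z| <= C * (1 + `|z|) ^+ M * expR (- (c * z ^+ 2))) ->
  mu.-integrable setT (EFin \o u).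
Proof.
move=> c0 mu_ [C uC]; have [K K0 KP] := gauss_absorb M c0.
have [ig _] := @gauss_integral (2 * c) (mulr_gt0 (ltr0n _ 2) c0).
apply: (le_integrable measurableT _ _ (integrableZl measurableT (`|C| * K) ig)).
  exact/measurable_EFinP.
move=> z _ /=; rewrite lee_fin.
rewrite (le_trans (uC z))// (le_trans _ (ler_norm _))// -!mulrA.
apply: (@le_trans _ _ (`|C| * ((1 + `|z|) ^+ M * expR (- (c * z ^+ 2))))).
  rewrite ler_wpM2r ?ler_norm// mulr_ge0 ?expR_ge0// exprn_ge0// addr_ge0//.
rewrite ler_wpM2l// (le_trans (KP z))// ler_wpM2l// ler_expR.
by rewrite le_eqVlt; apply/orP; left; apply/eqP; field.
Qed.

(** The fundamental theorem on growing symmetric intervals, followed by dominated convergence with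
    |f| itself as dominating function. It serves as integration by parts on the line, the boundary
    terms being controlled by [F0]. *)
Lemma integral_primitive_vanishing (F f : R -> R) :
  (forall x : R, is_derive x 1 F (f x)) -> continuous f ->
  mu.-integrable setT (EFin \o f) ->
  (F n.+1%:R - F (- n.+1%:R)) @[n --> \oo] --> 0 ->
  \int[mu]_x f x = 0.
Proof.
move=> FE cf fi F0.
have mf : measurable_fun setT f by exact: continuous_measurable_fun.
pose I n := `[(- n.+1%:R : R), n.+1%:R]%classic.
pose f_ n := (EFin \o f) \_ (I n).
have fE n : (\int[mu]_x f_ n x = (F n.+1%:R - F (- n.+1%:R))%:E)%E.
  rewrite -integral_mkcond EFinB; apply: continuous_FTC2 => //.
  - by rewrite gtrN// ltr0n.
  - exact: continuous_subspaceT.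
  - split=> [x _||].
    + by have ? := FE x; exact: ex_derive.
    + apply: cvg_at_right_filter; exact: is_derive1_continuous (FE _).
    + apply: cvg_at_left_filter; exact: is_derive1_continuous (FE _).
  - by move=> x _; rewrite derive1E; have ? := FE x; exact: derive_val.
have mf_ n : measurable_fun setT (f_ n).
  apply/(measurable_restrictT _ _).1; first exact: measurable_itv.
  by apply/measurable_EFinP; exact: measurable_funTS.
have fcv : {ae mu, forall x, setT x -> f_ ^~ x @ \oo --> (EFin \o f) x}.
  apply: aeW => x _; apply: cvg_near_cst; exists (Num.truncn `|x|) => // n /= xn.
  rewrite /f_ patchT// inE /I/= in_itv/= -ler_norml ltW//.
  by rewrite (lt_le_trans (truncnS_gt _))// ler_nat ltnS.
have fdom : {ae mu, forall x n, setT x -> (`|f_ n x| <= `|(f x)%:E|)%E}.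
  apply: aeW => x n _; rewrite /f_ patchE; case: ifPn => // _.
  by rewrite abse0.
have [_ _] := @dominated_convergence _ (measurableTypeR R) R mu setT
  measurableT f_ (EFin \o f) (abse \o (EFin \o f)) mf_
  ((measurable_EFinP _ _).2 mf) fcv (integrable_abse fi) fdom.
under eq_fun do rewrite fE.
move=> cv; rewrite /Rintegral.
have fin : (\int[mu]_x (f x)%:E \is a fin_num)%E.
  exact: integrable_fin_num fi.
have H : (F n.+1%:R - F (- n.+1%:R))%:E @[n --> \oo] --> (0 : R)%:E.
  by apply: cvg_comp F0 _.
by rewrite (cvg_unique _ cv H).
Qed.

Lemma gauss_poly_integrable (s : R) (n : nat) : 0 < s ->
  mu.-integrable setT (EFin \o (fun z => z ^+ n * expR (- (s * z ^+ 2 / 4)))).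
Proof.
move=> s0; apply: (@gauss_growth_integrable (s / 4) n); first exact: divr_gt0.
  apply: measurable_funM; first exact: measurable_funX.
  apply: measurableT_comp => //; apply: measurableT_comp => //.
  by apply: measurable_funM => //; apply: measurable_funM => //;
    exact: measurable_funX.
exists 1 => z; rewrite mul1r normrM normrX (ger0_norm (expR_ge0 _)).
rewrite (_ : s * z ^+ 2 / 4 = s / 4 * z ^+ 2); last by field.
by rewrite ler_wpM2r ?expR_ge0// lerXn2r ?nnegrE ?addr_ge0// lerDr.
Qed.

Definition gauss_moment (s : R) (n : nat) : R :=
  \int[mu]_z (z ^+ n * expR (- (s * z ^+ 2 / 4))).

Lemma gauss_moment0 s : 0 < s -> gauss_moment s 0 = Num.sqrt (4 * pi / s).
Proof.
move=> s0; rewrite -(gauss_integral s0).2; apply: eq_Rintegral => z _.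
by rewrite expr0 mul1r.
Qed.

Let dgauss (s : R) (z : R) : is_derive z 1 (fun z => expR (- (s * z ^+ 2 / 4)))
  (- (s / 2 * z) * expR (- (s * z ^+ 2 / 4))).
Proof.
have H : is_derive z 1 (fun z : R => - (s * z ^+ 2 / 4)) (- (s / 2 * z)).
  by apply: is_derive_eq; rewrite /GRing.scale/=; field.
have := @is_derive1_comp R expR _ z _ _ (is_derive_expR _) H.
by rewrite mulrC.
Qed.

Let gauss_continuous (s : R) : continuous (fun z : R => expR (- (s * z ^+ 2 / 4))).
Proof.
move=> x; apply/differentiable_continuous/derivable1_diffP.
by have ? := dgauss s x; exact: ex_derive.
Qed.

Let gauss_poly_vanish (s : R) (n : nat) : 0 < s ->
  let F z := z ^+ n * expR (- (s * z ^+ 2 / 4)) in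
  (F m.+1%:R - F (- m.+1%:R)) @[m --> \oo] --> 0.
Proof.
move=> s0 F; have [K K0 KP] := gauss_absorb n.+1 (divr_gt0 s0 (ltr0n R 4)).
have FK z : z != 0 -> `|F z| <= K * `|z|^-1.
  move=> z0; rewrite ler_pdivlMr ?normr_gt0//.
  have := KP z; rewrite /F normrM normrX (ger0_norm (expR_ge0 _)).
  rewrite (_ : s * z ^+ 2 / 4 = s / 4 * z ^+ 2); last by field.
  move=> H; apply: (le_trans (le_trans _ H)).
    rewrite mulrAC -exprSr ler_wpM2r ?expR_ge0// lerXn2r ?nnegrE ?addr_ge0//.
    by rewrite lerDr.
  rewrite -[leRHS]mulr1 ler_wpM2l// -expR0 ler_expR oppr_le0.
  by rewrite mulr_ge0 ?sqr_ge0// !divr_ge0// ltW.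
have H : (2 * K * m.+1%:R^-1 : R) @[m --> \oo] --> 0.
  rewrite -[X in _ --> X](mulr0 (2 * K)); apply: cvgMr.
  exact: cvg_harmonic.
apply/norm_cvg0P.
apply: (@squeeze_cvgr _ _ _ _ (cst 0) (fun m => 2 * K * m.+1%:R^-1)) => //.
  apply: nearW => m; rewrite normr_ge0/= (le_trans (ler_normB _ _))//.
  have m0 : m.+1%:R != 0 :> R by rewrite pnatr_eq0.
  have Nm0 : - m.+1%:R != 0 :> R by rewrite oppr_eq0.
  apply: (le_trans (lerD (FK _ m0) (FK _ Nm0))).
  by rewrite normrN ger0_norm// -mulrDl -mulr2n -[K *+ 2]mulr_natl.
exact: cvg_cst.
Qed.

(** Integration by parts: the derivative of z^(n+1) exp(- s z^2 / 4) integrates to 0, and its two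
    terms are multiples of the two moments. *)
Lemma gauss_momentSS s n : 0 < s ->
  gauss_moment s n.+2 = 2 * n.+1%:R / s * gauss_moment s n.
Proof.
move=> s0; pose g z := expR (- (s * z ^+ 2 / 4)).
have i1 := gauss_poly_integrable n s0.
have i2 := gauss_poly_integrable n.+2 s0.
have Z1 : mu.-integrable setT (EFin \o (fun z : R => n.+1%:R * (z ^+ n * g z))).
  by have := integrableZl measurableT n.+1%:R i1.
have Z2 : mu.-integrable setT (EFin \o (fun z : R => s / 2 * (z ^+ n.+2 * g z))).
  by have := integrableZl measurableT (s / 2) i2.
have H : \int[mu]_z (n.+1%:R * (z ^+ n * g z) - s / 2 * (z ^+ n.+2 * g z)) = 0.
  apply: (@integral_primitive_vanishing (fun z => z ^+ n.+1 * g z)).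
  - move=> x; have ? := dgauss s x.
    have Xj : is_derive x 1 (fun z : R => z ^+ n.+1) (n.+1%:R * x ^+ n).
      apply: DeriveDef; first exact: exprn_derivable.
      by rewrite exp_derive /GRing.scale/= mulr1.
    apply: is_derive_eq; rewrite /GRing.scale/= /g !exprS; ring.
  - have cp m : continuous (fun z : R => z ^+ m * g z).
      move=> x; apply: cvgM; first exact: exprn_continuous.
      exact: gauss_continuous.
    move=> x; apply: cvgB; apply: cvgM; try exact: cvg_cst; exact: cp.
  - have := integrableB measurableT Z1 Z2; apply: eq_integrable => //.
  - exact: gauss_poly_vanish.
move: H; rewrite RintegralB// !RintegralZl// -/(gauss_moment s n) -/(gauss_moment s n.+2).
move=> /eqP; rewrite subr_eq0 => /eqP H.
have -> : gauss_moment s n.+2 = 2 / s * (s / 2 * gauss_moment s n.+2).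
  by field; exact: lt0r_neq0.
by rewrite -H; ring.
Qed.

Lemma gauss_poly_integral s n (c : nat -> R) : 0 < s ->
  \int[mu]_z (expR (- (s * z ^+ 2 / 4)) * \sum_(i < n) c i * z ^+ i) =
  \sum_(i < n) c i * gauss_moment s i.
Proof.
move=> s0.
transitivity (\int[mu]_z (\sum_(i < n) c i * (z ^+ i * expR (- (s * z ^+ 2 / 4))))).
  by apply: eq_Rintegral => z _; rewrite mulr_sumr; apply: eq_bigr => i _; ring.
have iZ i : mu.-integrable setT
    (EFin \o (fun z : R => c i * (z ^+ i * expR (- (s * z ^+ 2 / 4))))).
  by have := integrableZl measurableT (c i) (gauss_poly_integrable i s0).
elim: n => [|n IH].
  under eq_Rintegral do rewrite big_ord0; rewrite big_ord0.
  by rewrite Rintegral_cst// mul0r.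
under eq_Rintegral do rewrite big_ord_recr/=.
rewrite RintegralD//.
  by rewrite IH big_ord_recr/= RintegralZl//; exact: gauss_poly_integrable.
have := @integrable_sum _ _ R mu setT measurableT _ (index_enum 'I_n) xpredT
  (fun i => EFin \o (fun z : R => c i * (z ^+ i * expR (- (s * z ^+ 2 / 4)))))
  (fun i _ => iZ i).
by apply: eq_integrable => // z _ /=; rewrite sumEFin.
Qed.

End gaussian.

Section coefficients.
Context {R : realType}.
Local Notation mu := (@lebesgue_measure R).
Implicit Types (a b : nat -> R).

Lemma fps_powS a m n :
  fps_pow a m.+1 n = \sum_(i < n.+1) a i * fps_pow a m (n - i).
Proof. by []. Qed.

Lemma fps_pow1 a n : fps_pow a 1 n = a n.
Proof.
rewrite fps_powS big_ord_recr/= subnn mulr1 big1 ?add0r// => i _.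
by rewrite /fps_one subn_eq0 leqNgt ltn_ord mulr0.
Qed.

(** Order 4 is enough, because [b_] with [k = 2] is the coefficient of tau^4. *)
Lemma fps_exp_values a : a 0%N = 0 ->
  [/\ fps_exp a 0 = 1, fps_exp a 1 = a 1%N, fps_exp a 2 = a 2%N + a 1%N ^+ 2 / 2,
    fps_exp a 3 = a 3%N + a 1%N * a 2%N + a 1%N ^+ 3 / 6 &
    fps_exp a 4 = a 4%N + a 1%N * a 3%N + a 2%N ^+ 2 / 2 +
      a 1%N ^+ 2 * a 2%N / 2 + a 1%N ^+ 4 / 24].
Proof.
move=> a0.
have p2 n : fps_pow a 2 n = \sum_(i < n.+1) a i * a (n - i)%N.
  by rewrite fps_powS; apply: eq_bigr => i _; rewrite fps_pow1.
have p22 : fps_pow a 2 2 = a 1%N ^+ 2.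
  by rewrite p2 !big_ord_recr big_ord0/= a0; ring.
have p23 : fps_pow a 2 3 = 2 * (a 1%N * a 2%N).
  by rewrite p2 !big_ord_recr big_ord0/= a0; ring.
have p24 : fps_pow a 2 4 = 2 * (a 1%N * a 3%N) + a 2%N ^+ 2.
  by rewrite p2 !big_ord_recr big_ord0/= a0; ring.
have conv3 (q : nat -> R) : \sum_(i < 4) a i * q (3 - i)%N =
    a 1%N * q 2%N + a 2%N * q 1%N + a 3%N * q 0%N.
  by rewrite !big_ord_recr big_ord0/= a0; ring.
have conv4 (q : nat -> R) : \sum_(i < 5) a i * q (4 - i)%N =
    a 1%N * q 3%N + a 2%N * q 2%N + a 3%N * q 1%N + a 4%N * q 0%N.
  by rewrite !big_ord_recr big_ord0/= a0; ring.
have p33 : fps_pow a 3 3 = a 1%N ^+ 3.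
  by rewrite fps_powS conv3 p22 !(@fps_pow_small _ a 2)//; ring.
have p34 : fps_pow a 3 4 = 3 * (a 1%N ^+ 2 * a 2%N).
  by rewrite fps_powS conv4 p22 p23 !(@fps_pow_small _ a 2)//; ring.
have p44 : fps_pow a 4 4 = a 1%N ^+ 4.
  by rewrite fps_powS conv4 p33 !(@fps_pow_small _ a 3)//; ring.
have f1 : 1`!%:R = 1 :> R by [].
have f2 : 2`!%:R = 2 :> R by [].
have f3 : 3`!%:R = 6 :> R by [].
have f4 : 4`!%:R = 24 :> R by [].
have expE (q : nat -> nat -> R) n : \sum_(m < n.+1) q m n / m`!%:R =
    \sum_(0 <= m < n.+1) q m n / m`!%:R by rewrite big_mkord.
have p0 n : fps_pow a 0 n = (n == 0%N)%:R by [].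
split; rewrite /fps_exp (expE (fps_pow a)) !big_nat_recr// big_geq// ?fps_pow1
  ?p22 ?p23 ?p24 ?p33 ?p34 ?p44 ?f1 ?f2 ?f3 ?f4 ?fact0 p0 //=;
  by field.
Qed.

Lemma B_series_jac (s : nat -> R) (kappa z : R) n :
  B_series s kappa z n.+1 = fps_exp (B_exponent s z) n.+1 +
    fps_exp (B_exponent s z) n * (z * kappa).
Proof.
rewrite /B_series /fps_mul !big_ord_recr/= subnn subSnn/= mulr1 big1 ?add0r.
  by rewrite addrC.
move=> i _; have -> : (n.+1 - i = (n - i.+1).+2)%N by have := ltn_ord i; lia.
by rewrite /B_jacobian mulr0.
Qed.

Lemma a_poly (s : nat -> R) (kappa : R) k n (c : nat -> R) : 0 < s 2%N ->
  (forall z, b_ s kappa k z = \sum_(i < n) c i * z ^+ i) ->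
  a_ s kappa k = (4 * pi)^-1 * \sum_(i < n) c i * gauss_moment (s 2%N) i.
Proof.
move=> s0 bE; rewrite /a_ -gauss_poly_integral//; congr (_ * _).
by apply: eq_Rintegral => z _; rewrite bE.
Qed.

Lemma gauss_moment0_powR (s : R) : 0 < s ->
  (4 * pi)^-1 * gauss_moment s 0 = (4 * pi * s) `^ (- 2^-1).
Proof.
move=> s0; rewrite gauss_moment0//.
have p0 : 0 < 4 * pi :> R by rewrite mulr_gt0// pi_gt0.
rewrite powRN powR12_sqrt ?mulr_ge0// ?ltW//.
have q0 : 0 < Num.sqrt (4 * pi) :> R by rewrite sqrtr_gt0.
have r0 : 0 < Num.sqrt s by rewrite sqrtr_gt0.
rewrite sqrtrM ?(ltW p0)// sqrtrV ?(ltW s0)// (sqrtrM s) ?(ltW p0)//.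
have {1}-> : 4 * pi = Num.sqrt (4 * pi) ^+ 2 :> R by rewrite sqr_sqrtr// ltW.
  by field; rewrite !gt_eqF.
exact: pi_gt0.
Qed.

(** The constants are (2n)! / n!, that is n! times the central binomial coefficient: 252 and 924 are
    those for n = 5 and n = 6. *)
Lemma gauss_moment_values (s : R) : 0 < s ->
  let m := gauss_moment s 0 in
  [/\ gauss_moment s 4 = 12 * s ^- 2 * m, gauss_moment s 6 = 120 * s ^- 3 * m,
    gauss_moment s 8 = 1680 * s ^- 4 * m,
    gauss_moment s 10 = (120 * 252) * s ^- 5 * m &
    gauss_moment s 12 = (720 * 924) * s ^- 6 * m].
Proof.
move=> s0 m; have sn : s != 0 by rewrite gt_eqF.
have m2 : gauss_moment s 2 = 2 * s^-1 * m.
  by rewrite gauss_momentSS// -/m; field.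
have m4 : gauss_moment s 4 = 12 * s ^- 2 * m.
  by rewrite gauss_momentSS// m2; field.
have m6 : gauss_moment s 6 = 120 * s ^- 3 * m.
  by rewrite gauss_momentSS// m4; field.
have m8 : gauss_moment s 8 = 1680 * s ^- 4 * m.
  by rewrite gauss_momentSS// m6; field.
have m10 : gauss_moment s 10 = (120 * 252) * s ^- 5 * m.
  by rewrite gauss_momentSS// m8; field.
by split => //; rewrite gauss_momentSS// m10; field.
Qed.

Let factE : [/\ 3`!%:R = 6 :> R, 4`!%:R = 24 :> R, 5`!%:R = 120 :> R &
  6`!%:R = 720 :> R].
Proof. by split; congr (_%:R). Qed.

Lemma a0_value (s : nat -> R) (kappa : R) : 0 < s 2%N ->
  a_ s kappa 0 = (4 * pi * s 2%N) `^ (- 2^-1).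
Proof.
move=> s0; rewrite (@a_poly _ _ _ 1 (fun=> 1))// => [|z].
  by rewrite big_ord1 mul1r gauss_moment0_powR.
rewrite big_ord1 expr0 mulr1 /b_ /B_series /fps_mul big_ord1/= mulr1.
by have [-> _ _ _ _] := @fps_exp_values (B_exponent s z) erefl.
Qed.

Lemma a1_value (s : nat -> R) (kappa : R) : 0 < s 2%N ->
  a_ s kappa 1 = (4 * pi * s 2%N) `^ (- 2^-1) *
    ((- (s 3%N * kappa) - 1 / 4 * s 4%N) * s 2%N ^- 2
     + 5 / 12 * s 3%N ^+ 2 * s 2%N ^- 3).
Proof.
move=> s0; have [f3 f4 _ _] := factE.
(* The coefficients of [b_] for [k = 1] as a polynomial in z. The exponent has coefficients - s_3
   z^3 / 12 and - s_4 z^4 / 48; the second, half the square of the first, and the first times z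
   kappa make up [c]. *)
pose c i : R := match i with
  | 4%N => - (s 4%N / 48) - s 3%N * kappa / 12
  | 6%N => s 3%N ^+ 2 / 288 | _ => 0 end.
rewrite (@a_poly _ _ _ 7 c)// => [|z]; last first.
  rewrite /b_ B_series_jac.
  have [_ -> -> _ _] := @fps_exp_values (B_exponent s z) erefl.
  rewrite !big_ord_recr big_ord0 /= /B_exponent f3 f4.
  by field.
rewrite !big_ord_recr big_ord0 /= -gauss_moment0_powR//.
have [-> -> _ _ _] := gauss_moment_values s0.
have sn : s 2%N != 0 by rewrite gt_eqF.
have pn : pi != 0 :> R by rewrite gt_eqF// pi_gt0.
by move: (@pi R) pn => p pn; field; rewrite ?sn ?pn.
Qed.

Lemma a2_value (s : nat -> R) (kappa : R) : 0 < s 2%N ->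
  a_ s kappa 2 = (4 * pi * s 2%N) `^ (- 2^-1) *
    ((- (1 / 2 * s 5%N * kappa) - 1 / 12 * s 6%N) * s 2%N ^- 3
     + (35 / 12 * s 3%N * s 4%N * kappa + 7 / 12 * s 3%N * s 5%N
        + 35 / 96 * s 4%N ^+ 2) * s 2%N ^- 4
     + (- (35 / 12 * s 3%N ^+ 3 * kappa)
        - 35 / 16 * s 3%N ^+ 2 * s 4%N) * s 2%N ^- 5
     + 385 / 288 * s 3%N ^+ 4 * s 2%N ^- 6).
Proof.
move=> s0; have [f3 f4 f5 f6] := factE.
(* The analogue at tau^4, with the further exponent coefficients - s_5 z^5 / 240 and - s_6 z^6 /
   1440. The degree in z is the order 4 plus twice the number of exponent factors, hence 6, 8, 10
   and 12. *)
pose c i : R := match i with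
  | 6%N => - (s 6%N / 1440) - s 5%N * kappa / 240
  | 8%N => s 3%N * s 5%N / (12 * 240) + s 4%N ^+ 2 / (48 * 96) + s 3%N * s 4%N * kappa / 576
  | 10%N => - (s 3%N ^+ 2 * s 4%N / (24 * 576)) - s 3%N ^+ 3 * kappa / (18 * 576)
  | 12%N => s 3%N ^+ 4 / (576 * 864) | _ => 0 end.
rewrite (@a_poly _ _ _ 13 c)// => [|z]; last first.
  rewrite /b_ B_series_jac.
  have [_ _ _ -> ->] := @fps_exp_values (B_exponent s z) erefl.
  rewrite !big_ord_recr big_ord0 /= /B_exponent f3 f4 f5 f6.
  by field.
rewrite !big_ord_recr big_ord0 /= -gauss_moment0_powR//.
have [_ -> -> -> ->] := gauss_moment_values s0.
have sn : s 2%N != 0 by rewrite gt_eqF.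
have pn : pi != 0 :> R by rewrite gt_eqF// pi_gt0.
by move: (@pi R) pn => p pn; field; rewrite ?sn ?pn.
Qed.

(** Multiplying the coefficient of order i by [c ^+ i] is the substitution of c tau for tau, which
    commutes with products of series. *)
Lemma fps_mul_scale (c : R) a b a' b' n :
  (forall i, a' i = c ^+ i * a i) -> (forall i, b' i = c ^+ i * b i) ->
  fps_mul a' b' n = c ^+ n * fps_mul a b n.
Proof.
move=> aE bE; rewrite /fps_mul mulr_sumr; apply: eq_bigr => i _.
rewrite aE bE; have -> : c ^+ n = c ^+ i * c ^+ (n - i).
  by rewrite -exprD subnKC// -ltnS.
by ring.
Qed.

Lemma fps_exp_scale (c : R) a a' n : (forall i, a' i = c ^+ i * a i) ->
  fps_exp a' n = c ^+ n * fps_exp a n.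
Proof.
move=> aE; rewrite /fps_exp mulr_sumr; apply: eq_bigr => m _.
rewrite mulrA; congr (_ / _).
have : forall (m k : nat), fps_pow a' m k = c ^+ k * fps_pow a m k; last exact.
move=> {m n}; elim=> [|m IH] n.
  rewrite /fps_pow/= /fps_one.
  by case: n => [|n]; rewrite ?expr0 ?mul1r// mulr0.
exact: fps_mul_scale.
Qed.

(** Replacing z by - z amounts to replacing tau by - tau: the exponent coefficient of order i
    carries z^(i+2), and the Jacobian one carries z^i. *)
Lemma B_series_opp (s : nat -> R) (kappa z : R) n :
  B_series s kappa (- z) n = (- 1) ^+ n * B_series s kappa z n.
Proof.
apply: fps_mul_scale => i; first apply: fps_exp_scale => {}i.
  case: i => [|i]; first by rewrite /= mulr0.
  rewrite /B_exponent (_ : (- z) ^+ i.+3 = (- 1) ^+ i.+1 * z ^+ i.+3); first ring.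
  rewrite [LHS]exprNn; congr (_ * _).
  by rewrite (exprS _ i.+2) (exprS _ i.+1) mulrA mulrNN !mul1r.
by case: i => [|[|i]] /=; rewrite ?expr0 ?mulr0//; ring.
Qed.

Lemma odd_integral (f : R -> R) : mu.-integrable setT (EFin \o f) ->
  (forall z, f (- z) = - f z) -> \int[mu]_z f z = 0.
Proof.
move=> fi fN.
have mf : measurable_fun setT f by apply/measurable_EFinP; exact: measurable_int fi.
have fNi : mu.-integrable setT (EFin \o (fun z => f (- z))).
  have := integrableN fi; apply: eq_integrable => // z _ /=.
  by rewrite fN.
have H : (\int[mu]_z (f z)%:E = \int[mu]_z (f (- z))%:E)%E.
  transitivity (\int[mu]_(z in (-%R : measurableTypeR R -> measurableTypeR R)
      @^-1` setT) ((EFin \o f) \o -%R) z)%E; last by rewrite preimage_setT.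
  rewrite -integral_pushforward//=.
  - by apply: eq_measure_integral => //= A mA AS; exact/esym/lebesgue_measureN.
  - exact/measurable_EFinP.
have I0 : \int[mu]_z f z = - \int[mu]_z f z.
  rewrite {1}/Rintegral H -[LHS]/(\int[mu]_z (f (- z))).
  rewrite -[RHS]mulN1r -RintegralZl//.
  by apply: eq_Rintegral => z _; rewrite fN mulN1r.
by move: I0; lra.
Qed.

End coefficients.

(** * The exterior of the tube *)

Section exterior.
Context {R : realType}.
Local Notation mu := (@lebesgue_measure R).
Local Notation T2 := (measurableTypeR R * measurableTypeR R)%type.

Lemma integral_oneDsqrV :
  (\int[mu]_x ((oneDsqr x)^-1)%:E = pi%:E :> \bar R)%E.
Proof.
rewrite (@ge0_symfun_integralT R (fun x => (oneDsqr x)^-1)).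
- rewrite -set_itvcy integral0y_oneDsqr -EFinM; congr EFin.
  by move: (@pi R) => p; field.
- by move=> x; rewrite invr_ge0 (le_trans ler01)// oneDsqr_ge1.
- exact: continuous_oneDsqrV.
- by move=> x /=; rewrite /oneDsqr sqrrN.
Qed.

Lemma sigma0E (x : R * R) : sigma x 0 = (x.1 ^+ 2 + x.2 ^+ 2) / 2.
Proof. by rewrite /sigma /dot /= !subr0; ring. Qed.

(** The bound is a product of functions of one variable, so that Tonelli computes its integral. Near
    the origin only constants matter; far away exp(S / 2) dominates a power of S / 2, which by the
    growth condition exceeds a multiple of the square of [sigma x 0], however small [p] is. *)
Lemma decay_bound (S : R * R -> R) (p r C : R) : 0 < p -> 0 < C ->
  (forall x, 0 <= S x) ->
  (forall x, r ^+ 2 / 2 < sigma x 0 -> C * (sigma x 0) `^ p <= S x) ->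
  exists2 K : R, 0 <= K &
    forall x, expR (- (S x / 2)) <= K * ((oneDsqr x.1)^-1 * (oneDsqr x.2)^-1).
Proof.
move=> p0 C0 S0 decay.
(* The maximum with 1 makes powers of [w] increasing in their exponent beyond [W] and gives (1 +
   2w)^2 <= 9 w^2 there, the source of the constant 9. *)
pose W := Num.max 1 (r ^+ 2 / 2).
(* Chosen so that [p * n.+1] is at least 2: the power [n.+1] of S then controls w^2. *)
pose n := Num.truncn (2 / p).
have n2 : 2 <= p * n.+1%:R.
  by rewrite mulrC -ler_pdivrMr// ltW// truncnS_gt.
pose c := (C / 2) ^+ n.+1 / n.+1`!%:R.
have c0 : 0 < c by rewrite divr_gt0 ?ltr0n ?fact_gt0// exprn_gt0// divr_gt0.
have W1 : 1 <= W by rewrite le_max lexx.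
exists ((1 + 2 * W) ^+ 2 + 9 / c) => [|x].
  by rewrite addr_ge0 ?sqr_ge0// divr_ge0// ltW.
have o1 := oneDsqr_ge1 x.1; have o2 := oneDsqr_ge1 x.2.
have o10 : 0 < oneDsqr x.1 by exact: lt_le_trans o1.
have o20 : 0 < oneDsqr x.2 by exact: lt_le_trans o2.
rewrite -invfM -[leRHS]/(_ / _) ler_pdivlMr ?mulr_gt0//.
set w := sigma x 0.
have w0 : 0 <= w by rewrite /w sigma0E divr_ge0// addr_ge0// sqr_ge0.
have ow : oneDsqr x.1 * oneDsqr x.2 <= (1 + 2 * w) ^+ 2.
  rewrite /w sigma0E /oneDsqr; have := sqr_ge0 x.1; have := sqr_ge0 x.2.
  by move: (x.1 ^+ 2) (x.2 ^+ 2) => A B; nra.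
have e0 := expR_ge0 (- (S x / 2)).
rewrite mulrC; apply: (le_trans (ler_wpM2r e0 ow)).
have [wW|wW] := lerP w W.
  have e1 : expR (- (S x / 2)) <= 1.
    by rewrite -expR0 ler_expR oppr_le0 divr_ge0.
  have : 0 <= 9 / c by rewrite divr_ge0// ltW.
  have : (1 + 2 * w) ^+ 2 <= (1 + 2 * W) ^+ 2.
    by rewrite lerXn2r ?nnegrE//; lra.
  have := sqr_ge0 (1 + 2 * w); nra.
have w1 : 1 < w by exact: le_lt_trans wW.
have rw : r ^+ 2 / 2 < w by rewrite (le_lt_trans _ wW)// le_max lexx orbT.
have Sx := decay x rw; rewrite -/w in Sx.
have key : c * w ^+ 2 <= expR (S x / 2).
  have S20 : 0 <= S x / 2 by rewrite divr_ge0.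
  apply: (@le_trans _ _ ((S x / 2) ^+ n.+1 / n.+1`!%:R)); last first.
    by rewrite (le_trans _ (expR_ge1Dxn n S20))// lerDr.
  rewrite /c mulrAC ler_wpM2r ?invr_ge0//.
  apply: (@le_trans _ _ ((C / 2 * w `^ p) ^+ n.+1)).
    rewrite [leRHS]exprMn ler_wpM2l ?exprn_ge0 ?divr_ge0 ?(ltW C0)//.
    rewrite -(powR_mulrn _ (powR_ge0 _ _)) -powRrM -(powR_mulrn 2 w0).
    by apply: ler_powR => //; exact: ltW.
  apply: lerXn2r; rewrite ?nnegrE ?mulr_ge0 ?divr_ge0 ?powR_ge0 ?(ltW C0)//.
  by move: Sx; lra.
rewrite expRN ler_pdivrMr ?expR_gt0//.
apply: (@le_trans _ _ (9 / c * (c * w ^+ 2))).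
  have -> : 9 / c * (c * w ^+ 2) = 9 * w ^+ 2 by field; exact: lt0r_neq0.
  nra.
apply: (@le_trans _ _ (9 / c * expR (S x / 2))).
  by rewrite ler_wpM2l// divr_ge0// ltW.
by rewrite ler_wpM2r ?expR_ge0// lerDr sqr_ge0.
Qed.

(** Finiteness at the single time t = 1; smaller times are compared with it in
    [exterior_integral_bound]. *)
Lemma exp_decay_integral_lty (S : R * R -> R) (p r C : R) :
  0 < p -> 0 < C -> measurable_fun [set: T2] S -> (forall x, 0 <= S x) ->
  (forall x, r ^+ 2 / 2 < sigma x 0 -> C * (sigma x 0) `^ p <= S x) ->
  (\int[(mu \x mu)%E]_x (expR (- (S x / 2)))%:E < +oo)%E.
Proof.
move=> p0 C0 mS S0 /(decay_bound p0 C0 S0)[K K0 KP].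
have oV0 (u : R) : 0 <= (oneDsqr u)^-1.
  by rewrite invr_ge0 (le_trans ler01)// oneDsqr_ge1.
have moV : measurable_fun setT (fun u : R => (oneDsqr u)^-1).
  by apply: continuous_measurable_fun; exact: continuous_oneDsqrV.
have mK : measurable_fun [set: T2]
    (fun x => (K * ((oneDsqr x.1)^-1 * (oneDsqr x.2)^-1))%:E).
  apply/measurable_EFinP; apply: measurable_funM => //.
  apply: measurable_funM; first exact: (measurableT_comp moV measurable_fst).
  exact: (measurableT_comp moV measurable_snd).
apply: (@le_lt_trans _ _ (\int[(mu \x mu)%E]_x
    (K * ((oneDsqr x.1)^-1 * (oneDsqr x.2)^-1))%:E)%E).
  apply: ge0_le_integral => //.
  - apply/measurable_EFinP/measurableT_comp => //.
    by apply: measurableT_comp => //; exact: measurable_funM.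
  - by move=> x _; rewrite lee_fin; exact: KP.
rewrite fubini_tonelli1//=; last first.
  by move=> x; rewrite lee_fin mulr_ge0// mulr_ge0.
rewrite /fubini_F/=.
have line (k : R) : 0 <= k ->
    (\int[mu]_y (k * (oneDsqr y)^-1)%:E = (k * pi)%:E :> \bar R)%E.
  move=> k0; under eq_integral do rewrite EFinM.
  rewrite ge0_integralZl ?lee_fin ?integral_oneDsqrV//.
  - exact/measurable_EFinP.
have -> : (\int[mu]_x \int[mu]_y (K * ((oneDsqr x)^-1 / oneDsqr y))%:E =
    \int[mu]_x (K * pi * (oneDsqr x)^-1)%:E)%E.
  apply: eq_integral => x _; under eq_integral do rewrite mulrA.
  by rewrite line ?mulr_ge0// mulrAC.
by rewrite line ?ltry// mulr_ge0// pi_ge0.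
Qed.

End exterior.

(** * Uniform Laplace expansion in the normal variable *)

Section growth.
Context {R : realType} {T : Type}.
Variables (D : set T) (om : T -> R).
Hypotheses (om1 : forall p, D p -> 1 <= om p).

Lemma poly_growth_fps_mul (a b : nat -> T -> R) n :
  (forall i, poly_growth D om (a i)) -> (forall i, poly_growth D om (b i)) ->
  poly_growth D om (fun p => fps_mul (a ^~ p) (b ^~ p) n).
Proof.
move=> ag bg; apply: (poly_growth_sum om1) => i _.
exact: poly_growthM.
Qed.

Lemma poly_growth_fps_exp (a : nat -> T -> R) n :
  (forall i, poly_growth D om (a i)) ->
  poly_growth D om (fun p => fps_exp (a ^~ p) n).
Proof.
move=> ag; apply: (poly_growth_sum om1) => m _.
apply: poly_growthM => //; last exact: poly_growth_cst.
have : forall (k i : nat), poly_growth D om (fun p => fps_pow (a ^~ p) k i).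
  elim=> [|k IH] i; first exact: poly_growth_cst.
  exact: (poly_growth_fps_mul i ag IH).
exact.
Qed.

Lemma poly_growth_B_series (s : T -> nat -> R) (kappa z : T -> R) n :
  (forall j, poly_growth D om (s ^~ j)) -> poly_growth D om kappa ->
  poly_growth D om z ->
  poly_growth D om (fun p => B_series (s p) (kappa p) (z p) n).
Proof.
move=> sg kg zg.
have eg i : poly_growth D om (fun p => B_exponent (s p) (z p) i).
  case: i => [|i]; first exact: poly_growth_cst.
  rewrite /B_exponent; under eq_fun do rewrite -mulNr.
  apply: poly_growthM => //; first exact: poly_growth_cst.
  apply: poly_growthM => //; last exact: poly_growthX.
  by apply: poly_growthM => //; exact: poly_growth_cst.
have jg i : poly_growth D om (fun p => B_jacobian (kappa p) (z p) i).
  case: i => [|[|i]]; [exact: poly_growth_cst|exact: poly_growthM|].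
  exact: poly_growth_cst.
exact: (poly_growth_fps_mul n (fun i => poly_growth_fps_exp i eg) jg).
Qed.

End growth.

(** * Pointwise expansion of the rescaled integrand with a Gaussian error *)

Section laplace.
Context {R : realType}.
Variables (L : R) (G : nat -> R -> R -> R) (kappa : R -> R).
Hypothesis L0 : 0 < L.
Hypothesis GE : forall k y (z : R), is_derive z 1 (G k y) (G k.+1 y z).
Hypothesis Gc : forall k, continuous (fun p : R * R => G k p.1 p.2).
Hypotheses (G00 : forall y, G 0%N y 0 = 0) (G10 : forall y, G 1%N y 0 = 0).
Hypothesis G2 : forall y, 0 < G 2%N y 0.
Hypothesis ck : continuous kappa.

Let s y j := G j y 0.

Lemma G_bounded k : exists2 C : R, 1 <= C &
  {in `[0, L], forall y z, `|z| <= 1 -> `|G k y z| <= C}.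
Proof.
pose A : set (R * R) := `[0, L]%classic `*` `[(-1), 1]%classic.
have cA : compact A by apply: compact_setX; exact: segment_compact.
have A0 : A !=set0.
  by exists (0, 0); split; rewrite /= in_itv/= ?lexx ?(ltW L0)//; lra.
have cG : continuous (fun p : R * R => `|G k p.1 p.2|).
  by move=> p; apply: continuous_comp; [exact: Gc|exact: norm_continuous].
have [c _ cmax] := compact_EVT_max A0 cA (continuous_subspaceT cG).
exists (Num.max 1 `|G k c.1 c.2|) => [|y yL z z1]; first by rewrite le_max lexx.
rewrite le_max; apply/orP; right; apply: (cmax (y, z)); apply/mem_set.
by split => //=; rewrite in_itv/= -ler_norml.
Qed.

Lemma s_continuous j : continuous (fun y => s y j).
Proof.
move=> y; apply: (@continuous_comp _ _ _ (fun y : R => (y, 0) : R * R)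
  (fun p : R * R => G j p.1 p.2)); last exact: Gc.
by have := @pair_continuous R R id (cst 0) y; apply;
  [exact: cvg_id|exact: cvg_cst].
Qed.

(** A point is (tau, (y, z)); the normal variable z, already rescaled, is unrestricted. *)
Let par : set (R * (R * R)) := [set p | [/\ 0 < p.1, p.1 <= 1 & p.2.1 \in `[0, L]]].
Let om (p : R * (R * R)) := 1 + `|p.2.2|.
Let om1 p : par p -> 1 <= om p. Proof. by move=> _; rewrite lerDl. Qed.

Let om_ge1 (D : set (R * (R * R))) p : D p -> 1 <= om p.
Proof. by move=> _; rewrite lerDl. Qed.

Lemma B_series_growth (D : set (R * (R * R))) n :
  (forall p, D p -> p.2.1 \in `[0, L]) ->
  poly_growth D om (fun p => B_series (s p.2.1) (kappa p.2.1) p.2.2 n).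
Proof.
move=> DL; apply: poly_growth_B_series => [|j||].
- exact: om_ge1.
- have [C _ CP] := continuous_segment_bounded (ltW L0) (@s_continuous j).
  by apply: (@poly_growth_bounded _ _ _ _ _ C) => p /DL; exact: CP.
- have [C _ CP] := continuous_segment_bounded (ltW L0) ck.
  by apply: (@poly_growth_bounded _ _ _ _ _ C) => p /DL; exact: CP.
- by exists 1, 1%N; split => // p _; rewrite mul1r expr1 lerDr.
Qed.

(** The indicator extends the rescaled tube integrand by 0 to the whole line, where the Gaussian
    integrals defining [a_] live. Inside the tube the calculus of expansions applies; outside only
    the finite sum remains, small because there |z| is at least e / tau. *)
Lemma laplace_pointwise : exists2 e1 : R, 0 < e1 & forall (e : R) (N : nat),
  0 < e -> e <= e1 -> exists C c : R, exists M : nat, [/\ 0 <= C, 0 < c &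
  forall tau y z : R, 0 < tau -> tau <= 1 -> y \in `[0, L] ->
  `| (\1_(`[- e, e[%classic) (tau * z) : R) *
     (expR (- (G 0%N y (tau * z) / (2 * tau ^+ 2))) * (1 + tau * z * kappa y)) -
     \sum_(n < N.+2) tau ^+ n *
       (expR (- (s y 2%N * z ^+ 2 / 4)) * B_series (s y) (kappa y) z n) | <=
  C * tau ^+ N.+2 * ((1 + `|z|) ^+ M * expR (- (c * z ^+ 2)))].
Proof.
have [m m0 mP] := continuous_segment_pos (ltW L0) (@s_continuous 2)
  (fun y _ => G2 y).
have [C3 C31 C3P] := G_bounded 3.
have C30 : 0 < C3 by exact: lt_le_trans C31.
(* By Taylor the exponent differs from - s_2 z^2 / 4 by at most C3 tau |z|^3 / 2. With tau |z| <= m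
   / (4 C3) this is at most m z^2 / 8, half of the Gaussian rate guaranteed by s_2 >= m. *)
pose e1 := Num.min 1 (m / (4 * C3)).
have e10 : 0 < e1 by rewrite lt_min ltr01 divr_gt0// mulr_gt0.
exists e1 => // e N e0 ee1.
have e_1 : e <= 1 by rewrite (le_trans ee1)// ge_min lexx.
have e_m : C3 * e <= m / 4.
  have : e <= m / (4 * C3) by rewrite (le_trans ee1)// ge_min lexx orbT.
  rewrite ler_pdivlMr ?mulr_gt0// => H; lra.
pose D : set (R * (R * R)) := par `&` [set p | `|p.1 * p.2.2| <= e].
pose tau (p : R * (R * R)) := p.1.
have Dtau0 p : D p -> 0 <= tau p by move=> [[/ltW]].
have Dtaup p : D p -> 0 < tau p by move=> [[]].
have Dtau1 p : D p -> tau p <= 1 by move=> [[]].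
have Dom p : D p -> 1 <= om p by exact: om_ge1.
have DL p : D p -> p.2.1 \in `[0, L] by move=> [[]].
have zg : poly_growth D om (fun p => p.2.2).
  by exists 1, 1%N; split => // p _; rewrite mul1r expr1 lerDr.
have sg j : poly_growth D om (fun p => s p.2.1 j).
  have [C _ CP] := continuous_segment_bounded (ltW L0) (@s_continuous j).
  by apply: (@poly_growth_bounded _ _ _ _ _ C) => p /DL; exact: CP.
have kg : poly_growth D om (fun p => kappa p.2.1).
  have [C _ CP] := continuous_segment_bounded (ltW L0) ck.
  by apply: (@poly_growth_bounded _ _ _ _ _ C) => p /DL; exact: CP.
(* What is left of the exponent once the Gaussian is factored out; its expansion in tau has
   coefficients [B_exponent]. *)
pose u (p : R * (R * R)) := - (2^-1 * (G 0%N p.2.1 (p.1 * p.2.2) / p.1 ^+ 2 -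
  s p.2.1 2%N * p.2.2 ^+ 2 / 2)).
pose v (p : R * (R * R)) := 1 + p.1 * p.2.2 * kappa p.2.1.
pose a n (p : R * (R * R)) := B_exponent (s p.2.1) p.2.2 n.
pose b n (p : R * (R * R)) := B_jacobian (kappa p.2.1) p.2.2 n.
have Dz1 p : D p -> `|p.1 * p.2.2| <= 1 by move=> [_ /le_trans]; exact.
have ag n : poly_growth D om (a n).
  rewrite /a; case: n => [|n]; first exact: poly_growth_cst.
  rewrite /B_exponent; under eq_fun do rewrite -mulNr.
  apply: poly_growthM => //; first exact: poly_growth_cst.
  apply: poly_growthM => //; last exact: poly_growthX.
  by apply: poly_growthM => //; exact: poly_growth_cst.
have bg n : poly_growth D om (b n).
  rewrite /b; case: n => [|[|n]]; [exact: poly_growth_cst|exact: poly_growthM|].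
  exact: poly_growth_cst.
(* Derivatives up to order [N.+4] are used because division by tau^2 costs two orders; the Taylor
   terms of degree 0 and 1 vanish, and that of degree 2 cancels the quadratic part. *)
have uE : expansion D tau om N.+1 u a.
  have [C C1 CP] := G_bounded N.+4.
  pose r p := (u p - \sum_(n < N.+2) tau p ^+ n * a n p) / tau p ^+ N.+2.
  apply: (@expansion_remainder _ _ D tau om Dtau0 N.+1 u a r) => //; last first.
    by move=> p Dp; rewrite /r mulrC divfK// expf_neq0// gt_eqF// Dtaup.
  exists C, N.+4; split; first exact: le_trans C1.
  move=> [t [y z]] Dp; have t0 := Dtaup _ Dp; rewrite /tau/= in t0.
  have tn0 : t != 0 by rewrite gt_eqF.
  have := @taylor_bound R N.+3 (fun k => G k y) C 1 (fun k z => GE k y z)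
    (fun z z1 => CP y (DL _ Dp) z z1) (t * z) (Dz1 _ Dp).
  set Sm := \sum_(j < N.+4) _.
  have -> : r (t, (y, z)) = - (2^-1 * (G 0%N y (t * z) - Sm)) / t ^+ N.+4.
    rewrite /r /u /tau/=.
    have -> : Sm = s y 2%N * (t * z) ^+ 2 / 2 -
        2 * t ^+ 2 * \sum_(n < N.+2) t ^+ n * a n (t, (y, z)).
      rewrite /Sm 2!big_ord_recl /= G00 G10 !mul0r !add0r.
      rewrite big_ord_recl [X in _ = _ - _ * X]big_ord_recl /= /a/= mulr0 add0r.
      rewrite mulr_sumr -sumrN; congr (_ + _).
        by rewrite /bump/= /s mulrAC.
      apply: eq_bigr => i _; rewrite /bump/= !add1n /B_exponent.
      rewrite exprMn (_ : t ^+ i.+3 = t ^+ 2 * t ^+ i.+1); last by rewrite -exprD.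
      have : (i.+3)`!%:R != 0 :> R by rewrite pnatr_eq0 -lt0n fact_gt0.
      move: ((i.+3)`!%:R) (t ^+ i.+1) (z ^+ i.+3) => F x w F0.
      by rewrite /s; field.
    by rewrite -[N.+4]addn2 exprD; field; rewrite tn0 expf_neq0.
  move=> H; rewrite normrM normrN normfV (gtr0_norm (exprn_gt0 _ t0)).
  rewrite ler_pdivrMr ?exprn_gt0// normrM gtr0_norm ?invr_gt0//.
  apply: (@le_trans _ _ (1 * (C * `|t * z| ^+ N.+4))).
    by apply: ler_pM => //; rewrite ?invr_ge0// invf_le1// ler1n.
  have C0 : 0 <= C by exact: le_trans C1.
  rewrite mul1r normrM (gtr0_norm t0) exprMn.
  rewrite [leRHS](_ : _ = C * (t ^+ N.+4 * om (t, (y, z)) ^+ N.+4)); last by ring.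
  apply: ler_wpM2l => //; apply: ler_wpM2l; first by rewrite exprn_ge0 ?(ltW t0).
  by rewrite lerXn2r ?nnegrE// ?addr_ge0// lerDr.
have vE : expansion D tau om N.+1 v b.
  apply: (@expansion_remainder _ _ D tau om Dtau0 N.+1 v b (fun=> 0)) => //.
    exact: poly_growth_cst.
  move=> p Dp; rewrite mulr0 2!big_ord_recl/= big1 ?addr0; last first.
    by move=> i _; rewrite /b /bump/= mulr0.
  by rewrite /b /v /bump/= expr0 expr1 /tau; ring.
have u3 p : D p -> `|u p| <= 2^-1 * (C3 * (p.1 * `|p.2.2| ^+ 3)).
  case: p => t [y z] Dp; have t0 := Dtaup _ Dp; rewrite /tau/= in t0.
  have tn0 : t != 0 by rewrite gt_eqF.
  have := @taylor_bound R 2 (fun k => G k y) C3 1 (fun k z => GE k y z)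
    (fun z z1 => C3P y (DL _ Dp) z z1) (t * z) (Dz1 _ Dp).
  rewrite !big_ord_recl big_ord0 /= G00 G10 !mul0r !add0r addr0 => H.
  rewrite /u/= normrN normrM gtr0_norm ?invr_gt0// ler_wpM2l ?invr_ge0//.
  have -> : G 0%N y (t * z) / t ^+ 2 - s y 2%N * z ^+ 2 / 2 =
      (G 0%N y (t * z) - G 2%N y 0 / 2`!%:R * (t * z) ^+ 2) / t ^+ 2.
    by rewrite /s (_ : 2`!%:R = 2 :> R)//; field.
  rewrite normrM normfV (gtr0_norm (exprn_gt0 2 t0)) ler_pdivrMr ?exprn_gt0//.
  apply: (le_trans H); rewrite normrM (gtr0_norm t0).
  by rewrite le_eqVlt; apply/orP; left; apply/eqP; ring.
have uO : poly_growth D om (fun p => u p / tau p).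
  exists C3, 3%N; split; first exact: ltW.
  move=> p Dp; have t0 := Dtaup _ Dp.
  rewrite normrM normfV (gtr0_norm t0) ler_pdivrMr// (le_trans (u3 p Dp))//.
  have -> : C3 * om p ^+ 3 * tau p = 1 * (C3 * (tau p * om p ^+ 3)) by ring.
  apply: ler_pM => //; rewrite ?mulr_ge0 ?invr_ge0 ?exprn_ge0 ?(ltW C30) ?(ltW t0)//.
    by rewrite invf_le1// ler1n.
  rewrite ler_wpM2l ?(ltW C30)// ler_wpM2l ?(ltW t0)//.
  by rewrite lerXn2r ?nnegrE// ?addr_ge0// lerDr.
have um p : D p -> `|u p| <= m / 8 * p.2.2 ^+ 2.
  move=> Dp; have t0 := Dtaup _ Dp; rewrite (le_trans (u3 p Dp))//.
  have [_ /= pe] := Dp; rewrite normrM (gtr0_norm t0) in pe.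
  rewrite -(real_normK (num_real p.2.2)).
  have -> : 2^-1 * (C3 * (p.1 * `|p.2.2| ^+ 3)) =
    2^-1 * (C3 * (p.1 * `|p.2.2|)) * `|p.2.2| ^+ 2 by ring.
  rewrite ler_wpM2r ?sqr_ge0//.
  have : C3 * (p.1 * `|p.2.2|) <= C3 * e by rewrite ler_wpM2l// ltW.
  lra.
have [Ca [Ma [Ca0 CaP]]] := @expansion_exp R _ D tau om Dtau0 Dtau1 Dom N.+1 u a v b
  uE (fun p => erefl) uO Dtaup vE.
have [Cb [Mb [Cb0 CbP]]] : poly_growth par om (fun p => \sum_(n < N.+2)
    `|B_series (s p.2.1) (kappa p.2.1) p.2.2 n|).
  apply: (poly_growth_sum om1) => n _.
  have [C [M [C0 CP]]] := @B_series_growth par n (fun p (H : par p) => let: And3 _ _ P := H in P).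
  by exists C, M; split => // p Dp; rewrite normr_id; exact: CP.
exists (Ca + Cb / e ^+ N.+2), (m / 8), (Ma + (Mb + N.+2))%N.
have en0 : 0 < e ^+ N.+2 by rewrite exprn_gt0.
split; first by rewrite addr_ge0// divr_ge0// ltW.
  by rewrite divr_gt0.
move=> t y z t0 t1 yL.
pose p : R * (R * R) := (t, (y, z)).
have parp : par p by [].
have sm : m <= s y 2%N by exact: mP.
have z20 : 0 <= z ^+ 2 by rewrite sqr_ge0.
have omM k l : (k <= l)%N -> (1 + `|z|) ^+ k <= (1 + `|z|) ^+ l.
  by move=> kl; apply: ler_weXn2l => //; rewrite lerDl.
have ogt0 k : 0 <= (1 + `|z|) ^+ k by rewrite exprn_ge0// addr_ge0.
have tn0 k : 0 <= t ^+ k by rewrite exprn_ge0// ltW.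
have em : expR (- (s y 2%N * z ^+ 2 / 4)) <= expR (- (m / 8 * z ^+ 2)).
  by rewrite ler_expR; nra.
rewrite indicE; case: (boolP (t * z \in `[- e, e[%classic)) => [tz|tz].
  have Dp : D p.
    split => //=; move: tz; rewrite inE/= in_itv/= => /andP[? /ltW ?].
    by rewrite ler_norml; apply/andP.
  rewrite mul1r.
  have -> : expR (- (G 0%N y (t * z) / (2 * t ^+ 2))) =
      expR (- (s y 2%N * z ^+ 2 / 4)) * expR (u p).
    rewrite -expRD; congr expR; rewrite /u/=; field.
    exact: lt0r_neq0.
  have -> : \sum_(n < N.+2) t ^+ n * (expR (- (s y 2%N * z ^+ 2 / 4)) *
      B_series (s y) (kappa y) z n) = expR (- (s y 2%N * z ^+ 2 / 4)) *
      \sum_(n < N.+2) t ^+ n * B_series (s y) (kappa y) z n.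
    by rewrite mulr_sumr; apply: eq_bigr => n _; rewrite mulrCA.
  rewrite -mulrA -mulrBr normrM (ger0_norm (expR_ge0 _)).
  apply: (le_trans (ler_wpM2l (expR_ge0 _) (CaP p Dp))).
  have ue : expR (- (s y 2%N * z ^+ 2 / 4)) * expR `|u p| <=
      expR (- (m / 8 * z ^+ 2)).
    by rewrite -expRD ler_expR; have := um p Dp; rewrite /=; nra.
  apply: (@le_trans _ _ (Ca * t ^+ N.+2 * ((1 + `|z|) ^+ Ma *
      expR (- (m / 8 * z ^+ 2))))).
    rewrite [leLHS](_ : _ = Ca * t ^+ N.+2 * ((1 + `|z|) ^+ Ma *
      (expR (- (s y 2%N * z ^+ 2 / 4)) * expR `|u p|))); last first.
      by rewrite /tau /om /=; ring.
    apply: ler_wpM2l; first by rewrite mulr_ge0.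
    by apply: ler_wpM2l.
  apply: ler_pM; [by apply: mulr_ge0|by rewrite mulr_ge0 ?expR_ge0| |].
    by apply: ler_wpM2r => //; rewrite lerDl divr_ge0// ltW.
  by apply: ler_wpM2r; rewrite ?expR_ge0// omM// leq_addr.
(* Off the tube t |z| / e is at least 1, so any power of it may be inserted; the power [N.+2] yields
   the required order in t at the price of more growth in z. *)
rewrite mul0r sub0r normrN.
have tze : e <= t * `|z|.
  rewrite leNgt; apply/negP => H; move: tz; rewrite notin_setE/= in_itv/=; apply.
  have : `|t * z| < e by rewrite normrM gtr0_norm.
  by rewrite ltr_norml => /andP[/ltW -> ->].
apply: (@le_trans _ _ (expR (- (m / 8 * z ^+ 2)) * (Cb * (1 + `|z|) ^+ Mb))).
  apply: (le_trans (ler_norm_sum _ _ _)).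
  apply: (@le_trans _ _ (expR (- (m / 8 * z ^+ 2)) * \sum_(n < N.+2)
    `|B_series (s y) (kappa y) z n|)).
    rewrite mulr_sumr; apply: ler_sum => n _.
    rewrite !normrM (ger0_norm (tn0 _)) (ger0_norm (expR_ge0 _)).
    rewrite -[leRHS]mul1r; apply: ler_pM; rewrite ?mulr_ge0 ?expR_ge0//.
      by rewrite exprn_ile1// ltW.
    by apply: ler_wpM2r.
  apply: ler_wpM2l; rewrite ?expR_ge0//.
  by apply: le_trans (CbP p parp); rewrite ler_norm.
apply: (@le_trans _ _ (expR (- (m / 8 * z ^+ 2)) * (Cb * (1 + `|z|) ^+ Mb) *
   (t * `|z| / e) ^+ N.+2)).
  rewrite -[leLHS]mulr1; apply: ler_wpM2l.
    by rewrite mulr_ge0 ?expR_ge0 ?mulr_ge0.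
  rewrite exprn_ege1//.
  by rewrite ler_pdivlMr// mul1r.
have -> : expR (- (m / 8 * z ^+ 2)) * (Cb * (1 + `|z|) ^+ Mb) *
   (t * `|z| / e) ^+ N.+2 = Cb / e ^+ N.+2 * t ^+ N.+2 *
   (((1 + `|z|) ^+ Mb * `|z| ^+ N.+2) * expR (- (m / 8 * z ^+ 2))).
  by rewrite expr_div_n exprMn; field; exact: lt0r_neq0.
apply: ler_pM.
- by apply: mulr_ge0 => //; rewrite divr_ge0// ltW.
- by rewrite mulr_ge0 ?expR_ge0// mulr_ge0// exprn_ge0.
- by apply: ler_wpM2r; rewrite // lerDr.
apply: ler_wpM2r; rewrite ?expR_ge0// (le_trans _ (omM (Mb + N.+2)%N _ _))// ?leq_addl//.
rewrite exprD; apply: ler_wpM2l; rewrite // lerXn2r ?nnegrE ?addr_ge0// lerDr//.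
Qed.

End laplace.

(** * Continuity, measurability and integrability of the terms of the expansion *)

Section continuous_series.
Context {R : realType} {X : topologicalType}.

Lemma continuous_mul (f g : X -> R) : continuous f -> continuous g ->
  continuous (fun p => f p * g p).
Proof. by move=> cf cg p; exact: (@continuousM R X f g p (cf p) (cg p)). Qed.

Lemma continuous_add (f g : X -> R) : continuous f -> continuous g ->
  continuous (fun p => f p + g p).
Proof. by move=> cf cg p; exact: (@continuousD R R X f g p (cf p) (cg p)). Qed.

Lemma continuous_opp (f : X -> R) : continuous f -> continuous (fun p => - f p).
Proof. by move=> cf p; exact: (@continuousN R R X f p (cf p)). Qed.

Lemma continuous_abs (f : X -> R) : continuous f -> continuous (fun p => `|f p|).
Proof.
move=> cf p.
exact: (@continuous_comp _ _ _ f (fun x : R => `|x|) p (cf p) (@norm_continuous _ R^o _)).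
Qed.

Lemma continuous_exp (f : X -> R) n : continuous f -> continuous (fun p => f p ^+ n).
Proof.
by move=> cf p; apply: (@continuous_comp _ _ _ f (fun x : R => x ^+ n));
  [exact: cf|exact: exprn_continuous].
Qed.

Lemma continuous_expRo (f : X -> R) : continuous f -> continuous (fun p => expR (f p)).
Proof.
by move=> cf p; apply: (@continuous_comp _ _ _ f expR);
  [exact: cf|exact: continuous_expR].
Qed.

Lemma continuous_sum (I : Type) (r : seq I) (F : I -> X -> R) :
  (forall i, continuous (F i)) -> continuous (fun p => \sum_(i <- r) F i p).
Proof.
move=> cF p; elim: r => [|i r IH].
  by under eq_fun do rewrite big_nil; exact: cvg_cst.
by under eq_fun do rewrite big_cons; apply: continuousD => //; exact: cF.
Qed.

Lemma fps_mul_continuous (a b : nat -> X -> R) n :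
  (forall i, continuous (a i)) -> (forall i, continuous (b i)) ->
  continuous (fun p => fps_mul (a ^~ p) (b ^~ p) n).
Proof.
move=> ca cb; apply: continuous_sum => i p.
by apply: continuousM; [exact: ca|exact: cb].
Qed.

Lemma fps_exp_continuous (a : nat -> X -> R) n :
  (forall i, continuous (a i)) -> continuous (fun p => fps_exp (a ^~ p) n).
Proof.
move=> ca; apply: continuous_sum => m p.
apply: (@continuousM _ _ (fun p => fps_pow (a ^~ p) m n) (cst _)); last exact: cvg_cst.
have : forall (k i : nat), continuous (fun p => fps_pow (a ^~ p) k i).
  elim=> [|k IH] i; first by move=> ?; exact: cvg_cst.
  exact: (@fps_mul_continuous a (fun i p => fps_pow (a ^~ p) k i) i ca IH).
by move=> H; exact: H.
Qed.

Lemma B_series_continuous (s : X -> nat -> R) (kappa z : X -> R) n :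
  (forall j, continuous (s ^~ j)) -> continuous kappa -> continuous z ->
  continuous (fun p => B_series (s p) (kappa p) (z p) n).
Proof.
move=> cs ck cz.
have ce i : continuous (fun p => B_exponent (s p) (z p) i).
  case: i => [|i]; first by move=> p; exact: cvg_cst.
  apply: continuous_opp; apply: continuous_mul; first by move=> p; exact: cvg_cst.
  apply: continuous_mul; last exact: continuous_exp.
  by apply: continuous_mul; [exact: cs|move=> p; exact: cvg_cst].
have cj i : continuous (fun p => B_jacobian (kappa p) (z p) i).
  move=> p; case: i => [|[|i]]; [exact: cvg_cst| |exact: cvg_cst].
  by apply: continuousM; [exact: cz|exact: ck].
have cE i : continuous (fun p => fps_exp (B_exponent (s p) (z p)) i).
  exact: (@fps_exp_continuous (fun i p => B_exponent (s p) (z p) i) i ce).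
exact: (@fps_mul_continuous (fun i p => fps_exp (B_exponent (s p) (z p)) i)
  (fun i p => B_jacobian (kappa p) (z p) i) n cE cj).
Qed.

End continuous_series.

Section integration.
Context {R : realType}.
Notation mu := (@lebesgue_measure R).
Local Notation T2 := (measurableTypeR R * measurableTypeR R)%type.

Lemma partial_Rintegral_measurable (u : R * R -> R) : continuous u ->
  measurable_fun setT (fun y : R => \int[mu]_z u (y, z)).
Proof.
move=> cu.
have mu_ : measurable_fun [set: T2] (EFin \o u).
  by apply/measurable_EFinP; exact: (@continuous_plane_measurable R u cu).
rewrite /Rintegral; apply: (measurableT_comp (fine_measurable measurableT)).
under eq_fun do rewrite integralE.
apply: emeasurable_funB.
- have := @partial_integral_measurable R setT ((EFin \o u)^\+)%E measurableT
    (measurable_funepos mu_) (fun x => funepos_ge0 _ x).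
  congr (measurable_fun _ _); apply/funext => y.
  by apply: eq_integral => z _; rewrite !funeposE.
- have := @partial_integral_measurable R setT ((EFin \o u)^\-)%E measurableT
    (measurable_funeneg mu_) (fun x => funeneg_ge0 _ x).
  congr (measurable_fun _ _); apply/funext => y.
  by apply: eq_integral => z _; rewrite !funenegE.
Qed.

Lemma Rintegral_sum (I : Type) (r : seq I) (D : set (measurableTypeR R)) (F : I -> R -> R) :
  measurable D -> (forall i, mu.-integrable D (EFin \o F i)) ->
  mu.-integrable D (EFin \o (fun x => \sum_(i <- r) F i x)) /\
  \int[mu]_(x in D) (\sum_(i <- r) F i x) = \sum_(i <- r) \int[mu]_(x in D) F i x.
Proof.
move=> mD iF; elim: r => [|i r [IHi IHe]].
  under eq_fun do rewrite big_nil.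
  split; first exact: integrable0.
  by rewrite big_nil Rintegral_cst// mul0r.
have -> : (fun x => \sum_(j <- i :: r) F j x) = (fun x => F i x + \sum_(j <- r) F j x).
  by apply/funext => x; rewrite big_cons.
split; last by rewrite RintegralD// IHe big_cons.
have -> : EFin \o (fun x => F i x + \sum_(j <- r) F j x) =
    ((EFin \o F i) \+ (EFin \o (fun x => \sum_(j <- r) F j x)%R))%E by [].
exact: integrableD.
Qed.

Lemma Rintegral_close (D : set (measurableTypeR R)) (u v w : R -> R) : measurable D ->
  mu.-integrable D (EFin \o u) -> mu.-integrable D (EFin \o v) ->
  mu.-integrable D (EFin \o w) -> {in D, forall x, `|u x - v x| <= w x} ->
  `| \int[mu]_(x in D) u x - \int[mu]_(x in D) v x | <= \int[mu]_(x in D) w x.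
Proof.
move=> mD iu iv iw H; rewrite -RintegralB//.
have iuv : mu.-integrable D (EFin \o (fun x => u x - v x)).
  have -> : EFin \o (fun x => u x - v x) = ((EFin \o u) \- (EFin \o v))%E by [].
  exact: integrableB.
have /le_trans -> // := le_normr_Rintegral mD iuv.
apply: le_Rintegral => // [|x Dx]; last by apply: H; exact/mem_set.
exact: (integrable_abse iuv).
Qed.

Lemma integrable_scale (D : set (measurableTypeR R)) (c : R) (u : R -> R) :
  measurable D -> mu.-integrable D (EFin \o u) ->
  mu.-integrable D (EFin \o (fun x => c * u x)).
Proof.
move=> mD iu.
have -> : EFin \o (fun x => c * u x) = (fun x => c%:E * (EFin \o u) x)%E by [].
exact: integrableZl.
Qed.

Lemma Rintegral_scale_sum (I : Type) (r : seq I) (D : set (measurableTypeR R))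
    (c : I -> R) (F : I -> R -> R) :
  measurable D -> (forall i, mu.-integrable D (EFin \o F i)) ->
  mu.-integrable D (EFin \o (fun x => \sum_(i <- r) c i * F i x)) /\
  \int[mu]_(x in D) (\sum_(i <- r) c i * F i x) =
    \sum_(i <- r) c i * \int[mu]_(x in D) F i x.
Proof.
move=> mD iF.
have [|iS ->] := @Rintegral_sum I r D (fun i x => c i * F i x) mD.
  by move=> i; exact: integrable_scale.
by split => //; apply: eq_bigr => i _; rewrite RintegralZl.
Qed.

Lemma gauss_weight_integrable (c : R) (M : nat) : 0 < c ->
  mu.-integrable setT (EFin \o (fun z => (1 + `|z|) ^+ M * expR (- (c * z ^+ 2)))).
Proof.
move=> cp.
have wc : continuous (fun z : R => (1 + `|z|) ^+ M * expR (- (c * z ^+ 2))).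
  apply: continuous_mul.
    apply: continuous_exp; apply: continuous_add; last exact: norm_continuous.
    by move=> z; exact: cvg_cst.
  apply: continuous_expRo; apply: continuous_opp.
  apply: continuous_mul; first by move=> z; exact: cvg_cst.
  exact: exprn_continuous.
apply: (@gauss_growth_integrable R c M _ cp (continuous_measurable_fun wc)).
by exists 1 => z; rewrite mul1r ger0_norm// mulr_ge0 ?expR_ge0// exprn_ge0// addr_ge0.
Qed.

Lemma bounded_integrable_co (L C : R) (u : R -> R) : measurable_fun setT u ->
  {in `[0, L[, forall y, `|u y| <= C} ->
  mu.-integrable `[0, L[%classic (EFin \o u).
Proof.
move=> mu_ uC; apply: measurable_bounded_integrable => //.
- by rewrite /= lebesgue_measure_itv/=; case: ifP => _; rewrite ?ltry.
- exact: measurable_funTS.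
- exists C; split; first exact: num_real.
  by move=> x Cx y yL /=; apply: le_trans (ltW Cx); exact: uC.
Qed.

End integration.

Lemma sum_even_odd (R : zmodType) (F : nat -> R) K :
  \sum_(n < K.*2) F n = \sum_(k < K) (F k.*2 + F k.*2.+1).
Proof.
elim: K => [|K IH]; first by rewrite !big_ord0.
by rewrite doubleS 2!big_ord_recr/= IH [RHS]big_ord_recr/= addrA.
Qed.

Section laplace_integral.
Context {R : realType}.
Notation mu := (@lebesgue_measure R).
Variables (L : R) (G : nat -> R -> R -> R) (kappa c0 : R -> R).
Hypothesis L0 : 0 < L.
Hypothesis GE : forall k y (z : R), is_derive z 1 (G k y) (G k.+1 y z).
Hypothesis Gc : forall k, continuous (fun p : R * R => G k p.1 p.2).
Hypotheses (G00 : forall y, G 0%N y 0 = 0) (G10 : forall y, G 1%N y 0 = 0).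
Hypothesis G2 : forall y, 0 < G 2%N y 0.
Hypotheses (ck : continuous kappa) (cc0 : continuous c0).
Hypothesis c00 : forall y, 0 <= c0 y.

Let s y j := G j y 0.
Let W n (p : R * R) := expR (- (s p.1 2%N * p.2 ^+ 2 / 4)) *
  B_series (s p.1) (kappa p.1) p.2 n.
Let m n y := \int[mu]_z W n (y, z).

Let s_fst_continuous j : continuous (fun p : R * R => s p.1 j).
Proof.
move=> p; apply: (@continuous_comp _ _ _ fst (fun y => s y j)).
  exact: cvg_fst.
exact: (@s_continuous R G Gc j).
Qed.

Let W_continuous n : continuous (W n).
Proof.
have cB : continuous (fun p : R * R => B_series (s p.1) (kappa p.1) p.2 n).
  apply: (@B_series_continuous R _ (fun p : R * R => s p.1) (fun p => kappa p.1)
    (fun p => p.2)) => [|p|p]; first exact: s_fst_continuous.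
    by apply: (@continuous_comp _ _ _ fst kappa); [exact: cvg_fst|exact: ck].
  exact: cvg_snd.
apply: continuous_mul => //; apply: continuous_expRo; apply: continuous_opp.
apply: continuous_mul; last by move=> p; exact: cvg_cst.
apply: continuous_mul; first exact: s_fst_continuous.
by apply: continuous_exp => p; exact: cvg_snd.
Qed.

Let W_line_measurable n y : measurable_fun setT (fun z : R => W n (y, z)).
Proof.
apply: continuous_measurable_fun => z.
apply: (@continuous_comp _ _ _ (fun z : R => (y, z) : R * R) (W n)); last exact: W_continuous.
by have := @pair_continuous R R (cst y) id z; apply; [exact: cvg_cst|exact: cvg_id].
Qed.

Let W_bound n : exists C c : R, exists M : nat, [/\ 0 <= C, 0 < c &
  forall y z : R, y \in `[0, L] ->
    `|W n (y, z)| <= C * (1 + `|z|) ^+ M * expR (- (c * z ^+ 2))].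
Proof.
have [d d0 dP] := continuous_segment_pos (ltW L0) (@s_continuous R G Gc 2)
  (fun y _ => G2 y).
have [C [M [C0 CP]]] := @B_series_growth R L G kappa L0 Gc ck
  [set p : R * (R * R) | p.2.1 \in `[0, L]] n (fun p Lp => Lp).
exists C, (d / 4), M; split => // [|y z yL]; first exact: divr_gt0.
rewrite normrM (ger0_norm (expR_ge0 _)) mulrC; apply: ler_pM => //.
  exact: (CP (0, (y, z))).
rewrite ler_expR/=; have : d * z ^+ 2 <= s y 2%N * z ^+ 2.
  by apply: ler_wpM2r; [exact: sqr_ge0|exact: dP].
by rewrite /s; lra.
Qed.

Let W_integrable n y : y \in `[0, L] ->
  mu.-integrable setT (EFin \o (fun z => W n (y, z))).
Proof.
move=> yL; have [C [c [M [C0 cp WP]]]] := W_bound n.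
apply: (@gauss_growth_integrable R c M _ cp (@W_line_measurable n y)).
by exists C => z; exact: WP.
Qed.

Let m_bound n : exists C : R, {in `[0, L], forall y, `|m n y| <= C}.
Proof.
have [C [c [M [C0 cp WP]]]] := W_bound n.
pose w (z : R) := C * ((1 + `|z|) ^+ M * expR (- (c * z ^+ 2))).
have iw : mu.-integrable setT (EFin \o w).
  exact: (integrable_scale C measurableT (gauss_weight_integrable M cp)).
exists (\int[mu]_z w z) => y yL.
have := @Rintegral_close R setT (fun z => W n (y, z)) (fun=> 0) w measurableT
  (W_integrable n yL).
rewrite Rintegral_cst ?mul0r// subr0; apply => //.
  exact: integrable0.
by move=> z _; rewrite subr0 /w mulrA WP.
Qed.

Let m_measurable n : measurable_fun setT (m n).
Proof. exact: (@partial_Rintegral_measurable R (W n) (@W_continuous n)). Qed.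

Let m_even k y : m k.*2 y = 4 * pi * a_ (s y) (kappa y) k.
Proof.
rewrite /a_ mulrA divff ?mul1r//.
by rewrite mulf_neq0// ?pnatr_eq0// gt_eqF// pi_gt0.
Qed.

Let m_odd k y : y \in `[0, L] -> m k.*2.+1 y = 0.
Proof.
move=> yL; apply: odd_integral; first exact: W_integrable.
move=> z; rewrite /W /= sqrrN B_series_opp -signr_odd /= odd_double expr1.
by rewrite mulN1r mulrN.
Qed.

Let V (e t y z : R) : R := \1_(`[- e, e[%classic) (t * z) *
  (expR (- (G 0%N y (t * z) / (2 * t ^+ 2))) * (1 + t * z * kappa y)).

Let G_line_continuous k y : continuous (G k y).
Proof.
move=> z; apply: (@continuous_comp _ _ _ (fun z : R => (y, z) : R * R)
  (fun p => G k p.1 p.2)); last exact: Gc.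
by have := @pair_continuous R R (cst y) id z; apply; [exact: cvg_cst|exact: cvg_id].
Qed.

Let V_measurable e t y : measurable_fun setT (V e t y).
Proof.
have ct : continuous (fun z : R => t * z).
  by apply: continuous_mul => z; [exact: cvg_cst|exact: cvg_id].
apply: measurable_funM.
  apply: measurableT_comp; last exact: continuous_measurable_fun.
  exact: measurable_indic.
apply: continuous_measurable_fun; apply: continuous_mul.
  apply: continuous_expRo; apply: continuous_opp; apply: continuous_mul.
    move=> z; apply: (@continuous_comp _ _ _ (fun z => t * z) (G 0%N y)).
      exact: ct.
    exact: G_line_continuous.
  by move=> z; exact: cvg_cst.
apply: continuous_add; first by move=> z; exact: cvg_cst.
by apply: continuous_mul => // z; exact: cvg_cst.
Qed.

(** The substitution of t z for z. The absolute value makes the integrand nonnegative on the whole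
    line, as the substitution lemma demands; on the interval itself [jac0] makes it harmless. *)
Let V_scale e t y : 0 < e -> 0 < t -> mu.-integrable setT (EFin \o V e t y) ->
  (forall z, `|z| <= e -> 0 <= 1 + z * kappa y) ->
  (\int[mu]_(z in `[(- e)%R, e[)
    (`|c0 y * (1 + z * kappa y)| * expR (- (G 0%N y z / (2 * t ^+ 2))))%:E =
  (t * c0 y * \int[mu]_z V e t y z)%:E)%E.
Proof.
move=> e0 t0 iV jac0.
have tn0 : t != 0 by rewrite gt_eqF.
pose g (x : R) := (`|c0 y * (1 + x * kappa y)| * expR (- (G 0%N y x / (2 * t ^+ 2))))%:E.
have := @ge0_substitution_incr R (fun z => t * z) (cst t) (- e / t) (e / t) g.
have -> : t * (- e / t) = - e by field.
have -> : t * (e / t) = e by field.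
move=> <-.
- have -> : (t * c0 y * \int[mu]_z V e t y z)%:E = (\int[mu]_z (t * c0 y * V e t y z)%:E)%E.
    have iV' : mu.-integrable setT (EFin \o (fun z => t * c0 y * V e t y z)).
      exact: (integrable_scale (t * c0 y) measurableT iV).
    rewrite -(@RintegralZl _ _ _ mu setT (V e t y) (t * c0 y) measurableT iV).
    by rewrite /Rintegral fineK//; exact: (integrable_fin_num measurableT iV').
  rewrite integral_mkcond; apply: eq_integral => z _; rewrite patchE.
  have tzE : (z \in `[(- e / t), (e / t)[%classic) = (t * z \in `[- e, e[%classic).
    apply/idP/idP; rewrite !inE/= !in_itv/= ler_pdivrMr// ltr_pdivlMr// ![z * t]mulrC //.
  rewrite tzE /V indicE; case: ifPn => tz; last by rewrite mul0r mulr0.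
  rewrite /g/= -EFinM ger0_norm ?mul1r; first by congr EFin; ring.
  rewrite mulr_ge0// jac0//; move: tz; rewrite inE/= in_itv/= => /andP[? /ltW ?].
  by rewrite ler_norml; apply/andP.
- by rewrite ltr_pM2r ?invr_gt0//; lra.
- move=> z _; apply: is_derive_eq; rewrite /GRing.scale/=; ring.
- by move=> z _; exact: cvg_cst.
- by [].
- apply/measurable_EFinP; apply: continuous_measurable_fun; apply: continuous_mul.
    have cj : continuous (fun z : R => c0 y * (1 + z * kappa y)).
      apply: continuous_mul; first by move=> z; exact: cvg_cst.
      apply: continuous_add; first by move=> z; exact: cvg_cst.
      by apply: continuous_mul => z; [exact: cvg_id|exact: cvg_cst].
    exact: continuous_abs.
  apply: continuous_expRo; apply: continuous_opp; apply: continuous_mul.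
    exact: G_line_continuous.
  by move=> z; exact: cvg_cst.
- by move=> x; rewrite lee_fin mulr_ge0// expR_ge0.
Qed.

(** The pointwise estimate is integrated in z, where the weight has finite mass [Q], and then over a
    period, which contributes [L]. The double integral is the one the tube formula produces, a
    priori possibly infinite, so its finiteness belongs to the conclusion. *)
Lemma laplace_integral : exists2 e1, 0 < e1 & forall (e : R) (K : nat),
  0 < e -> e <= e1 ->
  {in `[0, L], forall y z, `|z| <= e -> 0 <= 1 + z * kappa y} ->
  exists C : R, forall t, 0 < t -> t <= 1 -> exists2 I : R,
    (\int[mu]_(y in `[0%R, L[) \int[mu]_(z in `[(- e)%R, e[)
      (c0 y * (1 + z * kappa y) * expR (- (G 0%N y z / (2 * t ^+ 2))))%:E = I%:E)%E &
    `|I - \sum_(k < K.+1) t ^+ k.*2.+1 *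
      (4 * pi * \int[mu]_(y in `[0, L]) (a_ (s y) (kappa y) k * c0 y))| <=
    C * t ^+ K.*2.+3.
Proof.
have [e1 e10 H] := laplace_pointwise L0 GE Gc G00 G10 G2 ck.
exists e1 => // e K e0 ee1 jac0.
have [C [c [M [C0 cp VP]]]] := H e K.*2 e0 ee1.
pose w (z : R) := (1 + `|z|) ^+ M * expR (- (c * z ^+ 2)).
have iw := gauss_weight_integrable M cp.
pose Q := \int[mu]_z w z.
have w0 z : 0 <= w z by rewrite mulr_ge0 ?expR_ge0// exprn_ge0// addr_ge0.
have Q0 : 0 <= Q by apply: Rintegral_ge0 => z _; exact: w0.
have [Cc Cc1 CcP] := continuous_segment_bounded (ltW L0) cc0.
have Cc0 : 0 <= Cc by exact: le_trans Cc1.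
exists (C * Q * Cc * L) => t t0 t1.
have tn (k : nat) : 0 <= t ^+ k by rewrite exprn_ge0// ltW.
(* Orders 0 to 2K + 1 are kept: the last one is odd and integrates to 0, so the error starts at
   order 2K + 2, and the factor t of the rescaling raises it to 2K + 3. *)
pose N := K.*2.+2.
pose Sm y z := \sum_(n < N) t ^+ n * W n (y, z).
have iSm y : y \in `[0, L] -> mu.-integrable setT (EFin \o Sm y) /\
    \int[mu]_z Sm y z = \sum_(n < N) t ^+ n * m n y.
  move=> yL; exact: (@Rintegral_scale_sum R 'I_N _ setT (fun n => t ^+ n)
    (fun n z => W n (y, z)) measurableT (fun n => W_integrable n yL)).
have VS y z : y \in `[0, L] -> `|V e t y z - Sm y z| <= C * t ^+ N * w z.
  by move=> yL; exact: VP.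
have iV y : y \in `[0, L] -> mu.-integrable setT (EFin \o V e t y).
  move=> yL; have [iS _] := iSm y yL.
  have iD : mu.-integrable setT (EFin \o (fun z => V e t y z - Sm y z)).
    have mS : measurable_fun setT (Sm y).
      by apply/measurable_EFinP; exact: measurable_int iS.
    apply: (@gauss_growth_integrable R c M _ cp
      (measurable_funB (@V_measurable e t y) mS)).
    by exists (C * t ^+ N) => z; rewrite -mulrA; exact: VS.
  have -> : EFin \o V e t y =
      ((EFin \o (fun z => (V e t y z - Sm y z)%R)) \+ (EFin \o Sm y))%E.
    by apply/funext => z /=; rewrite -EFinD subrK.
  exact: integrableD.
have Zest y : y \in `[0, L] ->
    `|\int[mu]_z V e t y z - \sum_(n < N) t ^+ n * m n y| <= C * t ^+ N * Q.
  move=> yL; have [iS <-] := iSm y yL.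
  rewrite -(@RintegralZl _ _ _ mu setT w (C * t ^+ N) measurableT iw).
  apply: (@Rintegral_close R setT _ _ _ measurableT (iV y yL) iS) => [|z _].
    exact: (integrable_scale (C * t ^+ N) measurableT iw).
  exact: VS.
(* The absolute value makes [j] measurable on the whole line by Tonelli; on the period it is the
   rescaled integral, by [jE]. *)
pose j y := fine (\int[mu]_(z in `[(- e)%R, e[)
  (`|c0 y * (1 + z * kappa y)| * expR (- (G 0%N y z / (2 * t ^+ 2))))%:E)%E.
have co_cc y : y \in `[0, L[ -> y \in `[0, L].
  by rewrite !in_itv/= => /andP[-> /ltW].
have jE y : y \in `[0, L] -> j y = t * c0 y * \int[mu]_z V e t y z.
  move=> yL; rewrite /j V_scale//; first exact: iV.
  by move=> z ze; exact: jac0.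
have mj : measurable_fun setT j.
  apply: (measurableT_comp (fine_measurable measurableT)).
  pose k (p : R * R) := `|c0 p.1 * (1 + p.2 * kappa p.1)| *
    expR (- (G 0%N p.1 p.2 / (2 * t ^+ 2))).
  have k0 p : (0 <= (k p)%:E)%E by rewrite lee_fin mulr_ge0// expR_ge0.
  suff mk : measurable_fun [set: measurableTypeR R * measurableTypeR R] (EFin \o k).
    have mI : measurable (`[(- e)%R, e[%classic : set R) by [].
    exact: (@partial_integral_measurable R _ (EFin \o k) mI mk k0).
  apply/measurable_EFinP; apply: (@continuous_plane_measurable R).
  apply: continuous_mul.
    have cj : continuous (fun p : R * R => c0 p.1 * (1 + p.2 * kappa p.1)).
      apply: continuous_mul.
        by move=> p; apply: (@continuous_comp _ _ _ fst c0); [exact: cvg_fst|exact: cc0].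
      apply: continuous_add; first by move=> z; exact: cvg_cst.
      apply: continuous_mul; first by move=> z; exact: cvg_snd.
      by move=> p; apply: (@continuous_comp _ _ _ fst kappa); [exact: cvg_fst|exact: ck].
    exact: continuous_abs.
  apply: continuous_expRo; apply: continuous_opp; apply: continuous_mul; first exact: Gc.
  by move=> z; exact: cvg_cst.
have icm n : mu.-integrable `[0, L[%classic (EFin \o (fun y => c0 y * m n y)).
  have [Cm CmP] := m_bound n.
  apply: (@bounded_integrable_co R L (Cc * Cm)).
    by apply: measurable_funM => //; exact: continuous_measurable_fun.
  move=> y /co_cc yL; rewrite normrM ler_pM//; first exact: CcP.
  exact: CmP.
pose T y := \sum_(n < N) t ^+ n.+1 * (c0 y * m n y).
have [iT ET] := @Rintegral_scale_sum R 'I_N (index_enum _) `[0, L[%classic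
  (fun n => t ^+ n.+1) (fun n y => c0 y * m n y) ltac:(by []) icm.
have jT y : y \in `[0, L[ -> `|j y - T y| <= C * Q * Cc * t ^+ K.*2.+3.
  move=> /co_cc yL; rewrite jE//.
  have -> : T y = t * c0 y * \sum_(n < N) t ^+ n * m n y.
    by rewrite mulr_sumr; apply: eq_bigr => n _; rewrite exprS; ring.
  rewrite -mulrBr normrM ger0_norm; last by rewrite mulr_ge0// ltW.
  have cy : c0 y <= Cc by apply: le_trans (CcP y yL); exact: ler_norm.
  rewrite (_ : C * Q * Cc * t ^+ K.*2.+3 = t * Cc * (C * t ^+ N * Q)); last first.
    by rewrite exprS /N; ring.
  apply: ler_pM => //; first by rewrite mulr_ge0// ltW.
    by apply: ler_wpM2l => //; exact: ltW.
  exact: Zest.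
(* Integrability of [j] comes from its bounded distance to the integrable [T] on an interval of
   finite length. *)
have ij : mu.-integrable `[0, L[%classic (EFin \o j).
  have iD : mu.-integrable `[0, L[%classic (EFin \o (fun y => j y - T y)).
    apply: (@bounded_integrable_co R L (C * Q * Cc * t ^+ K.*2.+3)) => //.
    apply: measurable_funB => //.
    apply: measurable_sum => n; apply: measurable_funM => //.
    by apply: measurable_funM => //; exact: continuous_measurable_fun.
  have -> : EFin \o j = ((EFin \o (fun y => (j y - T y)%R)) \+ (EFin \o T))%E.
    by apply/funext => z /=; rewrite -EFinD subrK.
  exact: integrableD.
exists (\int[mu]_(y in `[0, L[) j y).
  rewrite /Rintegral fineK; last exact: (integrable_fin_num _ ij).
  apply: eq_integral => y; rewrite inE/= => /co_cc yL.
  rewrite jE// -V_scale//; [|exact: iV|by move=> z ze; exact: jac0].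
  apply: eq_integral => z; rewrite inE/= in_itv/= => /andP[z1 /ltW z2].
  by rewrite ger0_norm// mulr_ge0// jac0// ler_norml z1.
have -> : \sum_(k < K.+1) t ^+ k.*2.+1 *
      (4 * pi * \int[mu]_(y in `[0, L]) (a_ (s y) (kappa y) k * c0 y)) =
    \int[mu]_(y in `[0, L[) T y.
  rewrite ET (_ : N = (K.+1).*2)//.
  rewrite (sum_even_odd (fun n => t ^+ n.+1 * \int[mu]_(y in `[0, L[) (c0 y * m n y))).
  apply: eq_bigr => k _.
  have -> : \int[mu]_(y in `[0, L[) (c0 y * m k.*2.+1 y) = 0.
    under eq_Rintegral => y do [rewrite inE/= => /co_cc yL; rewrite m_odd// mulr0].
    by rewrite Rintegral_cst// mul0r.
  rewrite mulr0 addr0; congr (_ * _).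
  have pi4 : 4 * pi != 0 :> R by rewrite mulf_neq0// ?pnatr_eq0// gt_eqF// pi_gt0.
  have acE : (fun y => a_ (s y) (kappa y) k * c0 y) =
      (fun y => (4 * pi)^-1 * (c0 y * m k.*2 y)).
    by apply/funext => y; rewrite m_even [RHS]mulrCA mulKf// mulrC.
  rewrite -Rintegral_itv_bndo_bndc; last first.
    by rewrite acE; exact: integrable_scale.
  rewrite acE (@RintegralZl _ _ _ mu `[0, L[%classic _ (4 * pi)^-1 ltac:(by []) (icm k.*2)).
  by rewrite mulrA divff ?mul1r.
have := @Rintegral_close R `[0, L[%classic j T (cst (C * Q * Cc * t ^+ K.*2.+3))
  ltac:(by []) ij iT.
rewrite Rintegral_cst//= lebesgue_measure_itv/= lte_fin L0 oppr0 addr0 /=.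
have -> : C * Q * Cc * L * t ^+ K.*2.+3 = C * Q * Cc * t ^+ K.*2.+3 * L by ring.
apply.
  apply: (@bounded_integrable_co R L `|C * Q * Cc * t ^+ K.*2.+3|) => //.
by move=> y; rewrite inE/= => yL; exact: jT.
Qed.

End laplace_integral.

(** * The heat trace *)

Section heat_integral_exterior.
Context {R : realType}.
Notation mu := (@lebesgue_measure R).
Local Notation T2 := (measurableTypeR R * measurableTypeR R)%type.

Lemma exterior_lower_bound (S f1 f2 : _) (e p r C : R) (T : set (R * R)) :
  0 < e -> 0 < p -> 0 < r -> 0 < C -> continuous (S : R * R -> R) ->
  (forall x, 0 <= S x) ->
  (forall x, S x = 0 -> exists y : R, x = (f1 y, f2 y)) ->
  (forall x, r ^+ 2 / 2 < sigma x 0 -> C * (sigma x 0) `^ p <= S x) ->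
  (forall x : R * R, (exists y, (x.1 - f1 y) ^+ 2 + (x.2 - f2 y) ^+ 2 < e ^+ 2) -> T x) ->
  exists2 c : R, 0 < c & forall x, ~ T x -> c <= S x.
Proof.
move=> e0 p0 r0 C0 cS S0 Sz decay TP.
pose q y (x : R * R) := (x.1 - f1 y) ^+ 2 + (x.2 - f2 y) ^+ 2.
have cq y : continuous (q y).
  by apply: continuous_add; apply: continuous_exp; apply: continuous_add => z;
    [exact: cvg_fst|exact: cvg_cst|exact: cvg_snd|exact: cvg_cst].
(* The tube is half-open in z, so compactness is applied to the complement of the open distance
   neighbourhood [O], which [T] contains by [TP]. *)
pose O := \bigcup_y (q y @^-1` [set u | u < e ^+ 2]).
have oO : open O.
  apply: bigcup_open => y _.
  by move/continuousP: (cq y); apply; exact: open_lt.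
(* Outside this square one coordinate exceeds [r] in size, so [sigma x 0] exceeds [r ^+ 2 / 2] and
   the growth condition applies. *)
pose B : set (R * R) := `[- r, r]%classic `*` `[- r, r]%classic.
pose K := B `&` ~` O.
have cB : compact B by apply: compact_setX; exact: segment_compact.
have cK : compact K by apply: compact_closedI => //; exact: open_closedC.
have c2 : 0 < C * (r ^+ 2 / 2) `^ p.
  by rewrite mulr_gt0// powR_gt0// divr_gt0// exprn_gt0.
have KS x : K x -> 0 < S x.
  move=> [_ nO]; rewrite lt_neqAle S0 andbT eq_sym; apply/eqP => /Sz[y xE].
  by apply: nO; exists y => //=; rewrite /q xE/= !subrr expr0n/= addr0 exprn_gt0.
have TK x : ~ T x -> K x \/ C * (r ^+ 2 / 2) `^ p <= S x.
  move=> nT; have [Bx|nB] := pselect (B x).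
    by left; split => // -[y _ yP]; apply: nT; apply: TP; exists y.
  right; have sx : r ^+ 2 / 2 < sigma x 0.
    rewrite sigma0E ltr_pM2r ?invr_gt0// ltNge; apply/negP => H; apply: nB.
    split; rewrite /= in_itv/= -ler_norml -(@ler_pXn2r _ 2) ?nnegrE ?(ltW r0)//.
      by rewrite real_normK ?num_real// (le_trans _ H)// lerDl sqr_ge0.
    by rewrite real_normK ?num_real// (le_trans _ H)// lerDr sqr_ge0.
  apply: le_trans (decay x sx); apply: ler_wpM2l; first exact: ltW.
  apply: ge0_ler_powR; rewrite ?nnegrE ?(ltW p0) ?(ltW sx)//.
    by rewrite divr_ge0// sqr_ge0.
  by rewrite (le_trans _ (ltW sx))// divr_ge0// sqr_ge0.
have [K0|/eqP/set0P[x0 Kx0]] := pselect (K = set0).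
  by exists (C * (r ^+ 2 / 2) `^ p) => // x /TK[|//]; rewrite K0.
have [x1 Kx1 x1min] := compact_EVT_min (ex_intro _ x0 Kx0) cK (continuous_subspaceT cS).
exists (Num.min (S x1) (C * (r ^+ 2 / 2) `^ p)).
  by rewrite lt_min c2 andbT; apply: KS; exact: set_mem.
move=> x /TK[Kx|]; rewrite ge_min; last by move=> ->; rewrite orbT.
by rewrite x1min//; exact/mem_set.
Qed.

(** For t at most 1/2 the exponent S / (2t) is at least c / (4t) + S / 2: half of it pays for the
    first term through S >= c, the other half for the second through 1 / t >= 2. *)
Lemma exterior_integral_bound (S : R * R -> R) (T : set (R * R)) (c t : R) :
  measurable_fun [set: T2] S -> measurable (T : set T2) -> 0 < c ->
  (forall x, ~ T x -> c <= S x) -> 0 < t -> t <= 2^-1 ->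
  (\int[(mu \x mu)%E]_(x in ~` T) (expR (- (S x / (2 * t))))%:E <=
   (expR (- (c / (4 * t))))%:E *
     \int[(mu \x mu)%E]_x (expR (- (S x / 2)))%:E)%E.
Proof.
move=> mS mT c0 TS t0 t1.
have mE (k : R) : measurable_fun [set: T2] (fun x => (expR (- (S x / k)))%:E).
  apply/measurable_EFinP/measurableT_comp => //.
  by apply: measurableT_comp => //; exact: measurable_funM.
rewrite -ge0_integralZl//=.
apply: (@le_trans _ _ (\int[(mu \x mu)%E]_(x in ~` T)
   ((expR (- (c / (4 * t))))%:E * (expR (- (S x / 2)))%:E))%E).
  apply: ge0_le_integral => //.
  - exact: measurableC.
  - exact: measurable_funTS.
  - by apply: measurable_funTS; apply: emeasurable_funM.
  - move=> x nT; rewrite -EFinM lee_fin -expRD ler_expR.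
    have Sc := TS x nT.
    have tV : 2 <= t^-1 by rewrite -[leLHS]invrK lef_pV2// posrE invr_gt0.
    have -> : S x / (2 * t) = S x * t^-1 / 2 by field; rewrite gt_eqF.
    have -> : c / (4 * t) = c * t^-1 / 4 by field; rewrite gt_eqF.
    by move: (t^-1) tV => v v2; nra.
apply: ge0_subset_integral => //.
  exact: measurableC.
by apply: emeasurable_funM.
Qed.

End heat_integral_exterior.

Section heat_expansion.
Context {R : realType}.
Notation mu := (@lebesgue_measure R).
Local Notation T2 := (measurableTypeR R * measurableTypeR R)%type.

Lemma powR_half_integer (t : R) k : 0 < t ->
  t `^ ((2 * k%:R - 1) / 2) = Num.sqrt t ^+ k.*2 / Num.sqrt t.
Proof.
move=> t0; have -> : (2 * k%:R - 1) / 2 = k%:R + - 2^-1 :> R by field.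
rewrite powRD; last by rewrite (gt_eqF t0) implybT.
rewrite powR_mulrn ?(ltW t0)// powRN -powR12_sqrt ?(ltW t0)//.
by rewrite -mul2n exprM powR12_sqrt ?sqr_sqrtr// ltW.
Qed.

(** In the square root of time all exponents are integers. The error has order 2K + 1 against the
    reference order 2K - 1, so their ratio is a constant multiple of the time itself. *)
Lemma half_integer_expansion_sqrt (F : R -> R) (A : nat -> R) :
  (forall K, exists C t0 : R, 0 < t0 /\ forall t, 0 < t -> t <= t0 ->
    `|F (t ^+ 2) - \sum_(k < K.+1) t ^+ k.*2 / t * A k| <= C * t ^+ K.*2.+1) ->
  half_integer_expansion F A.
Proof.
move=> H K; apply/eqoP => eps eps0.
have [C [t0 [t0p HK]]] := H K.
pose d := Num.min (t0 ^+ 2) (eps / (`|C| + 1)).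
have d0 : 0 < d.
  by rewrite lt_min exprn_gt0//= divr_gt0// ltr_wpDl.
near=> t.
have tp : 0 < t by near: t; exact: nbhs_right_gt.
have td : t < d by near: t; exact: nbhs_right_lt.
have [tt0 te] : t < t0 ^+ 2 /\ t < eps / (`|C| + 1).
  by move: td; rewrite lt_min => /andP.
rewrite ltr_pdivlMr ?ltr_wpDl// in te.
pose u := Num.sqrt t.
have u0 : 0 < u by rewrite sqrtr_gt0.
have u2 : u ^+ 2 = t by rewrite sqr_sqrtr// ltW.
have ut0 : u <= t0.
  by rewrite -(@ler_pXn2r _ 2) ?nnegrE ?(ltW u0) ?(ltW t0p)// u2 ltW.
have := HK u u0 ut0; rewrite u2 => HK'.
rewrite powR_half_integer// -/u.
under eq_bigr do rewrite powR_half_integer// -/u.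
apply: (le_trans HK').
rewrite ger0_norm; last by rewrite divr_ge0 ?exprn_ge0 ?(ltW u0).
have -> : C * u ^+ K.*2.+1 = C * t * (u ^+ K.*2 / u).
  by rewrite -u2 exprS; field; exact: lt0r_neq0.
apply: ler_wpM2r; first by rewrite divr_ge0 ?exprn_ge0 ?(ltW u0).
have : C * t <= `|C| * t by apply: ler_wpM2r; [exact: ltW|exact: ler_norm].
by move: te; lra.
Unshelve. all: end_near. Qed.

(** A single term of the exponential series already beats the given power. *)
Lemma expRN_bound (c : R) n : 0 < c -> exists2 D : R, 0 <= D &
  forall t, 0 < t -> expR (- (c / t)) <= D * t ^+ n.+1.
Proof.
move=> c0; exists (n.+1`!%:R / c ^+ n.+1).
  by rewrite divr_ge0// exprn_ge0// ltW.
move=> t t0; have ct : 0 < c / t by rewrite divr_gt0.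
have F0 : 0 < n.+1`!%:R :> R by rewrite ltr0n fact_gt0.
rewrite expRN -[leRHS]invrK lef_pV2 ?posrE ?expR_gt0//; last first.
  by rewrite invr_gt0 mulr_gt0 ?exprn_gt0// divr_gt0 ?exprn_gt0.
apply: (@le_trans _ _ ((c / t) ^+ n.+1 / n.+1`!%:R)); last first.
  by rewrite (le_trans _ (expR_ge1Dxn n (ltW ct)))// lerDr.
rewrite expr_div_n; have := exprn_gt0 n.+1 c0; have := exprn_gt0 n.+1 t0.
move: (n.+1`!%:R) (c ^+ n.+1) (t ^+ n.+1) F0 => F x y F0 y0 x0.
rewrite le_eqVlt; apply/orP; left; apply/eqP; field.
by rewrite ?(gt_eqF F0, gt_eqF x0, gt_eqF y0).
Qed.

(** In the hypothesis on [T], t is the square root of time. The prefactor 1 / (4 pi t^2) of the heat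
    kernel lowers every order by two, which explains the powers t^(2k+1) and the factors 4 pi
    there. *)
Lemma heat_trace_expansion (Phi : R * R -> R * R) (T : set (R * R)) (c : R)
    (A : nat -> R) :
  measurable_fun [set: T2] (S_of Phi) -> measurable (T : set T2) -> 0 < c ->
  (forall x, ~ T x -> c <= S_of Phi x) ->
  (\int[(mu \x mu)%E]_x (expR (- (S_of Phi x / 2)))%:E < +oo)%E ->
  (forall K, exists C : R, forall t, 0 < t -> t <= 1 -> exists2 I : R,
    (\int[(mu \x mu)%E]_(x in T) (expR (- (S_of Phi x / (2 * t ^+ 2))))%:E = I%:E)%E &
    `|I - \sum_(k < K.+1) t ^+ k.*2.+1 * (4 * pi * A k)| <= C * t ^+ K.*2.+3) ->
  half_integer_expansion (heat_trace Phi) A.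
Proof.
move=> mS mT c0 TS fin_S HT; apply: half_integer_expansion_sqrt => K.
have [C CP] := HT K.
have c4 : 0 < c / 4 by rewrite divr_gt0.
(* Order K + 2 in the time is order 2K + 4 in its square root, one better than the tube error 2K +
   3. *)
have [E E0 EP] := expRN_bound K.+1 c4.
have pi0 : 0 < pi :> R by exact: pi_gt0.
pose J0 := fine (\int[(mu \x mu)%E]_x (expR (- (S_of Phi x / 2)))%:E)%E.
have J0_ge0 : 0 <= J0 by apply: fine_ge0; apply: integral_ge0 => x _; rewrite lee_fin expR_ge0.
have J0E : (\int[(mu \x mu)%E]_x (expR (- (S_of Phi x / 2)))%:E = J0%:E)%E.
  rewrite fineK// ge0_fin_numE//.
  by apply: integral_ge0 => x _; rewrite lee_fin expR_ge0.
exists ((C + E * J0) / (4 * pi)), 2^-1; split; first by rewrite invr_gt0.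
move=> t t0 t2.
have t1 : t <= 1 by apply: (le_trans t2); lra.
have tt0 : 0 < t ^+ 2 by rewrite exprn_gt0.
have tt2 : t ^+ 2 <= 2^-1 by rewrite expr2; nra.
have [I IE IP] := CP t t0 t1.
have mE : measurable_fun [set: T2] (fun x => (expR (- (S_of Phi x / (2 * t ^+ 2))))%:E).
  apply/measurable_EFinP/measurableT_comp => //.
  by apply: measurableT_comp => //; exact: measurable_funM.
have E_ge0 x : (0 <= (expR (- (S_of Phi x / (2 * t ^+ 2))))%:E)%E.
  by rewrite lee_fin expR_ge0.
have extB := exterior_integral_bound mS mT c0 TS tt0 tt2.
rewrite J0E -EFinM in extB.
pose J := fine (\int[(mu \x mu)%E]_(x in ~` T)
  (expR (- (S_of Phi x / (2 * t ^+ 2))))%:E)%E.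
have JE : (\int[(mu \x mu)%E]_(x in ~` T)
    (expR (- (S_of Phi x / (2 * t ^+ 2))))%:E = J%:E)%E.
  rewrite fineK// ge0_fin_numE; last by apply: integral_ge0 => x _; exact: E_ge0.
  by rewrite (le_lt_trans extB)// ltry.
have J_ge0 : 0 <= J by apply: fine_ge0; apply: integral_ge0 => x _; exact: E_ge0.
rewrite JE lee_fin in extB.
have traceE : heat_trace Phi (t ^+ 2) = (4 * pi * t ^+ 2)^-1 * (I + J).
  rewrite /heat_trace /Rintegral.
  have -> : (\int[(mu \x mu)%E]_x (heat_kernel (t ^+ 2) (Phi x) x)%:E =
    (4 * pi * t ^+ 2)^-1%:E *
      \int[(mu \x mu)%E]_x (expR (- (S_of Phi x / (2 * t ^+ 2))))%:E)%E.
    rewrite -ge0_integralZl//.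
    by rewrite lee_fin invr_ge0 !mulr_ge0// ltW.
  have -> : (\int[(mu \x mu)%E]_x (expR (- (S_of Phi x / (2 * t ^+ 2))))%:E =
      I%:E + J%:E)%E.
    rewrite -IE -JE -ge0_integral_setU//=.
    - by rewrite setUv.
    - exact: measurableC.
    - by rewrite setUv.
    - by apply/disj_setPS; rewrite setICr.
  by [].
have Jb : J <= E * J0 * t ^+ K.*2.+3.
  apply: (le_trans extB).
  have -> : c / (4 * t ^+ 2) = c / 4 / t ^+ 2 by field; exact: lt0r_neq0.
  apply: (@le_trans _ _ (E * (t ^+ 2) ^+ K.+2 * J0)).
    by apply: ler_wpM2r => //; exact: EP.
  have -> : E * (t ^+ 2) ^+ K.+2 * J0 = E * J0 * t ^+ K.*2.+4.
    by rewrite -exprM mul2n !doubleS; ring.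
  apply: ler_wpM2l; first by rewrite mulr_ge0.
  by apply: ler_wiXn2l; [exact: ltW| |].
have sumE : \sum_(k < K.+1) t ^+ k.*2 / t * A k = (4 * pi * t ^+ 2)^-1 *
    \sum_(k < K.+1) t ^+ k.*2.+1 * (4 * pi * A k).
  rewrite mulr_sumr; apply: eq_bigr => k _; rewrite [t ^+ k.*2.+1]exprS.
  have := lt0r_neq0 pi0; have := lt0r_neq0 t0.
  by move: (@pi R) (t ^+ k.*2) => p w t0' p0; field; rewrite p0 t0'.
rewrite sumE traceE -mulrBr normrM ger0_norm; last first.
  by rewrite invr_ge0 !mulr_ge0// ltW.
have -> : (C + E * J0) / (4 * pi) * t ^+ K.*2.+1 =
    (4 * pi * t ^+ 2)^-1 * ((C + E * J0) * t ^+ K.*2.+3).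
  rewrite -[K.*2.+3]addn2 exprD.
  have := lt0r_neq0 pi0; have := lt0r_neq0 t0.
  by move: (@pi R) (t ^+ K.*2.+1) => p w t0' p0; field; rewrite p0 t0'.
apply: ler_wpM2l; first by rewrite invr_ge0 !mulr_ge0// ltW.
rewrite addrAC (le_trans (ler_normD _ _))// (ger0_norm J_ge0) [leRHS]mulrDl.
exact: lerD.
Qed.

End heat_expansion.

Section normal_jets.
Context {R : realType}.
Variables (Phi : R * R -> R * R) (f h : R -> R * R).
Hypothesis Phi_smooth : smooth_map_on setT Phi.

(** Taylor's formula needs the derivatives at every [z], not only at 0 as in [nderiv]. The direction
    [h y] is constant along each normal, so these are iterated derivatives of a function of one
    variable. *)
Definition normal_jet (g : R * R -> R) (k : nat) (y z : R) : R :=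
  dirn k g (h y) (f y + z *: h y).

Lemma normal_jet0 g k y : smooth_fun g -> normal_jet g k y 0 = nderiv f h g k y.
Proof. by move=> sg; rewrite /nderiv derive1n_line. Qed.

(** S is half the squared norm of [Psi], which vanishes on the curve, so all Leibniz terms with an
    undifferentiated factor disappear. *)
Lemma normal_derivatives y : Phi (f y) = f y ->
  let D i j := dot (Psi_ Phi f h i y) (Psi_ Phi f h j y) in
  [/\ s_ Phi f h 0 y = 0, s_ Phi f h 1 y = 0, s_ Phi f h 2 y = D 1%N 1%N,
      s_ Phi f h 3 y = 3 * D 1%N 2%N &
      [/\ s_ Phi f h 4 y = 4 * D 1%N 3%N + 3 * D 2%N 2%N,
          s_ Phi f h 5 y = 5 * D 1%N 4%N + 10 * D 2%N 3%N &
          s_ Phi f h 6 y = 6 * D 1%N 5%N + 15 * D 2%N 4%N + 10 * D 3%N 3%N]].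
Proof.
move=> fixy D; have [s1 s2] := Psi_smooth Phi_smooth.
pose U k := normal_jet (fst \o Psi Phi) k y.
pose V k := normal_jet (snd \o Psi Phi) k y.
have UE k (z : R) : is_derive z 1 (U k) (U k.+1 z) by exact: is_derive_dirn.
have VE k (z : R) : is_derive z 1 (V k) (V k.+1 z) by exact: is_derive_dirn.
have [U00 V00] : U 0%N 0 = 0 /\ V 0%N 0 = 0.
  have P0 : Psi Phi (f y + 0 *: h y) = 0 by rewrite scale0r addr0 /Psi fixy subrr.
  by rewrite /U /V /normal_jet /dirn /comp P0.
have DE i j : D i j = U i 0 * U j 0 + V i 0 * V j 0.
  by rewrite /D /dot /Psi_/= /U /V !normal_jet0.
have sE k : s_ Phi f h k y = derive1n k (fun z => 2^-1 *
    (U 0%N z * U 0%N z + V 0%N z * V 0%N z)) 0 by [].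
have [E1 E2 E3 E4 [E5 E6]] := half_square_derivatives UE VE.
split; [by rewrite sE/= !(U00, V00, mul0r, add0r) mulr0|by rewrite sE E1 !(U00, V00, mul0r, add0r)|by rewrite sE E2 DE !(U00, V00, mul0r, add0r)|
  by rewrite sE E3 !DE !(U00, V00, mul0r, add0r)|].
by split; [rewrite sE E4|rewrite sE E5|rewrite sE E6]; rewrite !DE !(U00, V00, mul0r, add0r).
Qed.

End normal_jets.

Section moving_frame.
Context {R : realType}.
Variables (L : R) (f h : R -> R * R).
Hypothesis h_normal : oriented_unit_normal L f h.

(** Lagrange's identity writes |f'|^2 |h|^2 as the sum of the squared cross and dot products; the
    dot product is 0 and the orientation fixes the sign of the root. *)
Lemma metric_cross y : (metric f y) `^ 2^-1 = cross (velocity f y) (h y).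
Proof.
have [_ _ hh vh vc] := h_normal.
have -> : metric f y = cross (velocity f y) (h y) ^+ 2.
  have := hh y; have := vh y; rewrite /metric /cross /dot.
  move: (velocity f y) (h y) => [a b] [c d] /= H1 H2.
  have -> : a * a + b * b = (a * a + b * b) * (c * c + d * d) by rewrite H2 mulr1.
  have -> : (a * a + b * b) * (c * c + d * d) = (a * d - b * c) ^+ 2 + (a * c + b * d) ^+ 2.
    by ring.
  by rewrite H1 expr0n addr0.
rewrite powR12_sqrt ?sqr_ge0// sqrtr_sqr gtr0_norm//; exact: vc.
Qed.

Lemma curvature_cross y :
  curvature f h y = (cross (velocity f y) (h y))^-1 * cross (velocity h y) (h y).
Proof. by rewrite /curvature powRN metric_cross. Qed.

End moving_frame.

Section parametrized_curve.
Context {R : realType}.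
Notation mu := (@lebesgue_measure R).
Local Notation T2 := (measurableTypeR R * measurableTypeR R)%type.

Lemma derive1n_is_derive (u : R -> R) k (y : R) :
  (forall j (x : R), derivable (derive1n j u) x 1) ->
  is_derive y 1 (derive1n k u) (derive1n k.+1 u y).
Proof.
move=> du; rewrite derive1nS derive1E.
exact: (DeriveDef (du k y)).
Qed.

Lemma derive1n_continuous (u : R -> R) k :
  (forall j (x : R), derivable (derive1n j u) x 1) -> continuous (derive1n k u).
Proof.
move=> du y.
exact: (@is_derive1_continuous R _ (derive1n k.+1 u) y (derive1n_is_derive k y du)).
Qed.

(** The family [G] of normal derivatives of S enters the Laplace expansion with the arc-length
    density [c0] as weight, and the tube formula identifies the resulting double integral with a
    plane integral. *)
Lemma heat_trace_half_integer_expansion (Phi : R * R -> R * R) (L : R)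
    (f h : R -> R * R) :
  smooth_map_on setT Phi ->
  (exists p r C : R, [/\ 0 < p, 0 < r, 0 < C &
    forall x : R * R, r ^+ 2 / 2 < sigma x 0 ->
      C * (sigma x 0) `^ p <= S_of Phi x]) ->
  closed_parametrization (fixed_points Phi) L f ->
  oriented_unit_normal L f h ->
  (forall y, 0 < s_ Phi f h 2%N y) ->
  half_integer_expansion (heat_trace Phi) (fun k => arc_integral f L
    (fun y => a_ (fun j => s_ Phi f h j y) (curvature f h y) k)).
Proof.
move=> sPhi [p [r [C [p0 r0 C0 decay]]]] f_param h_normal s2_gt0.
have [L0 [sf _] fL finj frange] := f_param.
have [sh hL hh vh vc] := h_normal.
have df1 : forall j (x : R), derivable (derive1n j (fst \o f)) x 1 by move=> j x; have [] := sf j x.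
have df2 : forall j (x : R), derivable (derive1n j (snd \o f)) x 1 by move=> j x; have [] := sf j x.
have dh1 : forall j (x : R), derivable (derive1n j (fst \o h)) x 1 by move=> j x; have [] := sh j x.
have dh2 : forall j (x : R), derivable (derive1n j (snd \o h)) x 1 by move=> j x; have [] := sh j x.
pose c0 y := cross (velocity f y) (h y).
have fixf y : Phi (f y) = f y.
  by have : fixed_points Phi (f y) by rewrite -frange; exists y.
have sS : smooth_fun (S_of Phi) := S_smooth sPhi.
pose G := normal_jet f h (S_of Phi).
have GE k y (z : R) : is_derive z 1 (G k y) (G k.+1 y z) by exact: is_derive_dirn.
have c1 : continuous (fst \o h) := derive1n_continuous (k := 0) dh1.
have c2 : continuous (snd \o h) := derive1n_continuous (k := 0) dh2.
have cf1 : continuous (fst \o f) := derive1n_continuous (k := 0) df1.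
have cf2 : continuous (snd \o f) := derive1n_continuous (k := 0) df2.
have comp1 (u : R -> R) : continuous u -> continuous (fun q : R * R => u q.1).
  by move=> cu q; apply: (@continuous_comp _ _ _ fst u); [exact: cvg_fst|exact: cu].
have csnd : continuous (fun q : R * R => q.2) by move=> q; exact: cvg_snd.
have Gc k : continuous (fun q : R * R => G k q.1 q.2).
  apply: (@dirn_continuous R _ k (S_of Phi) (fun q : R * R => h q.1)
    (fun q => f q.1 + q.2 *: h q.1) sS).
  - exact: (comp1 _ c1).
  - exact: (comp1 _ c2).
  - move=> q; have := @pair_continuous R (R * R)%type
      (fun q => (f q.1).1 + q.2 * (h q.1).1) (fun q => (f q.1).2 + q.2 * (h q.1).2) q.
    apply; first by apply: continuous_add; [exact: (comp1 _ cf1)|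
      apply: continuous_mul => //; exact: (comp1 _ c1)].
    by apply: continuous_add; [exact: (comp1 _ cf2)|
      apply: continuous_mul => //; exact: (comp1 _ c2)].
have sE j y : G j y 0 = s_ Phi f h j y by rewrite /G normal_jet0.
have G00 y : G 0%N y 0 = 0 by rewrite sE; have [] := normal_derivatives h sPhi (fixf y).
have G10 y : G 1%N y 0 = 0 by rewrite sE; have [] := normal_derivatives h sPhi (fixf y).
have G2 y : 0 < G 2%N y 0 by rewrite sE.
have cd1 k := derive1n_continuous (k := k) df1.
have cd2 k := derive1n_continuous (k := k) df2.
have ce1 k := derive1n_continuous (k := k) dh1.
have ce2 k := derive1n_continuous (k := k) dh2.
have cc0 : continuous c0.
  apply: continuous_add; last apply: continuous_opp.
    by apply: continuous_mul; [exact: (cd1 1%N)|exact: c2].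
  by apply: continuous_mul; [exact: (cd2 1%N)|exact: c1].
have c0_gt0 y : 0 < c0 y by exact: vc.
have ck : continuous (curvature f h).
  have -> : curvature f h = fun y => (c0 y)^-1 * cross (velocity h y) (h y).
    by apply/funext => y; exact: (curvature_cross h_normal).
  apply: continuous_mul.
    by move=> y; apply: (@continuousV R R c0 y _ (cc0 y)); rewrite gt_eqF.
  apply: continuous_add; last apply: continuous_opp.
    by apply: continuous_mul; [exact: (ce1 1%N)|exact: c2].
  by apply: continuous_mul; [exact: (ce2 1%N)|exact: c1].
have fiP : {in `[0, L[%R &, forall y y' : R, (fst \o f) y = (fst \o f) y' ->
    (snd \o f) y = (snd \o f) y' -> y = y'}.
  move=> y y' yL yL' E1 E2; apply: finj => //.
  by apply/eqP; rewrite /eq_op/=; apply/andP; split; apply/eqP.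
have huP y : (fst \o h) y ^+ 2 + (snd \o h) y ^+ 2 = 1 by exact: hh.
have f1L y : (fst \o f) (y + L) = (fst \o f) y by rewrite /= fL.
have f2L y : (snd \o f) (y + L) = (snd \o f) y by rewrite /= fL.
have h1L y : (fst \o h) (y + L) = (fst \o h) y by rewrite /= hL.
have h2L y : (snd \o h) (y + L) = (snd \o h) y by rewrite /= hL.
have [e0 e0_gt0 tube] := @tube_change_of_variables R _ _ _ _ _ _ _ _ _ _
  (fun y => derive1n_is_derive 0 y df1) (fun y => derive1n_is_derive 0 y df2)
  (fun y => derive1n_is_derive 0 y dh1) (fun y => derive1n_is_derive 0 y dh2)
  (fun y => derive1n_is_derive 1 y df1) (fun y => derive1n_is_derive 1 y df2)
  (ce1 1%N) (ce2 1%N) (cd1 2%N) (cd2 2%N) L L0 f1L f2L h1L h2L fiP huP vh vc.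
have [e1 e1_gt0 lapl] := @laplace_integral R L G (curvature f h) c0 L0 GE Gc G00
  G10 G2 ck cc0 (fun y => ltW (c0_gt0 y)).
(* Thin enough both for the tube formula to hold and for the Gaussian to absorb the rest of the
   exponent. *)
pose e := Num.min e0 e1.
have e_gt0 : 0 < e by rewrite lt_min e0_gt0.
have ee0 : e <= e0 by rewrite ge_min lexx.
have ee1 : e <= e1 by rewrite ge_min lexx orbT.
have [jac_gt0 mT tubeE] := tube e e_gt0 ee0.
set T := (X in measurable (X : set T2)) in mT tubeE.
have S0 x : 0 <= S_of Phi x.
  by rewrite S_ofE mulr_ge0 ?invr_ge0// addr_ge0// -expr2 sqr_ge0.
have Sz x : S_of Phi x = 0 -> exists y, x = ((fst \o f) y, (snd \o f) y).
  rewrite S_ofE => /eqP; rewrite mulf_eq0 invr_eq0 pnatr_eq0/=.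
  rewrite -!expr2 paddr_eq0 ?sqr_ge0// !sqrf_eq0 => /andP[/eqP Z1 /eqP Z2].
  have : fixed_points Phi x.
    rewrite /fixed_points /=; apply/eqP; rewrite -subr_eq0; apply/eqP.
    by rewrite [LHS]surjective_pairing /= Z1 Z2.
  by rewrite -frange => -[y _ <-]; exists y; rewrite -surjective_pairing.
have TP x := @tube_contains R _ _ _ _ _ _ (fun y => derive1n_is_derive 0 y df1)
  (fun y => derive1n_is_derive 0 y df2) L L0 f1L f2L h1L h2L huP vh vc e x e_gt0.
have cS : continuous (S_of Phi) by exact: smooth_fun_continuous.
have mS : measurable_fun [set: T2] (S_of Phi).
  exact: (@continuous_plane_measurable R _ cS).
have [c c_gt0 TS] := exterior_lower_bound e_gt0 p0 r0 C0 cS S0 Sz decay TP.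
have fin_S := exp_decay_integral_lty p0 C0 mS S0 decay.
apply: (heat_trace_expansion mS mT c_gt0 TS fin_S) => K.
(* Matches the determinant used by the tube formula with the factor c0 (1 + z kappa) expanded in the
   Laplace step. *)
have jacE y z : tube_jac (fst \o h) (snd \o h) (derive1n 1 (fst \o f))
    (derive1n 1 (snd \o f)) (derive1n 1 (fst \o h)) (derive1n 1 (snd \o h)) y z =
    c0 y * (1 + z * curvature f h y).
  rewrite (curvature_cross h_normal) -/(c0 y) mulrDr mulr1 mulrCA mulVKf ?gt_eqF//.
  by rewrite /tube_jac /c0 /cross /velocity/=; ring.
have jac0 : {in `[0, L], forall y z, `|z| <= e -> 0 <= 1 + z * curvature f h y}.
  move=> y yL z ze; have := jac_gt0 y yL z ze.
  by rewrite jacE pmulr_rgt0// => /ltW.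
have [CK CKP] := lapl e K e_gt0 ee1 jac0.
exists CK => t t0 t1; have [I IE IP] := CKP t t0 t1.
exists I.
  rewrite -IE -tubeE; last by move=> x; rewrite lee_fin expR_ge0.
    apply: eq_integral => y _; apply: eq_integral => z _.
    by rewrite jacE -EFinM.
  apply/measurable_EFinP/measurableT_comp => //.
  by apply: measurableT_comp => //; exact: measurable_funM.
rewrite (_ : \sum_(k < K.+1) _ = \sum_(k < K.+1) t ^+ k.*2.+1 *
  (4 * pi * \int[mu]_(y in `[0, L])
     (a_ (fun j => G j y 0) (curvature f h y) k * c0 y)))//.
apply: eq_bigr => k _; congr (_ * (_ * _)); apply: eq_Rintegral => y _.
have -> : (fun j => G j y 0) = (fun j => s_ Phi f h j y).
  by apply/funext => j; exact: sE.
by have <- : metric f y `^ 2^-1 = c0 y := metric_cross h_normal y.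
Qed.

End parametrized_curve.

Unset Implicit Arguments.
Set Strict Implicit.
Set Printing Implicit Defensive.

Theorem lemma3p3 (R : realType) (Phi : R * R -> R * R)
    (L : R) (f h : R -> R * R)
    (Phi_smooth : smooth_map_on setT Phi)
    (Phi1 : [/\ submanifold1 (fixed_points Phi), compact (fixed_points Phi)
              & connected (fixed_points Phi)])
    (Phi2 : exists p r C : R, [/\ 0 < p, 0 < r, 0 < C &
      forall x : R * R, r ^+ 2 / 2 < sigma x 0 ->
        C * (sigma x 0) `^ p <= S_of Phi x])
    (f_param : closed_parametrization (fixed_points Phi) L f)
    (h_normal : oriented_unit_normal L f h)
    (Phi3 : forall y, 0 < s_ Phi f h 2%N y) :
  let s k y := s_ Phi f h k y in
  let P k y := Psi_ Phi f h k y in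
  let kappa y := curvature f h y in
  let a k y := a_ (fun j => s j y) (kappa y) k in
  [/\ half_integer_expansion (heat_trace Phi)
        (fun k => arc_integral f L (a k)),
      forall y, a 0%N y = (4 * pi * s 2%N y) `^ (- 2^-1),
      forall y, a 1%N y = (4 * pi * s 2%N y) `^ (- 2^-1) *
        ((- (s 3%N y * kappa y) - 1 / 4 * s 4%N y) * s 2%N y ^- 2
         + 5 / 12 * s 3%N y ^+ 2 * s 2%N y ^- 3),
      forall y, a 2%N y = (4 * pi * s 2%N y) `^ (- 2^-1) *
        ((- (1 / 2 * s 5%N y * kappa y) - 1 / 12 * s 6%N y) * s 2%N y ^- 3
         + (35 / 12 * s 3%N y * s 4%N y * kappa y + 7 / 12 * s 3%N y * s 5%N y
            + 35 / 96 * s 4%N y ^+ 2) * s 2%N y ^- 4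
         + (- (35 / 12 * s 3%N y ^+ 3 * kappa y)
            - 35 / 16 * s 3%N y ^+ 2 * s 4%N y) * s 2%N y ^- 5
         + 385 / 288 * s 3%N y ^+ 4 * s 2%N y ^- 6)
    & forall y,
      [/\ s 2%N y = dot (P 1%N y) (P 1%N y),
          s 3%N y = 3 * dot (P 1%N y) (P 2%N y),
          s 4%N y = 4 * dot (P 1%N y) (P 3%N y) + 3 * dot (P 2%N y) (P 2%N y),
          s 5%N y = 5 * dot (P 1%N y) (P 4%N y) + 10 * dot (P 2%N y) (P 3%N y)
        & s 6%N y = 6 * dot (P 1%N y) (P 5%N y) + 15 * dot (P 2%N y) (P 4%N y)
                  + 10 * dot (P 3%N y) (P 3%N y)]].
Proof.
move=> s P kappa a; split.
- exact: heat_trace_half_integer_expansion.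
- by move=> y; exact: a0_value.
- by move=> y; exact: a1_value.
- by move=> y; exact: a2_value.
- move=> y; have fixy : Phi (f y) = f y.
    have [_ _ _ _ fr] := f_param.
    by have : fixed_points Phi (f y) by rewrite -fr; exists y.
  have [_ _ E2 E3 [E4 E5 E6]] := normal_derivatives h Phi_smooth fixy.
  split; [exact: E2|exact: E3|exact: E4|exact: E5|exact: E6].
Qed.
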